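(* Let $\phi,\psi:\mathbb{R}\times\mathbb{R}^k\to\mathbb{R}^k$ be continuously differentiable and $T$-periodic in $t$, and consider, for $\varepsilon>0$, the system $$\dot x=\varepsilon\phi(t,x)+\psi(t,x). \qquad (1)$$ Let $U\subset\mathbb{R}^k$ be open and bounded. Assume: (A0) $\Omega(T,0,\xi)=\xi$ for all $\xi\in\partial U$; (A1) $\eta(T,s,\xi)-\eta(0,s,\xi)\neq 0$ for all $s\in[0,T]$ and $\xi\in\partial U$; (A2) $\gamma(\eta(T,0,\cdot),U)\neq 0$. Then there exists $\varepsilon_0>0$ such that for every $\varepsilon\in(0,\varepsilon_0)$ system (1) has at least one $T$-periodic solution $x$ belonging to the set $X=\{x:\ \Omega(0,t,x(t))\in U \text{ for all } t\in[0,T]\}$.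
   Context: Standing assumption: solutions of the unperturbed system $\dot x=\psi(t,x)$ exist for all times. $\Omega(\cdot,t_0,\xi)$ denotes the solution of $\dot x=\psi(t,x)$ (i.e. system (1) with $\varepsilon=0$) satisfying $x(t_0)=\xi$. For $\xi\in\mathbb{R}^k$ consider the linear inhomogeneous system $$\dot y=\phi(t,\Omega(t,0,\xi))+\psi'_{x}(t,\Omega(t,0,\xi))\,y, \qquad (2)$$ where $\psi'_x$ is the Jacobian matrix of $\psi$ with respect to its second (spatial) variable. $\eta(\cdot,s,\xi)$ denotes the solution $y$ of (2) satisfying $y(s)=0$. For a continuous map $F:\bar U\to\mathbb{R}^k$ on the closure of a bounded open set $U$ with $F(\xi)\neq0$ on $\partial U$, $\gamma(F,U)$ denotes the rotation number (Brouwer degree $\deg(F,U,0)$) of the vector field $F$ on $\partial U$. *)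

(* Defs.v *)
From mathcomp Require Import all_boot all_fingroup.
From Stdlib Require Import Reals ZArith.
Set Implicit Arguments. Unset Strict Implicit. Unset Printing Implicit Defensive.

Local Open Scope R_scope.

Definition Vec (k : nat) := 'I_k -> R.
Definition Mat (k : nat) := 'I_k -> 'I_k -> R.

Definition vadd {k} (u v : Vec k) : Vec k := fun i => u i + v i.
Definition vsub {k} (u v : Vec k) : Vec k := fun i => u i - v i.
Definition vscale {k} (a : R) (v : Vec k) : Vec k := fun i => a * v i.
Definition vzero {k} : Vec k := fun _ => 0.
Definition mapp {k} (M : Mat k) (v : Vec k) : Vec k :=
  fun i => \big[Rplus/0]_(j < k) (M i j * v j).
Definition vnorm {k} (v : Vec k) : R := \big[Rmax/0]_(i < k) Rabs (v i).
Definition mdet {k} (M : Mat k) : R :=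
  \big[Rplus/0]_(s : 'S_k)
     ((if odd_perm s then (-1) else 1) * \big[Rmult/1]_(i < k) M i (s i)).

Definition is_open {k} (U : Vec k -> Prop) : Prop :=
  forall x, U x -> exists r, 0 < r /\ forall y, vnorm (vsub y x) < r -> U y.
Definition is_bounded {k} (U : Vec k -> Prop) : Prop :=
  exists M, forall x, U x -> vnorm x <= M.
Definition closure {k} (U : Vec k -> Prop) (x : Vec k) : Prop :=
  forall r, 0 < r -> exists y, U y /\ vnorm (vsub y x) < r.
Definition boundary {k} (U : Vec k -> Prop) (x : Vec k) : Prop :=
  closure U x /\ ~ U x.

Definition frechet {k} (f : Vec k -> Vec k) (x : Vec k) (M : Mat k) : Prop :=
  forall eps, 0 < eps -> exists del, 0 < del /\
    forall h, vnorm h < del ->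
      vnorm (vsub (vsub (f (vadd x h)) (f x)) (mapp M h)) <= eps * vnorm h.

Definition C1 {k} (f : Vec k -> Vec k) : Prop :=
  exists Df : Vec k -> Mat k,
    (forall x, frechet f x (Df x)) /\
    (forall x eps, 0 < eps -> exists del, 0 < del /\
       forall y, vnorm (vsub y x) < del ->
         forall i j, Rabs (Df y i j - Df x i j) < eps).

Definition C1_tx_with {k} (f : R -> Vec k -> Vec k) (Dx : R -> Vec k -> Mat k) : Prop :=
  exists Dt : R -> Vec k -> Vec k,
    (forall t x eps, 0 < eps -> exists del, 0 < del /\
       forall s h, Rabs s < del -> vnorm h < del ->
         vnorm (vsub (vsub (f (t + s) (vadd x h)) (f t x))
                     (vadd (vscale s (Dt t x)) (mapp (Dx t x) h)))
           <= eps * Rmax (Rabs s) (vnorm h)) /\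
    (forall t x eps, 0 < eps -> exists del, 0 < del /\
       forall t' x', Rabs (t' - t) < del -> vnorm (vsub x' x) < del ->
         vnorm (vsub (Dt t' x') (Dt t x)) < eps /\
         forall i j, Rabs (Dx t' x' i j - Dx t x i j) < eps).

Definition C1_tx {k} (f : R -> Vec k -> Vec k) : Prop :=
  exists Dx, C1_tx_with f Dx.

Definition T_periodic {k} (T : R) (f : R -> Vec k -> Vec k) : Prop :=
  forall t x, f (t + T) x = f t x.

Definition is_solution {k} (f : R -> Vec k -> Vec k) (x : R -> Vec k) : Prop :=
  forall t (i : 'I_k), derivable_pt_lim (fun s => x s i) t (f t (x t) i).

Definition sgnZ (r : R) : Z := if Rlt_dec 0 r then 1%Z else (-1)%Z.

Definition cont_on_closure {k} (F : Vec k -> Vec k) (U : Vec k -> Prop) : Prop :=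
  forall x, closure U x -> forall eps, 0 < eps -> exists del, 0 < del /\
    forall y, closure U y -> vnorm (vsub y x) < del -> vnorm (vsub (F y) (F x)) < eps.

(* has_degree F U d : gamma(F,U) = deg(F,U,0) = d.  Standard analytic
   definition: F is continuous on cl U and nonvanishing on the boundary, and
   for every C^1 map G uniformly close enough to F on cl U having 0 as a
   regular value in U, the zero set of G in U is finite and the sum of the
   signs of det G' over it equals d. *)
Definition has_degree {k} (F : Vec k -> Vec k) (U : Vec k -> Prop) (d : Z) : Prop :=
  cont_on_closure F U /\
  (forall x, boundary U x -> F x <> vzero) /\
  exists delta, 0 < delta /\
    forall (G : Vec k -> Vec k) (DG : Vec k -> Mat k),
      (forall x, frechet G x (DG x)) -> C1 G ->
      (forall x, closure U x -> vnorm (vsub (F x) (G x)) < delta) ->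
      (forall x, U x -> G x = vzero -> mdet (DG x) <> 0) ->
      exists l : list (Vec k),
        List.NoDup l /\
        (forall x, List.In x l <-> (U x /\ G x = vzero)) /\
        d = List.fold_right (fun x acc => (sgnZ (mdet (DG x)) + acc)%Z) 0%Z l.

(* Main.v *)
(** Write [P xi] for the value at time [T] of the perturbed solution that starts at [xi] at
    time [0].  By Gronwall's inequality the perturbed solution through [(s, Omega(s,0,xi))] is
    [Omega(t,0,xi) + eps eta(t,s,xi) + o(eps)], uniformly on bounded sets.  With [s = 0] and
    (A0), the map [(P - id)/eps] is therefore close to [eta(T,0,.)] on the boundary of [U], so
    it has the same degree and vanishes at some point of [U].  This gives a T-periodic solution
    [x].  If [Omega(0,t,x(t))] left [U], it would meet the boundary at some time [s] in a point
    [xi]; the expansion through [(s, xi)] and [x(T) = x(0)] give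
    [eta(T,s,xi) - eta(0,s,xi) = o(1)], against (A1).

    The homotopy invariance of the degree is obtained without integrals: for a bump function
    [w] of small support, the Riemann sums of [w(h) det Dh] over a fine grid count the zeros of
    [h] with sign.  Along a homotopy, the derivative of [w(h) det Dh] is the divergence of a
    field that vanishes near the boundary, so its Riemann sums telescope up to [o(1)]. *)

(* [has_degree] speaks of [F] only through nearby C1 maps with 0 as a regular value. Before it can
   be used, [F] has to be replaced by a smooth map and a small regular value of that map subtracted,
   by a Sard argument; a homotopy then leads to the other map. The divergence identity involves
   second derivatives, and the Riemann sums tolerate an error of order mesh squared per node; hence
   the smooth class consists of functions with locally Lipschitz second derivatives. The sums are
   compared with those of the identity map, so the degree appears as a ratio and no integral is
   formed.

   For the differential equations the obstacle is that the fields are only C1, so perturbed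
   solutions may blow up. They are replaced by solutions of a system truncated outside a box, which
   is globally Lipschitz in space. The box is fixed before [eps], and for small [eps] the relevant
   solutions stay inside it, where the truncation changes nothing. *)
From mathcomp Require Import all_boot all_fingroup all_algebra zify.
From mathcomp Require Import Rstruct.
From mathcomp Require boolp.
From Stdlib Require Import Reals Ranalysis5 ZArith Lra Classical ClassicalEpsilon.
From Stdlib Require Import FunctionalExtensionality.
From Coquelicot Require Import Coquelicot.
Require Import Defs.
Set Implicit Arguments. Unset Strict Implicit. Unset Printing Implicit Defensive.
Delimit Scope ring_scope with ring.
Delimit Scope nat_scope with N.
Local Open Scope R_scope.

(** * Finite sums, the sup norm, compactness *)

Notation "\rsum_ ( i | P ) F" := (\big[Rplus/0]_(i | P%B) F)
  (at level 41, F at level 41, i, P at level 50).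
Notation "\rsum_ i F" := (\big[Rplus/0]_i F) (at level 41, i at level 0, F at level 41).

Lemma rsum_le (I : finType) (P : pred I) (F G : I -> R) :
  (forall i, P i -> F i <= G i) -> \rsum_(i | P i) F i <= \rsum_(i | P i) G i.
Proof. move=> h; apply: (big_ind2 Rle) => //; [lra | move=> *; lra]. Qed.

Lemma rsum_ge0 (I : finType) (P : pred I) (F : I -> R) :
  (forall i, P i -> 0 <= F i) -> 0 <= \rsum_(i | P i) F i.
Proof. move=> h; apply: (big_ind (Rle 0)) => //; [lra | move=> *; lra]. Qed.

Lemma rsum_abs (I : finType) (P : pred I) (F : I -> R) :
  Rabs (\rsum_(i | P i) F i) <= \rsum_(i | P i) Rabs (F i).
Proof.
apply: (big_ind2 (fun a b => Rabs a <= b)) => //; first by rewrite Rabs_R0; lra.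
- by move=> a b c d h1 h2; have := Rabs_triang a c; lra.
- by move=> *; lra.
Qed.

Lemma rsum_scal (I : finType) (P : pred I) (c : R) (F : I -> R) :
  c * (\rsum_(i | P i) F i) = \rsum_(i | P i) (c * F i).
Proof. by rewrite big_distrr. Qed.

Lemma rsum_scalr (I : finType) (P : pred I) (c : R) (F : I -> R) :
  (\rsum_(i | P i) F i) * c = \rsum_(i | P i) (F i * c).
Proof. by rewrite big_distrl. Qed.

Lemma rsum_sub (I : finType) (P : pred I) (F G : I -> R) :
  \rsum_(i | P i) F i - \rsum_(i | P i) G i = \rsum_(i | P i) (F i - G i).
Proof.
have -> : \rsum_(i | P i) F i - \rsum_(i | P i) G i
        = \rsum_(i | P i) F i + (-1) * (\rsum_(i | P i) G i) by ring.
by rewrite rsum_scal -big_split /=; apply: eq_bigr => i _; ring.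
Qed.

Lemma rsum_const (I : finType) (c : R) : \big[Rplus/0]_(i : I) c = INR #|I| * c.
Proof.
rewrite big_const cardE; elim: (size _) => [|n IH] /=; first by ring.
rewrite IH; case: n {IH} => [|n] /=; ring.
Qed.

Lemma rsum_le_const (I : finType) (F : I -> R) c :
  (forall i, F i <= c) -> \rsum_i F i <= INR #|I| * c.
Proof. by move=> h; rewrite -rsum_const; apply: rsum_le. Qed.

Lemma rsum_le_ord (n : nat) (F : 'I_n -> R) c :
  (forall i, F i <= c) -> \rsum_i F i <= INR n * c.
Proof. by move=> h; have := rsum_le_const h; rewrite card_ord. Qed.

Lemma rsum_ge_term (I : finType) (F : I -> R) i :
  (forall i, 0 <= F i) -> F i <= \rsum_i F i.
Proof.
move=> h; rewrite (bigD1 i) //=.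
have := @rsum_ge0 _ (fun j => j != i) F (fun j _ => h j); lra.
Qed.

(** Dividing by [K + 1] covers [K = 0]; the cap [r <= 1] keeps points in the unit neighbourhood on
    which a local Lipschitz constant [K] was computed. *)
Lemma small_mult K e : 0 <= K -> 0 < e ->
  exists r, 0 < r <= 1 /\ forall n, 0 <= n -> n < r -> K * n < e.
Proof.
move=> K0 e0; have q0 : 0 < e / (K + 1) by apply: Rdiv_lt_0_compat; lra.
exists (Rmin 1 (e / (K + 1))); split; first by split; [apply: Rmin_glb_lt; lra | apply: Rmin_l].
move=> n n0 hn; have h := Rlt_le_trans _ _ _ hn (Rmin_r _ _).
have e1 : (K + 1) * (e / (K + 1)) = e by field; lra.
nra.
Qed.

Lemma lt_minl x a b : x < Rmin a b -> x < a.
Proof. by have := Rmin_l a b; lra. Qed.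

Lemma lt_minr x a b : x < Rmin a b -> x < b.
Proof. by have := Rmin_r a b; lra. Qed.

Lemma le_minl x a b : x <= Rmin a b -> x <= a.
Proof. by have := Rmin_l a b; lra. Qed.

Lemma le_minr x a b : x <= Rmin a b -> x <= b.
Proof. by have := Rmin_r a b; lra. Qed.

Lemma max_ltl x a b : Rmax a b < x -> a < x.
Proof. by have := Rmax_l a b; lra. Qed.

Lemma max_ltr x a b : Rmax a b < x -> b < x.
Proof. by have := Rmax_r a b; lra. Qed.

Definition clamp a b s := Rmax a (Rmin b s).

Lemma clampP a b s : a <= b -> (s <= a /\ clamp a b s = a) \/
  (a <= s <= b /\ clamp a b s = s) \/ (b <= s /\ clamp a b s = b).
Proof.
rewrite /clamp => ab; have [h1|h1] := Rle_lt_dec s b.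
  rewrite (Rmin_right _ _ h1); have [h2|h2] := Rle_lt_dec s a.
    by left; rewrite Rmax_left.
  by right; left; rewrite Rmax_right; lra.
by right; right; rewrite Rmin_left ?Rmax_right; lra.
Qed.

Lemma vec_eq k (u v : Vec k) : (forall i, u i = v i) -> u = v.
Proof. exact: functional_extensionality. Qed.

Ltac vec_ring := apply: vec_eq => ?; rewrite /vadd /vsub /vscale /vzero; ring.

Section Norm.
Variable k : nat.
Implicit Types u v w : Vec k.

Lemma mat_eq (A B : Mat k) : (forall i j, A i j = B i j) -> A = B.
Proof. by move=> h; do 2 (apply: functional_extensionality => ?); apply: h. Qed.

Lemma vnorm_ge0 u : 0 <= vnorm u.
Proof.
rewrite /vnorm; apply: (big_ind (fun x => 0 <= x)); first lra.
- by move=> x y hx hy; apply: Rle_trans hx (Rmax_l _ _).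
- by move=> i _; apply: Rabs_pos.
Qed.

Lemma vnorm_coord u i : Rabs (u i) <= vnorm u.
Proof.
rewrite /vnorm; have : i \in index_enum 'I_k by rewrite mem_index_enum.
elim: (index_enum _) => // j s IH; rewrite inE big_cons => /orP [/eqP <-|/IH h].
- exact: Rmax_l.
- exact: Rle_trans h (Rmax_r _ _).
Qed.

Lemma vnorm_lub u c : 0 <= c -> (forall i, Rabs (u i) <= c) -> vnorm u <= c.
Proof.
move=> h0 h; rewrite /vnorm; apply: (big_ind (fun x => x <= c)) => //.
by move=> x y hx hy; apply: Rmax_lub.
Qed.

Lemma vnorm_lt u c : 0 < c -> (forall i, Rabs (u i) < c) -> vnorm u < c.
Proof.
move=> h0 h; rewrite /vnorm; apply: (big_ind (fun x => x < c)) => //.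
by move=> x y hx hy; apply: Rmax_lub_lt.
Qed.

Lemma vnorm_zero : vnorm (@vzero k) = 0.
Proof.
apply: Rle_antisym (vnorm_ge0 _); apply: vnorm_lub; first lra.
by move=> i; rewrite /vzero Rabs_R0; lra.
Qed.

Lemma vnorm_eq0 u : vnorm u <= 0 -> u = vzero.
Proof.
move=> h; apply: vec_eq => i; have h1 := vnorm_coord u i.
have h2 := Rabs_pos (u i); apply: NNPP => h3.
have := Rabs_pos_lt _ h3; lra.
Qed.

Lemma vnorm_pos u : u <> vzero -> 0 < vnorm u.
Proof. by move=> h; apply: Rnot_le_lt => /vnorm_eq0. Qed.

Lemma vnorm_add u v : vnorm (vadd u v) <= vnorm u + vnorm v.
Proof.
apply: vnorm_lub => [|i]; first by have := vnorm_ge0 u; have := vnorm_ge0 v; lra.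
rewrite /vadd; have := Rabs_triang (u i) (v i).
by have := vnorm_coord u i; have := vnorm_coord v i; lra.
Qed.

Lemma vnorm_scale a u : vnorm (vscale a u) = Rabs a * vnorm u.
Proof.
apply: Rle_antisym.
  apply: vnorm_lub => [|i].
    by apply: Rmult_le_pos (vnorm_ge0 _); apply: Rabs_pos.
  rewrite /vscale Rabs_mult; apply: Rmult_le_compat_l (vnorm_coord _ _); exact: Rabs_pos.
have [->|ha] := Req_dec a 0; first by rewrite Rabs_R0 Rmult_0_l; apply: vnorm_ge0.
have ha' := Rabs_pos_lt _ ha.
apply: (Rmult_le_reg_l (/ Rabs a)); first exact: Rinv_0_lt_compat.
rewrite -Rmult_assoc Rinv_l ?Rmult_1_l; last lra.
apply: vnorm_lub => [|i].
  apply: Rmult_le_pos (vnorm_ge0 _); apply: Rlt_le; exact: Rinv_0_lt_compat.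
apply: (Rmult_le_reg_l (Rabs a)) => //.
rewrite -Rmult_assoc Rinv_r ?Rmult_1_l; last lra.
by rewrite -Rabs_mult; apply: (vnorm_coord (vscale a u)).
Qed.

Lemma vnorm_sub_sym u v : vnorm (vsub u v) = vnorm (vsub v u).
Proof. by rewrite /vnorm; apply: eq_bigr => i _; rewrite /vsub Rabs_minus_sym. Qed.

Lemma vnorm_sub_tri u v w : vnorm (vsub u w) <= vnorm (vsub u v) + vnorm (vsub v w).
Proof.
have -> : vsub u w = vadd (vsub u v) (vsub v w) by vec_ring.
exact: vnorm_add.
Qed.

Lemma vnorm_le_sub u v : vnorm u <= vnorm v + vnorm (vsub u v).
Proof.
have -> : u = vadd v (vsub u v) by vec_ring.
have -> : vsub (vadd v (vsub u v)) v = vsub u v by vec_ring.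
exact: vnorm_add.
Qed.

Lemma vnorm_sub_le u v : vnorm (vsub u v) <= vnorm u + vnorm v.
Proof.
have -> : vsub u v = vadd u (vscale (-1) v) by vec_ring.
have := vnorm_add u (vscale (-1) v); rewrite vnorm_scale Rabs_Ropp Rabs_R1; lra.
Qed.

Lemma vsubxx u : vsub u u = vzero.
Proof. by vec_ring. Qed.

Lemma vsub_eq0 u v : vsub u v = vzero -> u = v.
Proof. by move=> h; apply: vec_eq => i; have := f_equal (fun w => w i) h; rewrite /vsub /vzero /=; lra. Qed.

Lemma mapp_sub (M : Mat k) u v : mapp M (vsub u v) = vsub (mapp M u) (mapp M v).
Proof.
apply: vec_eq => i; rewrite /vsub /mapp rsum_sub; apply: eq_bigr => j _; ring.
Qed.

Lemma mapp_scale (M : Mat k) c v : mapp M (vscale c v) = vscale c (mapp M v).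
Proof. by apply: vec_eq => i; rewrite /vscale /mapp rsum_scal; apply: eq_bigr => j _; ring. Qed.

Lemma mapp_bound (M : Mat k) a v :
  (forall i j, Rabs (M i j) <= a) -> vnorm (mapp M v) <= INR k * a * vnorm v.
Proof.
move=> h; have v0 := vnorm_ge0 v.
(* In dimension 0 the hypothesis is void and [a] may be negative, but then [INR k = 0]. *)
have [a0|a0] : k = 0%nat \/ 0 <= a.
- case: (k) M v h v0 => [|n] M v h v0; first by left.
  right; exact: Rle_trans (Rabs_pos _) (h ord0 ord0).
- apply: vnorm_lub => [|i]; last by move: (ltn_ord i); rewrite {2}a0.
  have -> : INR k = 0 by rewrite a0.
  lra.
have k0 := pos_INR k.
apply: vnorm_lub => [|i]; first by apply: Rmult_le_pos => //; apply: Rmult_le_pos.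
rewrite /mapp; apply: Rle_trans (rsum_abs _ _) _.
rewrite Rmult_assoc; apply: rsum_le_ord => j.
rewrite Rabs_mult; apply: Rmult_le_compat => //; try exact: Rabs_pos; exact: vnorm_coord.
Qed.

End Norm.

(* A monotone family of conditions [Q c] that holds locally with some c > 0 holds
   uniformly on a compact box; all compactness arguments go through this form. *)
Definition compact_in (X : Type) (B : X -> Prop) (d : X -> X -> R) :=
  forall Q : R -> X -> Prop,
  (forall c c' x, 0 < c' -> c' <= c -> Q c x -> Q c' x) ->
  (forall p, B p -> exists c, 0 < c /\ forall y, B y -> d y p < c -> Q c y) ->
  exists c, 0 < c /\ forall y, B y -> Q c y.

(** Boundedness becomes a condition monotone in [c] once the bound is written as [/ c]. *)
Lemma compact_bounded (X : Type) (B : X -> Prop) d (N : X -> R) : compact_in B d ->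
  (forall p, B p -> exists c K, 0 < c /\ forall y, B y -> d y p < c -> N y <= K) ->
  exists K, 0 < K /\ forall y, B y -> N y <= K.
Proof.
move=> cB h; have [c c' x c0 cc hx|p Bp|c [c0 hc]] := cB (fun c y => N y <= / c).
- by apply: Rle_trans hx _; apply: Rinv_le_contravar.
- have [c [K [c0 hK]]] := h p Bp; have k0 := Rabs_pos K.
  have i0 : 0 < / (Rabs K + 1) by apply: Rinv_0_lt_compat; lra.
  exists (Rmin c (/ (Rabs K + 1))); split; first exact: Rmin_glb_lt.
  move=> y By /lt_minl /(hK y By) hy; apply: (Rle_trans _ (Rabs K + 1)).
    by have := Rle_abs K; lra.
  rewrite -{1}[_ + 1]Rinv_inv; apply: Rinv_le_contravar; last exact: Rmin_r.
  exact: Rmin_glb_lt.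
- by exists (/ c); split => //; apply: Rinv_0_lt_compat.
Qed.

Lemma compact_interval a b : compact_in (fun t => a <= t <= b) (fun s t => Rabs (s - t)).
Proof.
move=> Q mono loc.
have [ab|ab] := Rle_lt_dec a b; last by exists 1; split; [lra | move=> y; lra].
(* Heine-Borel by a supremum: [s] bounds the points up to which one constant works, and the local
   constant at [s] reaches beyond [s], so [s] cannot fall short of [b]. *)
pose E x := a <= x <= b /\ exists c, 0 < c /\ forall y, a <= y <= x -> Q c y.
have Ea : E a.
  split; first lra.
  have [c [c0 hc]] := loc a (conj (Rle_refl _) ab); exists c; split => // y hy.
  by apply: hc; [lra | replace (y - a) with 0 by lra; rewrite Rabs_R0].
have bE : bound E by exists b => x [hx _]; lra.
have [s [ub lub]] := completeness E bE (ex_intro _ a Ea).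
have sab : a <= s <= b by split; [exact: ub | apply: lub => x [hx _]; lra].
have [c [c0 hc]] := loc s sab.
have [x [Ex xs]] : exists x, E x /\ s - c < x.
  apply: NNPP => h; have : s <= s - c; last lra.
  apply: lub => x Ex; apply: Rnot_lt_le => hx; apply: h; by exists x.
case: Ex => xab [c1 [c10 hc1]].
have hx := ub _ (conj xab (ex_intro _ c1 (conj c10 hc1))).
have hm : 0 < Rmin c c1 by apply: Rmin_glb_lt.
have ext y : a <= y <= b -> y < s + c -> Q (Rmin c c1) y.
  move=> hy hys; have [yx|yx] := Rle_lt_dec y x.
    by apply: (mono c1) => //; [apply: Rmin_r | apply: hc1; lra].
  apply: (mono c) => //; first exact: Rmin_l.
  by apply: hc => //; apply: Rabs_def1; lra.
have [bs|bs] := Rlt_le_dec b (s + c).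
  by exists (Rmin c c1); split => // y hy; apply: ext => //; lra.
have : s + c / 2 <= s; last lra.
apply: ub; split; first lra.
by exists (Rmin c c1); split => // y hy; apply: ext; lra.
Qed.

(** The tube argument: compactness of the first factor gives, near each [y], one constant for the
    whole slice; compactness of the second joins the slices. *)
Lemma compact_prod (X Y : Type) BX BY (dX : X -> X -> R) (dY : Y -> Y -> R) :
  compact_in BX dX -> compact_in BY dY ->
  compact_in (fun p => BX p.1 /\ BY p.2) (fun p q => Rmax (dX p.1 q.1) (dY p.2 q.2)).
Proof.
move=> cX cY Q mono loc.
have [|y hy|c [c0 hc]] := cY (fun c y => forall x, BX x -> Q c (x, y)).
- by move=> c c' y c0 cc h x Bx; apply: (mono c) => //; apply: h.
- have [|x Bx|c [c0 hc]] := cX (fun c x => forall y', BY y' -> dY y' y < c -> Q c (x, y')).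
  + by move=> c c' x c0 cc h y' By' hd; apply: (mono c) => //; apply: h => //; lra.
  + have [c [c0 hc]] := loc (x, y) (conj Bx hy).
    exists c; split => // x' Bx' hx' y' By' hy'.
    by apply: hc => //=; apply: Rmax_lub_lt.
  + by exists c; split => // y' By' hd x Bx; apply: hc.
- by exists c; split => // -[x y] [/= Bx By]; apply: hc.
Qed.

Lemma compact_image (X Y : Type) BX BY (dX : X -> X -> R) (dY : Y -> Y -> R) (f : X -> Y) :
  (forall x, BX x -> BY (f x)) -> (forall y, BY y -> exists x, BX x /\ f x = y) ->
  (forall x x', dY (f x) (f x') <= dX x x') ->
  compact_in BX dX -> compact_in BY dY.
Proof.
move=> fB surj lip cX Q mono loc.
have [|x Bx|c [c0 hc]] := cX (fun c x => Q c (f x)).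
- by move=> c c' x; apply: mono.
- have [c [c0 hc]] := loc _ (fB _ Bx).
  exists c; split => // x' Bx' hx'; apply: hc; first exact: fB.
  exact: Rle_lt_trans (lip _ _) hx'.
- by exists c; split => // y /surj [x [Bx <-]]; apply: hc.
Qed.

(** Induction on [k]: the box in dimension [k.+1] is a 1-Lipschitz image of an interval times the
    box in dimension [k]. For [M < 0] it is empty. *)
Lemma compact_box (k : nat) (M : R) :
  compact_in (fun x : Vec k => vnorm x <= M) (fun x y => vnorm (vsub x y)).
Proof.
elim: k => [|k IH].
  move=> Q mono loc; have [h|h] := Rle_lt_dec 0 M; last first.
    by exists 1; split; [lra | move=> y; have := vnorm_ge0 y; lra].
  have all0 (y : Vec 0) : y = vzero by apply: vec_eq => -[].
  have [|c [c0 hc]] := loc vzero; first by rewrite vnorm_zero.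
  by exists c; split => // y hy; apply: hc => //; rewrite (all0 y) vsubxx vnorm_zero.
pose f (p : R * Vec k) : Vec k.+1 := fun i => if unlift ord0 i is Some j then p.2 j else p.1.
have [M0|M0] := Rle_lt_dec 0 M; last first.
  by move=> Q _ _; exists 1; split; [lra | move=> y; have := vnorm_ge0 y; lra].
refine (compact_image (f := f) _ _ _ (compact_prod (@compact_interval (- M) M) IH)).
- move=> [t x] [/= ht hx]; apply: vnorm_lub => // i; rewrite /f.
  case: unliftP => [j _|_] /=; first exact: Rle_trans (vnorm_coord _ _) hx.
  exact: Rabs_le.
- move=> y hy; exists (y ord0, fun j => y (lift ord0 j)); split.
    split => /=; first by apply/Rabs_le_between; apply: Rle_trans (vnorm_coord _ _) hy.
    by apply: vnorm_lub => // j; apply: Rle_trans (vnorm_coord y _) hy.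
  by apply: vec_eq => i; rewrite /f; case: unliftP => [j ->|->].
- move=> [t x] [t' x'] /=; apply: vnorm_lub => [|i].
    exact: Rle_trans (Rabs_pos _) (Rmax_l _ _).
  rewrite /vsub /f; case: unliftP => [j _|_] /=; last exact: Rmax_l.
  exact: Rle_trans (vnorm_coord (vsub x x') j) (Rmax_r _ _).
Qed.

(** * Functions of class C2 *)

Lemma dlim_ext (f g : R -> R) x a b :
  (forall s, f s = g s) -> a = b -> derivable_pt_lim f x a -> derivable_pt_lim g x b.
Proof. by move=> h <-; have -> : f = g by apply: functional_extensionality. Qed.

Lemma dlim_sum (I : finType) (F : I -> R -> R) (F' : I -> R) x :
  (forall i, derivable_pt_lim (F i) x (F' i)) ->
  derivable_pt_lim (fun s => \rsum_i F i s) x (\rsum_i F' i).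
Proof.
move=> h; elim: (index_enum I) => [|i r IH].
  by apply: dlim_ext (derivable_pt_lim_const 0 x) => [s|]; rewrite big_nil.
by apply: dlim_ext (derivable_pt_lim_plus _ _ _ _ _ (h i) IH) => [s|]; rewrite big_cons.
Qed.

Lemma dlim_prod (k : nat) (F : 'I_k -> R -> R) (F' : 'I_k -> R) x :
  (forall i, derivable_pt_lim (F i) x (F' i)) ->
  derivable_pt_lim (fun s => \big[Rmult/1]_i F i s) x
    (\big[Rplus/0]_l \big[Rmult/1]_i (if i == l then F' i else F i x)).
Proof.
elim: k F F' => [|k IH] F F' h.
  by apply: dlim_ext (derivable_pt_lim_const 1 x) => [s|]; rewrite big_ord0.
have h' := IH (fun i => F (lift ord0 i)) (fun i => F' (lift ord0 i)) (fun i => h _).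
apply: dlim_ext (derivable_pt_lim_mult _ _ _ _ _ (h ord0) h') => [s|].
  by rewrite big_ord_recl.
rewrite big_ord_recl; congr (_ + _).
  by rewrite big_ord_recl eqxx.
rewrite rsum_scal; apply: eq_bigr => l _.
by rewrite big_ord_recl.
Qed.

Definition lip_on_bounded (phi : R -> R) :=
  forall M, exists K, 0 <= K /\ forall s t, Rabs s <= M -> Rabs t <= M ->
    Rabs (phi s) <= K /\ Rabs (phi s - phi t) <= K * Rabs (s - t).

Section Lip.
Variables (k : nat) (A : Type).
Implicit Types f g : A -> Vec k -> R.

(** One [K] serves as bound and as Lipschitz constant, for all parameters [a] at once. The parameter
    is trivial for a single function, an index for a finite family, a time in [[0,1]] for a
    homotopy. *)
Definition ulip f := forall M, exists K, 0 <= K /\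
  forall a x y, vnorm x <= M -> vnorm y <= M ->
    Rabs (f a x) <= K /\ Rabs (f a x - f a y) <= K * vnorm (vsub x y).

Lemma ulip_ext f g : (forall a x, f a x = g a x) -> ulip f -> ulip g.
Proof.
move=> h hf M; have [K [K0 hK]] := hf M; exists K; split => // a x y.
by rewrite -!h; apply: hK.
Qed.

Lemma ulip_const (c : A -> R) C : (forall a, Rabs (c a) <= C) -> ulip (fun a _ => c a).
Proof.
move=> h M; exists (Rmax 0 C); split; first exact: Rmax_l.
move=> a x y _ _; split; first exact: Rle_trans (h a) (Rmax_r _ _).
rewrite Rminus_diag Rabs_R0; apply: Rmult_le_pos (vnorm_ge0 _); exact: Rmax_l.
Qed.

Lemma ulip_coord i : ulip (fun _ x => x i).
Proof.
move=> M; exists (Rmax 1 M); split; first by have := Rmax_l 1 M; lra.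
move=> a x y hx hy; split.
  by have := vnorm_coord x i; have := Rmax_r 1 M; lra.
have := vnorm_coord (vsub x y) i; rewrite {1}/vsub => h; apply: Rle_trans h _.
rewrite -{1}[vnorm _]Rmult_1_l; apply: Rmult_le_compat_r (vnorm_ge0 _) _; exact: Rmax_l.
Qed.

Lemma ulip_add f g : ulip f -> ulip g -> ulip (fun a x => f a x + g a x).
Proof.
move=> hf hg M; have [K [K0 hK]] := hf M; have [L [L0 hL]] := hg M.
exists (K + L); split; first lra.
move=> a x y hx hy; have [h1 h2] := hK a x y hx hy; have [h3 h4] := hL a x y hx hy.
split; first by have := Rabs_triang (f a x) (g a x); lra.
have -> : f a x + g a x - (f a y + g a y) = (f a x - f a y) + (g a x - g a y) by ring.
by have := Rabs_triang (f a x - f a y) (g a x - g a y); lra.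
Qed.

Lemma ulip_mul f g : ulip f -> ulip g -> ulip (fun a x => f a x * g a x).
Proof.
move=> hf hg M; have [K [K0 hK]] := hf M; have [L [L0 hL]] := hg M.
have KL := Rmult_le_pos _ _ K0 L0.
exists (2 * (K * L)); split; first lra.
move=> a x y hx hy; have [h1 h2] := hK a x y hx hy; have [h3 h4] := hL a x y hx hy.
have [h5 _] := hL a y x hy hx; have n0 := vnorm_ge0 (vsub x y).
split.
  rewrite Rabs_mult; have := Rmult_le_compat _ _ _ _ (Rabs_pos _) (Rabs_pos _) h1 h3; lra.
have -> : f a x * g a x - f a y * g a y
    = f a x * (g a x - g a y) + (f a x - f a y) * g a y by ring.
apply: Rle_trans (Rabs_triang _ _) _; rewrite !Rabs_mult.
have := Rmult_le_compat _ _ _ _ (Rabs_pos _) (Rabs_pos _) h1 h4.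
have := Rmult_le_compat _ _ _ _ (Rabs_pos _) (Rabs_pos _) h2 h5; lra.
Qed.

Lemma ulip_sum (I : finType) (P : pred I) (F : I -> A -> Vec k -> R) :
  (forall i, ulip (F i)) -> ulip (fun a x => \rsum_(i | P i) F i a x).
Proof.
move=> h; elim: (index_enum I) => [|i r IH].
  apply: (ulip_ext (f := fun _ _ => 0)) => [a x|]; first by rewrite big_nil.
  by apply: (@ulip_const (fun=> 0) 0) => a; rewrite Rabs_R0; lra.
case Pi: (P i); last by apply: ulip_ext IH => a x; rewrite big_cons Pi.
by apply: ulip_ext (ulip_add (h i) IH) => a x; rewrite big_cons Pi.
Qed.

Lemma ulip_prod (I : finType) (P : pred I) (F : I -> A -> Vec k -> R) :
  (forall i, ulip (F i)) -> ulip (fun a x => \big[Rmult/1]_(i | P i) F i a x).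
Proof.
move=> h; elim: (index_enum I) => [|i r IH].
  apply: (ulip_ext (f := fun _ _ => 1)) => [a x|]; first by rewrite big_nil.
  by apply: (@ulip_const (fun=> 1) 1) => a; rewrite Rabs_R1; lra.
case Pi: (P i); last by apply: ulip_ext IH => a x; rewrite big_cons Pi.
by apply: ulip_ext (ulip_mul (h i) IH) => a x; rewrite big_cons Pi.
Qed.

Lemma ulip_scale c f : ulip f -> ulip (fun a x => c * f a x).
Proof. by apply: ulip_mul; apply: (@ulip_const (fun=> c) (Rabs c)) => a; apply: Rle_refl. Qed.

Lemma ulip_comp (phi : R -> R) f :
  lip_on_bounded phi -> ulip f -> ulip (fun a x => phi (f a x)).
Proof.
move=> hp hf M; have [K [K0 hK]] := hf M; have [L [L0 hL]] := hp K.
exists (Rmax L (L * K)); split; first exact: Rle_trans L0 (Rmax_l _ _).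
move=> a x y hx hy; have [h1 h2] := hK a x y hx hy; have [h5 _] := hK a y x hy hx.
have [h3 h4] := hL _ _ h1 h5; split; first exact: Rle_trans h3 (Rmax_l _ _).
apply: Rle_trans h4 _; apply: Rle_trans (Rmult_le_compat_l _ _ _ L0 h2) _.
rewrite -Rmult_assoc; apply: Rmult_le_compat_r (vnorm_ge0 _) _; exact: Rmax_r.
Qed.

Lemma ulip_det (M : A -> Vec k -> Mat k) :
  (forall i j, ulip (fun a x => M a x i j)) -> ulip (fun a x => mdet (M a x)).
Proof.
move=> h; apply: ulip_sum => s; apply: ulip_scale; apply: ulip_prod => i; exact: h.
Qed.

End Lip.

Lemma ulip_reindex (k : nat) (A B : Type) (g : B -> A) (f : A -> Vec k -> R) :
  ulip f -> ulip (fun b => f (g b)).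
Proof. by move=> h M; have [K [K0 hK]] := h M; exists K; split => // b; apply: hK. Qed.

Section C2.
Variable k : nat.
Implicit Types x v : Vec k.

Definition line x v (s : R) : Vec k := vadd x (vscale s v).

Definition loclip (f : Vec k -> R) := ulip (fun _ : unit => f).

Lemma ulip_fin (I : finType) (F : I -> Vec k -> R) :
  (forall i, loclip (F i)) -> ulip F.
Proof.
move=> h M; pose g i := constructive_indefinite_description _ (h i M).
have g0 i : 0 <= proj1_sig (g i) by case: (g i) => K [].
exists (\rsum_i proj1_sig (g i)); split; first exact: rsum_ge0.
move=> i x y hx hy; have := rsum_ge_term i g0.
case: (g i) => K [K0 hK] /= hs; have [h1 h2] := hK tt _ _ hx hy.
split; first lra.
by apply: Rle_trans h2 _; apply: Rmult_le_compat_r (vnorm_ge0 _) _.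
Qed.

(** Only derivatives along lines are asked for; the mean value theorem and Lipschitz bounds on [d]
    turn them into a Taylor estimate ([grad_taylor]), hence into Frechet derivatives. *)
Definition has_grad (f : Vec k -> R) (d : 'I_k -> Vec k -> R) :=
  forall x v, derivable_pt_lim (fun s => f (line x v s)) 0 (\rsum_j (v j * d j x)).

(** Symmetry of the second derivatives is a field, because the instances are built by sums and
    products from functions of one coordinate, where it is checked directly. Lipschitz second
    derivatives give the quadratic error in [flux_increment]. *)
Record C2fun := MkC2 {
  fn :> Vec k -> R;
  d1 : 'I_k -> Vec k -> R;
  d2 : 'I_k -> 'I_k -> Vec k -> R;
  fn_lip : loclip fn;
  d1_lip : forall j, loclip (d1 j);
  d2_lip : forall j m, loclip (d2 j m);
  fn_grad : has_grad fn d1;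
  d1_grad : forall j, has_grad (d1 j) (d2 j);
  d2_sym : forall j m x, d2 j m x = d2 m j x }.

Lemma line0 x v : line x v 0 = x.
Proof. by apply: vec_eq => i; rewrite /line /vadd /vscale; ring. Qed.

Lemma line_shift x v s t : line (line x v s) v t = line x v (s + t).
Proof. by apply: vec_eq => i; rewrite /line /vadd /vscale; ring. Qed.

Lemma has_grad_at f d x v s : has_grad f d ->
  derivable_pt_lim (fun s => f (line x v s)) s (\rsum_j (v j * d j (line x v s))).
Proof.
move=> h eps e0; have [del hdel] := h (line x v s) v eps e0.
by exists del => u u0 hu; have := hdel u u0 hu; rewrite !line_shift Rplus_0_l Rplus_0_r.
Qed.

Lemma grad_mvt f d x v : has_grad f d ->
  exists th, 0 <= th <= 1 /\ f (vadd x v) - f x = \rsum_j (v j * d j (line x v th)).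
Proof.
move=> h; have [|s hs|c [hc e]] := @MVT_gen (fun s => f (line x v s)) 0 1
   (fun s => \rsum_j (v j * d j (line x v s))).
- by move=> s hs; apply/is_derive_Reals; apply: has_grad_at.
- apply: derivable_continuous_pt; exists (\rsum_j (v j * d j (line x v s))).
  exact: has_grad_at.
- move: hc; rewrite Rmin_left ?Rmax_right; try lra; move=> hc; exists c; split => //.
  move: e => /=; rewrite line0 Rminus_0_r Rmult_1_r.
  suff -> : line x v 1 = vadd x v by [].
  by apply: vec_eq => i; rewrite /line /vadd /vscale; ring.
Qed.

Lemma line_bound x v M s : 0 <= s <= 1 ->
  vnorm x <= M -> vnorm (vadd x v) <= M -> vnorm (line x v s) <= M.
Proof.
move=> hs hx hv; apply: vnorm_lub => [|i]; first exact: Rle_trans (vnorm_ge0 x) hx.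
have /Rabs_le_between h1 := Rle_trans _ _ _ (vnorm_coord x i) hx.
have /Rabs_le_between h2 := Rle_trans _ _ _ (vnorm_coord (vadd x v) i) hv.
move: h2; rewrite /line /vadd /vscale => h2; apply: Rabs_le.
have -> : x i + s * v i = (1 - s) * x i + s * (x i + v i) by ring.
split; nra.
Qed.

Lemma grad_taylor f d M : has_grad f d -> (forall j, loclip (d j)) ->
  exists K, 0 <= K /\ forall x v, vnorm x <= M -> vnorm (vadd x v) <= M ->
    Rabs (f (vadd x v) - f x - \rsum_j (v j * d j x)) <= K * vnorm v * vnorm v.
Proof.
move=> hd hl.
have [K [K0 hK]] := ulip_fin hl M.
have k0 := pos_INR k.
exists (INR k * K); split; first exact: Rmult_le_pos.
move=> x v hx hv; have [th [hth ->]] := grad_mvt x v hd.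
rewrite rsum_sub; apply: Rle_trans (rsum_abs _ _) _.
rewrite !Rmult_assoc; apply: rsum_le_ord => j.
have -> : v j * d j (line x v th) - v j * d j x = (d j (line x v th) - d j x) * v j by ring.
have n0 := vnorm_ge0 v.
rewrite Rabs_mult -Rmult_assoc; apply: Rmult_le_compat (vnorm_coord _ _); try exact: Rabs_pos.
apply: Rle_trans (proj2 (hK j _ _ (line_bound hth hx hv) hx)) _.
apply: Rmult_le_compat_l => //.
have -> : vsub (line x v th) x = vscale th v.
  by apply: vec_eq => i; rewrite /vsub /line /vadd; ring.
rewrite vnorm_scale Rabs_pos_eq; nra.
Qed.

Lemma loclip_const c : loclip (fun _ => c).
Proof. by apply: (@ulip_const _ _ (fun=> c) (Rabs c)) => a; apply: Rle_refl. Qed.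

Lemma has_grad_const c : has_grad (fun _ => c) (fun _ _ => 0).
Proof.
move=> x v; apply: dlim_ext (derivable_pt_lim_const c 0) => //.
by rewrite big1 // => i _; ring.
Qed.

(** These constructions are transparent, so that values and derivatives of composite functions are
    found by conversion. *)
Definition C2const (c : R) : C2fun.
Proof.
apply: (@MkC2 (fun _ => c) (fun _ _ => 0) (fun _ _ _ => 0)) => // *;
  try exact: loclip_const; exact: has_grad_const.
Defined.

Lemma has_grad_add f g df dg : has_grad f df -> has_grad g dg ->
  has_grad (fun x => f x + g x) (fun j x => df j x + dg j x).
Proof.
move=> hf hg x v; apply: dlim_ext (derivable_pt_lim_plus _ _ _ _ _ (hf x v) (hg x v)) => //.
by rewrite -big_split; apply: eq_bigr => j _ /=; ring.
Qed.

Lemma has_grad_mul f g df dg : has_grad f df -> has_grad g dg ->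
  has_grad (fun x => f x * g x) (fun j x => df j x * g x + f x * dg j x).
Proof.
move=> hf hg x v; apply: dlim_ext (derivable_pt_lim_mult _ _ _ _ _ (hf x v) (hg x v)) => //.
rewrite !line0 rsum_scal rsum_scalr -big_split; apply: eq_bigr => j _ /=; ring.
Qed.

Definition C2add (f g : C2fun) : C2fun.
Proof.
apply: (@MkC2 (fun x => f x + g x) (fun j x => d1 f j x + d1 g j x)
  (fun j m x => d2 f j m x + d2 g j m x)).
- exact: ulip_add (fn_lip f) (fn_lip g).
- by move=> j; apply: ulip_add (d1_lip f j) (d1_lip g j).
- by move=> j m; apply: ulip_add (d2_lip f j m) (d2_lip g j m).
- exact: has_grad_add (fn_grad f) (fn_grad g).
- by move=> j; apply: has_grad_add (d1_grad f j) (d1_grad g j).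
- by move=> j m x; rewrite (d2_sym f) (d2_sym g).
Defined.

Definition C2mul (f g : C2fun) : C2fun.
Proof.
apply: (@MkC2 (fun x => f x * g x) (fun j x => d1 f j x * g x + f x * d1 g j x)
  (fun j m x => (d2 f j m x * g x + d1 f j x * d1 g m x)
              + (d1 f m x * d1 g j x + f x * d2 g j m x))).
- exact: ulip_mul (fn_lip f) (fn_lip g).
- by move=> j; apply: ulip_add; [exact: ulip_mul (d1_lip f j) (fn_lip g)
                                | exact: ulip_mul (fn_lip f) (d1_lip g j)].
- move=> j m; apply: ulip_add.
    apply: ulip_add; first exact: ulip_mul (d2_lip f j m) (fn_lip g).
    exact: ulip_mul (d1_lip f j) (d1_lip g m).
  apply: ulip_add; first exact: ulip_mul (d1_lip f m) (d1_lip g j).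
  exact: ulip_mul (fn_lip f) (d2_lip g j m).
- exact: has_grad_mul (fn_grad f) (fn_grad g).
- move=> j; apply: has_grad_add; first exact: has_grad_mul (d1_grad f j) (fn_grad g).
  exact: has_grad_mul (fn_grad f) (d1_grad g j).
- by move=> j m x; rewrite (d2_sym f) (d2_sym g); ring.
Defined.

Definition C2scale (c : R) (f : C2fun) : C2fun := C2mul (C2const c) f.

Definition C2sum (I : Type) (s : seq I) (F : I -> C2fun) : C2fun :=
  foldr (fun i g => C2add (F i) g) (C2const 0) s.

Definition C2prod (I : Type) (s : seq I) (F : I -> C2fun) : C2fun :=
  foldr (fun i g => C2mul (F i) g) (C2const 1) s.

Lemma C2sumE (I : Type) (s : seq I) F x : C2sum s F x = \big[Rplus/0]_(i <- s) F i x.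
Proof. by elim: s => [|i s IH]; rewrite ?big_nil //= big_cons -IH. Qed.

Lemma C2prodE (I : Type) (s : seq I) F x : C2prod s F x = \big[Rmult/1]_(i <- s) F i x.
Proof. by elim: s => [|i s IH]; rewrite ?big_nil //= big_cons -IH. Qed.

Lemma C2sum_d1 (I : Type) (s : seq I) F j x :
  d1 (C2sum s F) j x = \big[Rplus/0]_(i <- s) d1 (F i) j x.
Proof. by elim: s => [|i s IH]; rewrite ?big_nil //= big_cons -IH. Qed.

Lemma has_grad_coord (g g' : R -> R) i : (forall s, derivable_pt_lim g s (g' s)) ->
  has_grad (fun x => g (x i)) (fun j x => if j == i then g' (x i) else 0).
Proof.
move=> h x v.
have hl : derivable_pt_lim (fun s => line x v s i) 0 (0 + (1 * v i + 0 * 0)).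
  apply: (derivable_pt_lim_plus (fun=> x i) (fun s => s * v i)).
    exact: derivable_pt_lim_const.
  apply: (derivable_pt_lim_mult id (fun=> v i)); last exact: derivable_pt_lim_const.
  exact: derivable_pt_lim_id.
apply: dlim_ext (derivable_pt_lim_comp _ g 0 _ _ hl (h _)) => //.
rewrite line0 (bigD1 i) //= eqxx big1; last by move=> j /negbTE ->; ring.
by rewrite /=; ring.
Qed.

Lemma loclip_coord (g : R -> R) i : lip_on_bounded g -> loclip (fun x => g (x i)).
Proof. move=> h; apply: (ulip_comp h); exact: ulip_coord. Qed.

Definition C2coord_fun (g g1 g2 : R -> R) (i : 'I_k) :
  (forall s, derivable_pt_lim g s (g1 s)) -> (forall s, derivable_pt_lim g1 s (g2 s)) ->
  lip_on_bounded g -> lip_on_bounded g1 -> lip_on_bounded g2 -> C2fun.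
Proof.
move=> h0 h1 l0 l1 l2.
apply: (@MkC2 (fun x => g (x i)) (fun j x => if j == i then g1 (x i) else 0)
   (fun j m x => if j == i then if m == i then g2 (x i) else 0 else 0)).
- exact: loclip_coord.
- by move=> j; case: (j == i); [exact: loclip_coord | exact: loclip_const].
- by move=> j m; case: (j == i); case: (m == i); try exact: loclip_coord; exact: loclip_const.
- exact: has_grad_coord.
- move=> j; case: (j == i); [exact: has_grad_coord | exact: has_grad_const].
- by move=> j m x; case: (j == i); case: (m == i).
Defined.

Lemma lip_on_bounded_const c : lip_on_bounded (fun=> c).
Proof.
move=> M; exists (Rabs c); split; first exact: Rabs_pos.
move=> s t _ _; rewrite Rminus_diag Rabs_R0; split; first lra.
by apply: Rmult_le_pos; apply: Rabs_pos.
Qed.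

Lemma lip_on_bounded_id : lip_on_bounded id.
Proof.
move=> M; exists (Rmax 1 M); split; first by have := Rmax_l 1 M; lra.
move=> s t hs ht; have := Rmax_l 1 M; have := Rmax_r 1 M; have := Rabs_pos (s - t).
rewrite /id => *; split; nra.
Qed.

Definition C2coord (i : 'I_k) : C2fun :=
  @C2coord_fun id (fun=> 1) (fun=> 0) i derivable_pt_lim_id (derivable_pt_lim_const 1)
    lip_on_bounded_id (lip_on_bounded_const 1) (lip_on_bounded_const 0).

Definition C2map := 'I_k -> C2fun.
Definition mapv (h : C2map) : Vec k -> Vec k := fun x i => h i x.
Definition jac (h : C2map) : Vec k -> Mat k := fun x i j => d1 (h i) j x.

Lemma C2map_taylor (h : C2map) M : exists K, 0 <= K /\ forall x v,
    vnorm x <= M -> vnorm (vadd x v) <= M ->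
    vnorm (vsub (vsub (mapv h (vadd x v)) (mapv h x)) (mapp (jac h x) v))
      <= K * vnorm v * vnorm v.
Proof.
pose g i := constructive_indefinite_description _ (grad_taylor M (fn_grad (h i)) (d1_lip (h i))).
have g0 i : 0 <= proj1_sig (g i) by case: (g i) => K [].
exists (\rsum_i proj1_sig (g i)); split; first exact: rsum_ge0.
move=> x v hx hv; have n0 := vnorm_ge0 v; have s0 := @rsum_ge0 _ predT _ (fun i _ => g0 i).
apply: vnorm_lub => [|i]; first by apply: Rmult_le_pos => //; apply: Rmult_le_pos.
have := rsum_ge_term i g0; case: (g i) => K [K0 hK] /= hs.
have e : mapp (jac h x) v i = \rsum_j (v j * d1 (h i) j x).
  by apply: eq_bigr => j _; rewrite Rmult_comm.
rewrite /vsub e; apply: Rle_trans (hK x v hx hv) _; do 2 (apply: Rmult_le_compat_r => //).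
Qed.

Lemma C2map_lip (h : C2map) M : exists K, 0 <= K /\ forall x y,
    vnorm x <= M -> vnorm y <= M ->
    vnorm (mapv h x) <= K /\ vnorm (vsub (mapv h x) (mapv h y)) <= K * vnorm (vsub x y).
Proof.
have [K [K0 hK]] := ulip_fin (fun i => fn_lip (h i)) M.
exists K; split => // x y hx hy; have n0 := vnorm_ge0 (vsub x y).
split; apply: vnorm_lub => //; try (by apply: Rmult_le_pos); move=> i;
  by have [h1 h2] := hK i x y hx hy.
Qed.

Lemma C2map_frechet (h : C2map) x : frechet (mapv h) x (jac h x).
Proof.
move=> eps e0; have [K [K0 hK]] := C2map_taylor h (vnorm x + 1).
have [r [r0 hr]] := small_mult K0 e0; exists r; split; first lra.
move=> v hv; have n0 := vnorm_ge0 v.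
apply: Rle_trans (hK x v _ _) _; [lra | by have := vnorm_add x v; lra |].
by apply: Rmult_le_compat_r => //; apply/Rlt_le/hr.
Qed.

Lemma C2map_C1 (h : C2map) : C1 (mapv h).
Proof.
exists (jac h); split; first exact: C2map_frechet.
move=> x eps e0.
have hl : ulip (fun (p : 'I_k * 'I_k) y => d1 (h p.1) p.2 y).
  by apply: ulip_fin => p; apply: d1_lip.
have [K [K0 hK]] := hl (vnorm x + 1).
have [r [r0 hr]] := small_mult K0 e0; exists r; split; first lra.
move=> y hy i j; have n0 := vnorm_ge0 (vsub y x).
have [||_ h2] := hK (i, j) y x; [by have := vnorm_le_sub y x; lra | lra | ].
by apply: Rle_lt_trans h2 _; apply: hr.
Qed.

End C2.

Section Bounds.
Variables (k : nat) (M : R).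

(** The second hypothesis says that [S] is closed. Near a point of [S] continuity keeps [g] above
    half its value there; near other points the claim is void. *)
Lemma pos_lower (S : Vec k -> Prop) (g : Vec k -> R) :
  (forall x, S x -> vnorm x <= M) ->
  (forall x, ~ S x -> exists r, 0 < r /\ forall y, vnorm (vsub y x) < r -> ~ S y) ->
  (forall x, S x -> 0 < g x) ->
  (forall x e, S x -> 0 < e -> exists r, 0 < r /\ forall y, S y -> vnorm (vsub y x) < r ->
     Rabs (g y - g x) < e) ->
  exists c, 0 < c /\ forall x, S x -> c <= g x.
Proof.
move=> SM Sc g0 gc.
have [|p hp|c [c0 hc]] := @compact_box k M (fun c x => S x -> c <= g x).
- by move=> c c' x c0 cc h Sx; have := h Sx; lra.
- have [Sp|Sp] := classic (S p).
    have h := g0 p Sp; have [r [r0 hr]] := gc p (g p / 2) Sp ltac:(lra).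
    have m0 : 0 < Rmin r (g p / 2) by apply: Rmin_glb_lt; lra.
    exists (Rmin r (g p / 2)); split => // y hy hyp Sy.
    have := hr y Sy (lt_minl hyp) => /Rabs_lt_between.
    by have := Rmin_r r (g p / 2); lra.
  have [r [r0 hr]] := Sc p Sp; exists r; split => // y hy hyp Sy.
  by case: (hr y hyp).
- by exists c; split => // x Sx; apply: hc => //; apply: SM.
Qed.

Lemma not_closure (U : Vec k -> Prop) x : ~ closure U x ->
  exists r, 0 < r /\ forall y, vnorm (vsub y x) < r -> ~ closure U y.
Proof.
move=> cx; have [r hr] := not_all_ex_not _ _ cx; have {hr} [r0 hr] := imply_to_and _ _ hr.
exists (r / 2); split; first lra; move=> y hy Uy; apply: hr.
have [z [Uz hz]] := Uy (r / 2) ltac:(lra); exists z; split => //.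
by have := vnorm_sub_tri z y x; lra.
Qed.

Lemma not_boundary (U : Vec k -> Prop) x : is_open U -> ~ boundary U x ->
  exists r, 0 < r /\ forall y, vnorm (vsub y x) < r -> ~ boundary U y.
Proof.
move=> oU nb; have [Ux|Ux] := classic (U x).
  have [r [r0 hr]] := oU x Ux; exists r; split => // y hy [_ nU]; apply: nU; exact: hr.
have [|r [r0 hr]] := @not_closure U x; first by move=> cx; apply: nb.
by exists r; split => // y hy [cy _]; apply: hr hy cy.
Qed.

Lemma closure_bound (U : Vec k -> Prop) x :
  (forall y, U y -> vnorm y <= M) -> closure U x -> vnorm x <= M.
Proof.
move=> UM cx; apply: Rnot_lt_le => h; have [y [Uy hy]] := cx (vnorm x - M) ltac:(lra).
by have := UM y Uy; have := vnorm_le_sub x y; rewrite vnorm_sub_sym; lra.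
Qed.

Lemma subset_closure (U : Vec k -> Prop) x : U x -> closure U x.
Proof. by move=> Ux r r0; exists x; rewrite vsubxx vnorm_zero. Qed.

Lemma norm_cont (f : Vec k -> Vec k) x y : Rabs (vnorm (f y) - vnorm (f x)) <= vnorm (vsub (f y) (f x)).
Proof.
have := vnorm_le_sub (f y) (f x); have := vnorm_le_sub (f x) (f y).
by rewrite (vnorm_sub_sym (f x)); move=> *; apply: Rabs_le; lra.
Qed.

End Bounds.

Lemma mapv_cont (k : nat) (h : C2map k) x e : 0 < e -> exists r, 0 < r /\ forall y,
  vnorm (vsub y x) < r -> vnorm (vsub (mapv h y) (mapv h x)) < e.
Proof.
move=> e0; have [K [K0 hK]] := C2map_lip h (vnorm x + 1).
have [r [r0 hr]] := small_mult K0 e0; exists r; split; first lra.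
move=> y hy; have n0 := vnorm_ge0 (vsub y x).
have [||_ h2] := hK y x; [by have := vnorm_le_sub y x; lra | lra |].
by apply: Rle_lt_trans h2 _; apply: hr.
Qed.

(** * Determinants and the bump function *)

Section Det.
Variable k : nat.
Implicit Types M : Mat k.

Definition mx M : 'M[R]_k := (\matrix_(i, j) M i j)%ring.

Lemma mdetE M : mdet M = (\det (mx M))%ring.
Proof.
rewrite /mdet /determinant; apply: eq_bigr => s _; congr (_ * _).
  by case: (odd_perm s); rewrite /= ?GRing.expr1 ?GRing.expr0.
by apply: eq_bigr => i _; rewrite mxE.
Qed.

Definition row_repl (l : 'I_k) (v : Vec k) M : Mat k :=
  fun i j => if i == l then v j else M i j.

Lemma mdet_tr M : mdet (fun i j => M j i) = mdet M.
Proof.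
by rewrite !mdetE -det_tr; congr (\det _)%ring; apply/matrixP => i j; rewrite !mxE.
Qed.

Lemma dlim_det (M : R -> Mat k) (M' : Mat k) x :
  (forall i j, derivable_pt_lim (fun s => M s i j) x (M' i j)) ->
  derivable_pt_lim (fun s => mdet (M s)) x (\rsum_l mdet (row_repl l (M' l) (M x))).
Proof.
move=> h; pose sg (s : 'S_k) := if odd_perm s then -1 else 1.
have h1 (s : 'S_k) := derivable_pt_lim_scal _ (sg s) _ _
  (dlim_prod (F := fun i u => M u i (s i)) (fun i => h i (s i))).
apply: dlim_ext (dlim_sum (fun s => h1 s)) => //.
rewrite /mdet exchange_big /=; apply: eq_bigr => s _.
rewrite rsum_scal; apply: eq_bigr => l _; congr (_ * _); apply: eq_bigr => i _.
by rewrite /row_repl; case: eqP => // ->.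
Qed.

Lemma mdet_row_swap i j (u v : Vec k) M : i != j ->
  mdet (row_repl i u (row_repl j v M)) = - mdet (row_repl i v (row_repl j u M)).
Proof.
move=> ij; rewrite !mdetE.
have -> : mx (row_repl i u (row_repl j v M)) = xrow i j (mx (row_repl i v (row_repl j u M))).
  apply/matrixP => a b; rewrite !mxE /row_repl.
  by case: tpermP => [->|->|/eqP/negbTE -> /eqP/negbTE ->];
     rewrite ?eqxx ?(negbTE ij) // eq_sym (negbTE ij).
rewrite xrowE det_mulmx det_perm odd_tperm ij /= GRing.expr1.
exact: GRing.mulN1r.
Qed.

(** Cramer's rule: expansion along row [j] identifies [mdet (row_repl j g B)] with entry [j] of [g]
    times the adjugate of [B], and the adjugate times [B] is scalar. *)
Lemma mdet_cramer (B : Mat k) (g : Vec k) l :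
  \rsum_j (B j l * mdet (row_repl j g B)) = g l * mdet B.
Proof.
have h j : mdet (row_repl j g B) = (((\row_i g i) *m \adj (mx B)) 0 j)%ring.
  rewrite mdetE (expand_det_row _ j) mxE; apply: eq_bigr => i _.
  rewrite !mxE /row_repl eqxx; congr (_ * _).
  rewrite /cofactor; congr (_ * _)%ring; congr (\det _)%ring.
  by apply/matrixP => a b; rewrite !mxE eq_sym (negbTE (neq_lift _ _)).
have := f_equal (fun w : 'rV[R]_k => w 0%ring l)
  (mulmxA (\row_i g i) (\adj (mx B)) (mx B))%ring.
rewrite mul_adj_mx mul_mx_scalar !mxE /= => e.
transitivity (mdet B * g l); last by rewrite Rmult_comm.
rewrite [mdet B]mdetE; apply: etrans (esym e).
by apply: eq_bigr => j _; rewrite h [mx B j l]mxE Rmult_comm.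
Qed.

End Det.

Definition pos (s : R) := Rmax 0 s.

Lemma pos_lip : lip_on_bounded pos.
Proof.
move=> M; exists (Rmax 1 M); split; first by have := Rmax_l 1 M; lra.
move=> s t /Rabs_le_between hs /Rabs_le_between ht; have h1 := Rmax_r 1 M.
split.
  have h2 := Rmax_l 1 M; apply: Rabs_le; rewrite /pos; split; [have := Rmax_l 0 s; lra | apply: Rmax_lub; lra].
apply: (Rle_trans _ (1 * Rabs (s - t))); last first.
  by apply: Rmult_le_compat_r (Rmax_l _ _); apply: Rabs_pos.
have a1 := Rle_abs (s - t); have a2 := Rabs_maj2 (s - t); have a0 := Rabs_pos (s - t).
rewrite Rmult_1_l /pos /Rmax; apply: Rabs_le.
by case: Rle_dec => h2; case: Rle_dec => h3; lra.
Qed.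

(** Squaring makes the positive part differentiable: the remainder at increment [h] is at most
    [h * h], whatever the signs of [s] and [s + h]. *)
Lemma dlim_pos2 s : derivable_pt_lim (fun s => pos s * pos s) s (2 * pos s).
Proof.
move=> eps e0; exists (mkposreal eps e0) => h h0 /= hh.
have e : (pos (s + h) * pos (s + h) - pos s * pos s) / h - 2 * pos s =
    (pos (s + h) * pos (s + h) - pos s * pos s - 2 * pos s * h) / h by field.
rewrite e /Rdiv Rabs_mult Rabs_inv; have a0 := Rabs_pos_lt _ h0.
apply: (Rmult_lt_reg_r (Rabs h)) => //; rewrite Rmult_assoc Rinv_l ?Rmult_1_r; last lra.
apply: (Rle_lt_trans _ (Rabs h * Rabs h)); last exact: Rmult_lt_compat_r.
rewrite -Rabs_mult (Rabs_pos_eq (h * h)); last by have := Rle_0_sqr h; rewrite /Rsqr.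
rewrite /pos /Rmax; case: Rle_dec => h1; case: Rle_dec => h2; apply: Rabs_le; split; nra.
Qed.

Section Omega.
Variable k : nat.

(** The squared Euclidean norm. Unlike [vnorm] it is differentiable, so it carries both the bump
    function and the Gronwall estimate. *)
Definition energy (x : Vec k) := \rsum_i (x i * x i).

Lemma energy_ge (x : Vec k) : vnorm x * vnorm x <= energy x.
Proof.
have s0 : 0 <= energy x by apply: rsum_ge0 => i _; nra.
have : vnorm x <= sqrt (energy x).
  apply: vnorm_lub => [|i]; first exact: sqrt_pos.
  rewrite -sqrt_Rsqr_abs; apply: sqrt_le_1_alt.
  by apply: (rsum_ge_term (F := fun i => x i * x i)) => j; nra.
have := sqrt_sqrt _ s0; have := vnorm_ge0 x; have := sqrt_pos (energy x); nra.
Qed.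

Lemma energy_le (x : Vec k) : energy x <= INR k * (vnorm x * vnorm x).
Proof.
apply: rsum_le_ord => i; have := vnorm_coord x i => /Rabs_le_between h.
by have := vnorm_ge0 x; nra.
Qed.


(** Its square [bump] is C1 and supported in the ball of radius [r]. Both depend on [y] through
    [energy] alone, hence are unchanged by signed permutations of the coordinates. *)
Definition bump0 (r : R) (y : Vec k) := pos (r * r - energy y).
Definition bump (r : R) (y : Vec k) := bump0 r y * bump0 r y.

Lemma bump0_out r y : 0 <= r -> r <= vnorm y -> bump0 r y = 0.
Proof.
move=> r0 hr; rewrite /bump0 /pos Rmax_left //.
by have := energy_ge y; nra.
Qed.

Lemma dlim_bump r (y : R -> Vec k) (y' : Vec k) s :
  (forall i, derivable_pt_lim (fun u => y u i) s (y' i)) ->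
  derivable_pt_lim (fun u => bump r (y u)) s
    (-4 * bump0 r (y s) * \rsum_i (y s i * y' i)).
Proof.
move=> h.
have h1 := dlim_sum (fun i => derivable_pt_lim_mult _ _ _ _ _ (h i) (h i)).
have h2 := derivable_pt_lim_minus _ _ _ _ _ (derivable_pt_lim_const (r * r) s) h1.
apply: dlim_ext (derivable_pt_lim_comp _ _ _ _ _ h2 (dlim_pos2 _)) => //.
rewrite /bump0 /energy /minus_fct /fct_cte /mult_fct.
have -> : \rsum_i (y' i * y s i + y s i * y' i) = 2 * (\rsum_i (y s i * y' i)).
  by rewrite rsum_scal; apply: eq_bigr => i _; ring.
ring.
Qed.

End Omega.

(** * The flux of a homotopy *)

Lemma rsum_antisym (I : finType) (a : I -> I -> R) :
  (forall i j, a i j = - a j i) -> \rsum_i \rsum_j a i j = 0.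
Proof.
move=> h; have : \rsum_i \rsum_j a i j = - (\rsum_i \rsum_j a i j); last lra.
rewrite {1}exchange_big /=.
have -> (x : R) : - x = -1 * x by ring.
rewrite rsum_scal; apply: eq_bigr => i _; rewrite rsum_scal.
by apply: eq_bigr => j _; rewrite h; ring.
Qed.

Definition evec {k} (j : 'I_k) : Vec k := fun i => if i == j then 1 else 0.

Lemma vnorm_evec (k : nat) (j : 'I_k) : vnorm (evec j) = 1.
Proof.
apply: Rle_antisym.
  apply: vnorm_lub => [|i]; first lra.
  by rewrite /evec; case: (i == j); rewrite ?Rabs_R1 ?Rabs_R0; lra.
by have := vnorm_coord (evec j) j; rewrite /evec eqxx Rabs_R1.
Qed.

Lemma dlim_dir (k : nat) (f : Vec k -> R) d x (j : 'I_k) s : has_grad f d ->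
  derivable_pt_lim (fun s => f (line x (evec j) s)) s (d j (line x (evec j) s)).
Proof.
move=> h; apply: dlim_ext (has_grad_at x (evec j) s h) => //.
rewrite (bigD1 j) //= big1 /evec; first by rewrite eqxx; ring.
by move=> i /negbTE ->; ring.
Qed.

Section Homotopy.
Variables (k : nat) (h0 h1 : C2map k) (r : R).

Definition hom (t : R) : C2map k :=
  fun i => C2add (C2scale (1 - t) (h0 i)) (C2scale t (h1 i)).
Arguments hom : simpl never.

Definition vel (x : Vec k) : Vec k := fun l => h1 l x - h0 l x.
Definition dvel j (x : Vec k) : Vec k := fun l => d1 (h1 l) j x - d1 (h0 l) j x.
(** Transposed Jacobian: row [j] holds the derivatives in direction [j], and this is the row that
    [flux] replaces. *)
Definition jacT t (x : Vec k) : Mat k := fun j l => d1 (hom t l) j x.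
(** By Cramer's rule this is component [j] of the weight times the adjugate of the Jacobian applied
    to the velocity of the homotopy: the field whose divergence is the time derivative of
    [density]. *)
Definition flux t j x := bump r (mapv (hom t) x) * mdet (row_repl j (vel x) (jacT t x)).
Definition dflux t j x :=
  (-4 * bump0 r (mapv (hom t) x) * \rsum_l (mapv (hom t) x l * jacT t x j l))
     * mdet (row_repl j (vel x) (jacT t x))
  + bump r (mapv (hom t) x) *
    \rsum_m mdet (row_repl m (if m == j then dvel j x else fun l => d2 (hom t l) m j x)
                    (row_repl j (vel x) (jacT t x))).
Definition density t x := bump r (mapv (hom t) x) * mdet (jacT t x).

Lemma homE t i x : hom t i x = (1 - t) * h0 i x + t * h1 i x.
Proof. by []. Qed.

Lemma hom_d1 t i j x : d1 (hom t i) j x = (1 - t) * d1 (h0 i) j x + t * d1 (h1 i) j x.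
Proof. by rewrite /hom /=; ring. Qed.

Lemma hom_d2 t i j m x :
  d2 (hom t i) j m x = (1 - t) * d2 (h0 i) j m x + t * d2 (h1 i) j m x.
Proof. by rewrite /hom /=; ring. Qed.

Lemma dlim_affine a b t : derivable_pt_lim (fun t => (1 - t) * a + t * b) t (b - a).
Proof.
move=> eps e0; exists (mkposreal eps e0) => h hn _.
have -> : ((1 - (t + h)) * a + (t + h) * b - ((1 - t) * a + t * b)) / h - (b - a) = 0.
  by field.
by rewrite Rabs_R0.
Qed.

Lemma dlim_flux t j x s :
  derivable_pt_lim (fun s => flux t j (line x (evec j) s)) s (dflux t j (line x (evec j) s)).
Proof.
apply: derivable_pt_lim_mult.
  apply: (@dlim_bump k r (fun s => mapv (hom t) (line x (evec j) s))) => i.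
  exact: dlim_dir (fn_grad (hom t i)).
apply: (@dlim_det k (fun s => row_repl j (vel (line x (evec j) s)) (jacT t (line x (evec j) s)))
  (fun m => if m == j then dvel j (line x (evec j) s)
                  else fun l => d2 (hom t l) m j (line x (evec j) s))) => m l.
rewrite /row_repl; case: (m == j).
  by apply: derivable_pt_lim_minus; apply: dlim_dir; apply: fn_grad.
exact: dlim_dir (d1_grad (hom t l) m).
Qed.

Lemma row_repl_comm (m j : 'I_k) (u w : Vec k) M : m != j ->
  row_repl m u (row_repl j w M) = row_repl j w (row_repl m u M).
Proof.
move=> mj; apply: mat_eq => a b.
by rewrite /row_repl; case: eqP => // ->; rewrite (negbTE mj).
Qed.

Lemma row_repl_twice (j : 'I_k) (u w : Vec k) M :
  row_repl j u (row_repl j w M) = row_repl j u M.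
Proof.
apply: mat_eq => a b.
by rewrite /row_repl; case: eqP.
Qed.

(* The divergence of the flux; the second derivatives of the homotopy drop out
   because they are symmetric while a determinant is alternating in its rows. *)
Lemma div_flux t x : \rsum_j dflux t j x =
  (-4 * bump0 r (mapv (hom t) x) * \rsum_l (mapv (hom t) x l * vel x l)) * mdet (jacT t x)
  + bump r (mapv (hom t) x) * \rsum_m mdet (row_repl m (dvel m x) (jacT t x)).
Proof.
rewrite big_split /=; congr (_ + _).
  set b := -4 * _; set y := mapv _ x; set J := jacT t x.
  have -> : b * (\rsum_l (y l * vel x l)) * mdet J = \rsum_l (b * (y l * (vel x l * mdet J))).
    by rewrite rsum_scal rsum_scalr; apply: eq_bigr => l _; ring.
under eq_bigr => j _ do rewrite (rsum_scal _ b) rsum_scalr.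
  rewrite exchange_big /=; apply: eq_bigr => l _.
  (* Cramer's rule absorbs the Jacobian from the gradient of the bump, which leaves the derivative
     of the bump along [vel]. *)
  rewrite -mdet_cramer !rsum_scal; apply: eq_bigr => j _; ring.
rewrite -rsum_scal; congr (_ * _).
(* These are the second-derivative terms. On the diagonal the replaced row itself is differentiated
   and gives [dvel], so that term is kept apart. *)
pose a j m := if m == j then 0 else
  mdet (row_repl m (fun l => d2 (hom t l) m j x) (row_repl j (vel x) (jacT t x))).
have anti j m : a j m = - a m j.
  rewrite /a; case: eqP => [->|/eqP mj]; first by rewrite eqxx; ring.
  rewrite eq_sym (negbTE mj) (mdet_row_swap _ _ _ mj) row_repl_comm //; congr (- mdet _).
  congr (row_repl j _ _).
  by apply: vec_eq => l; apply: d2_sym.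
transitivity (\rsum_j mdet (row_repl j (dvel j x) (jacT t x)) + \rsum_j \rsum_m a j m).
  rewrite -big_split; apply: eq_bigr => j _ /=.
  rewrite (bigD1 j) //= eqxx row_repl_twice; congr (_ + _).
  rewrite [RHS](bigD1 j) //= {1}/a eqxx Rplus_0_l.
  by apply: eq_bigr => m /negbTE mj; rewrite /a mj.
by rewrite (rsum_antisym anti) Rplus_0_r.
Qed.

(** The chain rule for the bump and the row-by-row derivative of the determinant give exactly the
    two terms left in [div_flux]. This is the conservation law behind homotopy invariance. *)
Lemma dlim_density t x :
  derivable_pt_lim (fun t => density t x) t (\rsum_j dflux t j x).
Proof.
rewrite div_flux; apply: derivable_pt_lim_mult.
  by apply: (@dlim_bump k r (fun t => mapv (hom t) x)) => i; apply: dlim_affine.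
apply: (@dlim_det k (fun t => jacT t x) (fun m => dvel m x)) => m l.
by apply: dlim_ext (dlim_affine (d1 (h0 l) m x) (d1 (h1 l) m x) t) => // s; rewrite /jacT hom_d1.
Qed.

Let unit_int := {t : R | 0 <= t <= 1}.

Lemma ulip_affine (f g : Vec k -> R) : loclip f -> loclip g ->
  ulip (fun (t : unit_int) x => (1 - sval t) * f x + sval t * g x).
Proof.
have up (f' : Vec k -> R) : loclip f' -> ulip (fun (_ : unit_int) => f').
  by move=> h; apply: (ulip_reindex (fun=> tt) h).
move=> hf hg; apply: ulip_add; apply: ulip_mul; try exact: up.
- apply: (@ulip_const _ _ (fun t : unit_int => 1 - sval t) 1) => -[t ht] /=.
  by apply: Rabs_le; lra.
- apply: (@ulip_const _ _ (fun t : unit_int => sval t) 1) => -[t ht] /=.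
  by apply: Rabs_le; lra.
Qed.

Lemma ulip_vel l : loclip (fun x => vel x l).
Proof.
apply: (ulip_ext (f := fun _ x => h1 l x + -1 * h0 l x)) => [a x|]; first by rewrite /vel; ring.
by apply: ulip_add (fn_lip _) _; apply: ulip_scale; apply: fn_lip.
Qed.

Lemma ulip_dvel j l : loclip (fun x => dvel j x l).
Proof.
apply: (ulip_ext (f := fun _ x => d1 (h1 l) j x + -1 * d1 (h0 l) j x)) => [a x|].
  by rewrite /dvel; ring.
by apply: ulip_add (d1_lip _ _) _; apply: ulip_scale; apply: d1_lip.
Qed.

Lemma ulip_dflux j : ulip (fun (t : unit_int) => dflux (sval t) j).
Proof.
have up (f' : Vec k -> R) : loclip f' -> ulip (fun (_ : unit_int) => f').
  by move=> h; apply: (ulip_reindex (fun=> tt) h).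
have uh l : ulip (fun (t : unit_int) x => mapv (hom (sval t)) x l).
  exact: ulip_affine (fn_lip _) (fn_lip _).
have uJ i l : ulip (fun (t : unit_int) x => jacT (sval t) x i l).
  apply: ulip_ext (ulip_affine (d1_lip (h0 l) i) (d1_lip (h1 l) i)) => t x.
  by rewrite /jacT hom_d1.
have u2 i m l : ulip (fun (t : unit_int) x => d2 (hom (sval t) l) i m x).
  apply: ulip_ext (ulip_affine (d2_lip (h0 l) i m) (d2_lip (h1 l) i m)) => t x.
  by rewrite hom_d2.
have ub : ulip (fun (t : unit_int) x => bump0 r (mapv (hom (sval t)) x)).
  apply: (ulip_comp pos_lip).
  apply: (ulip_ext (f := fun t x => r * r + -1 * \rsum_i (hom (sval t) i x * hom (sval t) i x))).
    by move=> t x; rewrite /energy /mapv; ring.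
  apply: ulip_add; first by apply: up; apply: loclip_const.
  by apply: ulip_scale; apply: ulip_sum => i; apply: ulip_mul; apply: uh.
have uR : forall i l, ulip (fun (t : unit_int) x => row_repl j (vel x) (jacT (sval t) x) i l).
  by move=> i l; rewrite /row_repl; case: (i == j) => //; apply: up; apply: ulip_vel.
apply: ulip_add; apply: ulip_mul.
- apply: ulip_mul; first exact: ulip_scale.
  by apply: ulip_sum => l; apply: ulip_mul.
- exact: ulip_det.
- exact: ulip_mul.
- apply: ulip_sum => m; apply: ulip_det => i l; rewrite {1}/row_repl; case: (i == m) => //.
  by case: (m == j) => //; apply: up; apply: ulip_dvel.
Qed.

(** Mean value theorem along the edge and the Lipschitz bound on [dflux]. [K] must not depend on
    [t], which will itself come from a mean value theorem in time. *)
Lemma flux_increment M : exists K, 0 <= K /\ forall t j x d,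
  0 <= t <= 1 -> 0 <= d -> vnorm x <= M -> vnorm (line x (evec j) d) <= M ->
  Rabs (flux t j (line x (evec j) d) - flux t j x - d * dflux t j x) <= K * d * d.
Proof.
pose g j := constructive_indefinite_description _ (ulip_dflux j M).
have g0 j : 0 <= proj1_sig (g j) by case: (g j) => K [].
exists (\rsum_j proj1_sig (g j)); split; first exact: rsum_ge0.
move=> t j x d ht d0 hx hxd; have := rsum_ge_term j g0.
case: (g j) => K [K0 hK] /= hs.
have [||c [hc]] := @MVT_gen (fun s => flux t j (line x (evec j) s)) 0 d
   (fun s => dflux t j (line x (evec j) s)).
- by move=> s hs'; apply/is_derive_Reals; apply: dlim_flux.
- move=> s hs'; apply: derivable_continuous_pt; exists (dflux t j (line x (evec j) s)).
  exact: dlim_flux.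
move: hc; rewrite Rmin_left ?Rmax_right // line0 Rminus_0_r => hc ->.
have -> : dflux t j (line x (evec j) c) * d - d * dflux t j x
   = (dflux t j (line x (evec j) c) - dflux t j x) * d by ring.
rewrite Rabs_mult (Rabs_pos_eq d) //; apply: Rmult_le_compat_r => //.
have hxc : vnorm (line x (evec j) c) <= M.
  have [dz|dz] := Req_dec d 0; first by replace c with 0 by lra; rewrite line0.
  have -> : line x (evec j) c = line x (vscale d (evec j)) (c / d).
    by apply: vec_eq => i; rewrite /line /vadd /vscale; field.
  apply: line_bound => //; split.
    by apply: Rmult_le_pos; [lra | apply/Rlt_le/Rinv_0_lt_compat; lra].
  by apply: (Rmult_le_reg_r d); [lra | rewrite /Rdiv Rmult_assoc Rinv_l //; lra].
apply: Rle_trans (proj2 (hK (exist _ t ht) _ _ hxc hx)) _ => /=.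
have -> : vsub (line x (evec j) c) x = vscale c (evec j).
  by apply: vec_eq => i; rewrite /vsub /line /vadd; ring.
rewrite vnorm_scale vnorm_evec Rmult_1_r Rabs_pos_eq; last lra.
apply: Rmult_le_compat; lra.
Qed.

End Homotopy.

(** * Riemann sums and the degree *)

Lemma INR_expn a n : INR (expn a n) = INR a ^ n.
Proof. by elim: n => //= n IH; rewrite expnS mult_INR IH. Qed.

Definition ind (X : Type) (D : X -> Prop) (x : X) : R :=
  if excluded_middle_informative (D x) then 1 else 0.

Lemma ind1 (X : Type) (D : X -> Prop) x : D x -> ind D x = 1.
Proof. by rewrite /ind; case: excluded_middle_informative. Qed.

Lemma ind0 (X : Type) (D : X -> Prop) x : ~ D x -> ind D x = 0.
Proof. by rewrite /ind; case: excluded_middle_informative. Qed.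

Lemma ind_ge0 (X : Type) (D : X -> Prop) x : 0 <= ind D x.
Proof. by have [Dx|Dx] := classic (D x); rewrite ?(ind1 Dx) ?(ind0 Dx); lra. Qed.

Lemma arch_inv (a e : R) : 0 < e -> exists N0, forall N, (N0 <= N)%N -> a / INR N.+1 <= e.
Proof.
move=> e0; have [n hn] := INR_unbounded (Rabs a / e); exists n => N /leP hN.
have h1 : INR n <= INR N by apply: le_INR.
have h2 : INR N.+1 = INR N + 1 by rewrite S_INR.
have h3 := pos_INR n.
apply: (Rmult_le_reg_r (INR N.+1)); first lra.
rewrite /Rdiv Rmult_assoc Rinv_l ?Rmult_1_r; last lra.
have : Rabs a = Rabs a / e * e by field; lra.
have := Rle_abs a; nra.
Qed.

Section Grid.
Variables (k : nat) (M : R).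
Hypothesis M0 : 0 < M.
Implicit Types (D : Vec k -> Prop) (h : C2map k).

(** Each axis carries the [N.+1] nodes from [- M] to [M - mesh N]. Leaving out [M] lets the shift by
    one node be closed up cyclically. *)
Definition mesh (N : nat) := 2 * M / INR N.+1.
Definition node N (a : nat) := - M + mesh N * INR a.
Definition grid N (m : {ffun 'I_k -> 'I_N.+1}) : Vec k := fun i => node N (m i).
Definition riem N r D h := mesh N ^ k *
  \rsum_m (ind D (@grid N m) * (bump r (mapv h (grid m)) * mdet (jac h (grid m)))).

Lemma mesh_pos N : 0 < mesh N.
Proof. by apply: Rdiv_lt_0_compat; [lra | apply: lt_0_INR; apply/ltP]. Qed.

Lemma mesh_small e : 0 < e -> exists N0, forall N, (N0 <= N)%N -> mesh N <= e.
Proof. exact: arch_inv. Qed.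

Lemma node_last N : node N N.+1 = M.
Proof. rewrite /node /mesh; field; exact: not_0_INR. Qed.

Lemma node_range N a : (a <= N.+1)%N -> - M <= node N a <= M.
Proof.
move=> /leP /le_INR h; rewrite -{2}(node_last N) /node; have := mesh_pos N; have := pos_INR a.
by nra.
Qed.

Lemma mesh_card N : mesh N ^ k * INR #|{ffun 'I_k -> 'I_N.+1}| = (2 * M) ^ k.
Proof.
rewrite card_ffun !card_ord INR_expn -Rpow_mult_distr; congr (_ ^ _).
rewrite /mesh; field; exact: not_0_INR.
Qed.

Definition gshift N (j : 'I_k) (m : {ffun 'I_k -> 'I_N.+1}) : {ffun 'I_k -> 'I_N.+1} :=
  [ffun i => if i == j then ordS (m i) else m i].

Lemma gshift_inj N j : injective (@gshift N j).
Proof.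
move=> m m' /ffunP e; apply/ffunP => i; have := e i; rewrite !ffunE.
by case: (i == j) => // /ordS_inj.
Qed.

(** Summation by parts: [mesh N * W] is the forward difference of [V] up to [K] times the squared
    mesh, and the differences cancel in the sum. With [(2 * M)^k / mesh^k] nodes, one factor [mesh]
    survives. *)
Lemma riem_flux_sum N D (V : Vec k -> R) (W : Vec k -> R) (j : 'I_k) K :
  (forall x, D x -> vnorm x < M) -> 0 <= K ->
  (forall x, vnorm x <= M -> vnorm (line x (evec j) (mesh N)) <= M ->
     Rabs (ind D (line x (evec j) (mesh N)) * V (line x (evec j) (mesh N))
           - ind D x * V x - mesh N * (ind D x * W x)) <= K * mesh N * mesh N) ->
  Rabs (mesh N ^ k * \rsum_m (ind D (@grid N m) * W (grid m))) <= (2 * M) ^ k * K * mesh N.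
Proof.
move=> HD K0 HV; have d0 := mesh_pos N.
pose G (m : {ffun 'I_k -> 'I_N.+1}) := ind D (grid m) * V (grid m).
have sh m : G (gshift j m)
   = ind D (line (grid m) (evec j) (mesh N)) * V (line (grid m) (evec j) (mesh N)).
  have [lt|ge] := ltnP (m j).+1 N.+1.
    suff -> : line (grid m) (evec j) (mesh N) = grid (gshift j m) by [].
    apply: vec_eq => i; rewrite /line /vadd /vscale /evec /grid ffunE.
    case: eqP => [->|_]; last by ring.
    by rewrite /node /= modn_small // S_INR; ring.
  have mj : (m j).+1 = N.+1 by apply/eqP; rewrite eqn_leq ge ltn_ord.
  (* The cyclic shift jumps to the face [- M], while the true neighbour lies on the face [M]; [D]
     meets neither, so both values are 0. *)
  have no1 : ~ D (grid (gshift j m)).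
    move=> /HD hM; have := vnorm_coord (grid (gshift j m)) j.
    have -> : grid (gshift j m) j = - M.
      by rewrite /grid ffunE eqxx /node /= mj modnn /= Rmult_0_r Rplus_0_r.
    by rewrite Rabs_Ropp Rabs_pos_eq; lra.
  have no2 : ~ D (line (grid m) (evec j) (mesh N)).
    move=> /HD hM; have := vnorm_coord (line (grid m) (evec j) (mesh N)) j.
    have -> : line (grid m) (evec j) (mesh N) j = node N (m j).+1.
      by rewrite /line /vadd /vscale /evec eqxx /grid /node S_INR; ring.
    rewrite mj node_last Rabs_pos_eq; lra.
  by rewrite /G !ind0 // !Rmult_0_l.
have tele : \rsum_m G (gshift j m) = \rsum_m G m.
  by rewrite -(reindex_inj (@gshift_inj N j) (P := predT)).
have hb : Rabs (mesh N * \rsum_m (ind D (@grid N m) * W (grid m)))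
   <= INR #|{ffun 'I_k -> 'I_N.+1}| * (K * mesh N * mesh N).
  have -> : mesh N * (\rsum_m (ind D (@grid N m) * W (grid m)))
    = \rsum_m (mesh N * (ind D (@grid N m) * W (grid m)) - (G (gshift j m) - G m)).
    by rewrite -rsum_sub -rsum_scal -rsum_sub tele; ring.
  apply: Rle_trans (rsum_abs _ _) _; apply: rsum_le_const => m.
  rewrite sh Rabs_minus_sym; apply: HV.
    by apply: vnorm_lub => [|i]; [lra | apply/Rabs_le/node_range; apply: ltnW].
  apply: vnorm_lub => [|i]; first lra.
  rewrite /line /vadd /vscale /evec /grid; apply: Rabs_le.
  case: eqP => _; last by rewrite Rmult_0_r Rplus_0_r; apply: node_range; apply: ltnW.
  have -> : node N (m i) + mesh N * 1 = node N (m i).+1 by rewrite /node S_INR; ring.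
  exact: node_range.
apply: (Rmult_le_reg_l (mesh N)) => //.
rewrite -{1}(Rabs_pos_eq (mesh N)); last lra.
have p0 := pow_lt _ k d0.
rewrite -Rabs_mult.
have -> : forall s, mesh N * (mesh N ^ k * s) = mesh N ^ k * (mesh N * s) by move=> s; ring.
rewrite Rabs_mult Rabs_pos_eq; last lra.
rewrite -(mesh_card N).
have := Rmult_le_compat_l _ _ _ (Rlt_le _ _ p0) hb; lra.
Qed.

(** By the mean value theorem in [t] it is enough to bound the sum of the divergence of the flux at
    one time, direction by direction. The hypothesis on [c] makes the flux vanish at points of [D]
    closer than [c] to the complement, so cutting it off by [ind D] costs nothing once the mesh is
    below [c]. *)
Lemma riem_homotopy h0 h1 D r c : 0 <= r -> 0 < c ->
  (forall x, D x -> vnorm x < M) ->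
  (forall t x y, 0 <= t <= 1 -> D x -> ~ D y -> vnorm (vsub x y) < c ->
     r <= vnorm (mapv (hom h0 h1 t) x)) ->
  forall e, 0 < e -> exists N0, forall N, (N0 <= N)%N ->
    Rabs (riem N r D h1 - riem N r D h0) <= e.
Proof.
move=> r0 c0 HD col e e0.
have [K [K0 hK]] := flux_increment h0 h1 r M.
have P0 : 0 < (2 * M) ^ k by apply: pow_lt; lra.
pose C := INR k * ((2 * M) ^ k * K).
have C0 : 0 <= C.
  by apply: Rmult_le_pos (pos_INR _) _; apply: Rmult_le_pos => //; lra.
have hq : 0 < e / (C + 1) by apply: Rdiv_lt_0_compat; lra.
have [N0 hN0] := @mesh_small (Rmin (c / 2) (e / (C + 1))) ltac:(apply: Rmin_glb_lt; lra).
exists N0 => N /hN0 hN; have d0 := mesh_pos N.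
have hc : mesh N < c by have := Rmin_l (c / 2) (e / (C + 1)); lra.
have he : C * mesh N <= e.
  have h : mesh N <= e / (C + 1) by have := Rmin_r (c / 2) (e / (C + 1)); lra.
  have -> : e = (C + 1) * (e / (C + 1)) by field; lra.
  nra.
pose phi t := mesh N ^ k * \rsum_m (ind D (@grid N m) * density h0 h1 r t (grid m)).
have ends t h : (forall i x, hom h0 h1 t i x = h i x) ->
    (forall i j x, d1 (hom h0 h1 t i) j x = d1 (h i) j x) -> phi t = riem N r D h.
  move=> e1 e2; congr (_ * _); apply: eq_bigr => m _; congr (_ * _); rewrite /density.
  congr (bump r _ * _); first by apply: vec_eq => i; apply: e1.
  by rewrite -mdet_tr; congr mdet; apply: mat_eq => i j; apply: e2.
have phi1 : phi 1 = riem N r D h1 by apply: ends => *; rewrite ?homE ?hom_d1; ring.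
have phi0 : phi 0 = riem N r D h0 by apply: ends => *; rewrite ?homE ?hom_d1; ring.
pose dphi t := \rsum_j (mesh N ^ k * \rsum_m (ind D (@grid N m) * dflux h0 h1 r t j (grid m))).
have hd t : derivable_pt_lim phi t (dphi t).
  apply: dlim_ext (derivable_pt_lim_scal _ (mesh N ^ k) _ _
    (dlim_sum (fun m => derivable_pt_lim_scal _ (ind D (@grid N m)) _ _
      (dlim_density h0 h1 r t (grid m))))) => //.
  rewrite /dphi -rsum_scal exchange_big /=; congr (_ * _); apply: eq_bigr => m _.
  by rewrite rsum_scal.
rewrite -phi1 -phi0.
have [||t [ht ->]] := @MVT_gen phi 0 1 dphi.
- by move=> t _; apply/is_derive_Reals.
- by move=> t _; apply: derivable_continuous_pt; exists (dphi t); apply: hd.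
move: ht; rewrite Rmin_left ?Rmax_right; try lra; move=> ht.
rewrite Rminus_0_r Rmult_1_r; apply: Rle_trans he.
apply: Rle_trans (rsum_abs _ _) _; rewrite /C Rmult_assoc; apply: rsum_le_ord => j.
apply: (riem_flux_sum (V := flux h0 h1 r t j) (j := j)) => // x hx hy.
set y := line x (evec j) (mesh N).
have hxy : vnorm (vsub x y) < c.
  rewrite vnorm_sub_sym; have -> : vsub y x = vscale (mesh N) (evec j).
    by apply: vec_eq => i; rewrite /y /vsub /line /vadd; ring.
  by rewrite vnorm_scale vnorm_evec Rabs_pos_eq; lra.
have R0 : 0 <= K * mesh N * mesh N by apply: Rmult_le_pos; [apply: Rmult_le_pos; lra | lra].
have out z : r <= vnorm (mapv (hom h0 h1 t) z) ->
    flux h0 h1 r t j z = 0 /\ dflux h0 h1 r t j z = 0.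
  by move=> /(bump0_out r0) hz; rewrite /flux /dflux /bump hz; split; ring.
have [Dx|Dx] := classic (D x); have [Dy|Dy] := classic (D y).
- rewrite (ind1 Dx) (ind1 Dy) !Rmult_1_l; exact: hK (Rlt_le _ _ d0) hx hy.
- have [-> ->] := out x (col t x y ht Dx Dy hxy); rewrite (ind0 Dy).
  by rewrite !Rmult_0_l !Rmult_0_r !Rminus_0_r Rabs_R0.
- rewrite vnorm_sub_sym in hxy; have [-> _] := out y (col t y x ht Dy Dx hxy).
  by rewrite (ind0 Dx) !Rmult_0_l !Rmult_0_r !Rminus_0_r Rabs_R0.
- by rewrite (ind0 Dx) (ind0 Dy) !Rmult_0_l Rmult_0_r !Rminus_0_r Rabs_R0.
Qed.

End Grid.

Section Degree.
Variables (k : nat) (M : R).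
Hypothesis M0 : 0 < M.
Implicit Types (D : Vec k -> Prop) (h : C2map k).

Definition idmap : C2map k := fun i => C2coord i.
Definition ball (x0 : Vec k) rho (x : Vec k) := vnorm (vsub x x0) < rho.
Definition openbox (x : Vec k) := vnorm x < M.
(** Stands for the integral of the bump function; normalizing by it gives the identity degree 1 on
    the box by definition. *)
Definition mass N r := riem M N r openbox idmap.

Lemma jac_idmap x : mdet (jac idmap x) = 1.
Proof.
rewrite mdetE.
have -> : mx (jac idmap x) = (1%:M)%ring; last by rewrite det1.
by apply/matrixP => i j; rewrite !mxE /jac /= eq_sym; case: (i == j).
Qed.

(** Along the nodes the clamp to [[-rho, rho]] rises by [2 * rho] in total. A step contributes at
    most the mesh, and only if its left node is within [2 * rho], because the mesh is at most
    [rho]. *)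
Lemma node_count rho N : 0 < rho -> 2 * rho < M -> mesh M N <= rho ->
  2 * rho <= mesh M N * \big[Rplus/0]_(a < N.+1) ind (fun s => Rabs s <= 2 * rho) (node M N a).
Proof.
move=> r0 rM hd; have d0 := mesh_pos M0 N.
pose cl := clamp (- rho) rho.
have clP s : _ := @clampP (- rho) rho s ltac:(lra); rewrite -/cl in clP.
have step n : cl (node M N n.+1) - cl (node M N n)
    <= mesh M N * ind (fun s => Rabs s <= 2 * rho) (node M N n).
  have e : node M N n.+1 = node M N n + mesh M N by rewrite /node S_INR; ring.
  have c1 := clP (node M N n); have c2 := clP (node M N n.+1).
  have [h|h] := classic (Rabs (node M N n) <= 2 * rho); first by rewrite (ind1 (D := fun s => Rabs s <= 2 * rho)) //; lra.
  rewrite (ind0 (D := fun s => Rabs s <= 2 * rho)) //.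
  by move/Rnot_le_lt: h; rewrite /Rabs; case: Rcase_abs => ? ?; lra.
have tele n : cl (node M N n) - cl (node M N 0)
    <= \big[Rplus/0]_(a < n) (mesh M N * ind (fun s => Rabs s <= 2 * rho) (node M N a)).
  elim: n => [|n IH]; first by rewrite big_ord0; lra.
  rewrite big_ord_recr /=; apply: Rle_trans (Rplus_le_compat _ _ _ _ IH (step n)); lra.
have := tele N.+1; rewrite -rsum_scal node_last /node /= Rmult_0_r Rplus_0_r.
have -> : cl M = rho by have := clP M; lra.
have -> : cl (- M) = - rho by have := clP (- M); lra.
lra.
Qed.

(** On a cube of half-width [2 * rho] the bump is at least [(r^2 / 2)^2], and [node_count] along
    each axis provides enough nodes in the cube. *)
Lemma mass_lower r : 0 < r -> exists c, 0 < c /\ exists N0, forall N, (N0 <= N)%N ->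
  c <= mass N r.
Proof.
move=> r0; have k0 := pos_INR k.
(* Small enough for the cube to lie in the box and for [energy], at most [k] times the squared sup
   norm, to be at most [r^2 / 2] on it. *)
pose rho := Rmin (M / 4) (r / (4 * (INR k + 1))).
have rho0 : 0 < rho by apply: Rmin_glb_lt; apply: Rdiv_lt_0_compat; nra.
have rM : 2 * rho < M by have := Rmin_l (M / 4) (r / (4 * (INR k + 1))); rewrite -/rho; lra.
have rk : INR k * (2 * rho * (2 * rho)) <= r * r / 2.
  have := Rmin_r (M / 4) (r / (4 * (INR k + 1))); rewrite -/rho => hr.
  have h4 : 4 * (INR k + 1) * rho <= r.
    by have -> : r = 4 * (INR k + 1) * (r / (4 * (INR k + 1))) by [field; lra]; nra.
  have q2 : ((INR k + 1) * rho) * ((INR k + 1) * rho) <= r / 4 * (r / 4).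
    have q0 : 0 <= (INR k + 1) * rho by apply: Rmult_le_pos; lra.
    by apply: Rmult_le_compat; lra.
  have : INR k * (rho * rho) <= ((INR k + 1) * rho) * ((INR k + 1) * rho).
    have -> : (INR k + 1) * rho * ((INR k + 1) * rho)
      = (INR k * INR k + INR k + 1) * (rho * rho) + INR k * (rho * rho) by ring.
    by have := Rmult_le_pos (INR k * INR k + INR k + 1) (rho * rho); nra.
  nra.
have rr0 : 0 < r * r by apply: Rmult_lt_0_compat.
have b0 : 0 < r * r / 2 * (r * r / 2) by apply: Rmult_lt_0_compat; lra.
exists (r * r / 2 * (r * r / 2) * (2 * rho) ^ k); split.
  by apply: Rmult_lt_0_compat => //; apply: pow_lt; lra.
have [N0 hN0] := mesh_small M rho0; exists N0 => N /hN0 hN; have d0 := mesh_pos M0 N.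
pose chi (a : 'I_N.+1) := ind (fun s => Rabs s <= 2 * rho) (node M N a).
have h1 := node_count rho0 rM hN.
apply: (Rle_trans _ (r * r / 2 * (r * r / 2) * (mesh M N * \rsum_a chi a) ^ k)).
  apply: Rmult_le_compat_l; first lra.
  by apply: pow_incr; split => //; lra.
rewrite Rpow_mult_distr.
have -> : (\rsum_a chi a) ^ k = \big[Rmult/1]_(i < k) \rsum_a chi a.
  by rewrite big_const card_ord; elim: (k) => //= n ->.
(* Expanding the power of the count on one axis gives a sum over grid points of products of
   indicators. *)
rewrite (bigA_distr_bigA (fun (i : 'I_k) a => chi a)).
have -> : forall b s, b * (mesh M N ^ k * s) = mesh M N ^ k * (b * s) by move=> b s; ring.
apply: Rmult_le_compat_l; first by apply/Rlt_le/pow_lt.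
rewrite rsum_scal; apply: rsum_le => m _.
rewrite jac_idmap Rmult_1_r.
have -> : mapv idmap (grid M m) = grid M m by [].
have bp : 0 <= bump r (grid M m).
  by rewrite /bump; apply: Rle_0_sqr.
have ip := ind_ge0 openbox (grid M m).
have [all|nall] := classic (forall i, Rabs (grid M m i) <= 2 * rho); last first.
  have [i hi] := not_all_ex_not _ _ nall.
  rewrite (bigD1 i) //= /chi (ind0 (D := fun s => Rabs s <= 2 * rho) hi) Rmult_0_l Rmult_0_r; exact: Rmult_le_pos.
rewrite big1 => [|i _]; last by rewrite /chi ind1 //; apply: all.
rewrite ind1; last by apply: vnorm_lt => // i; have := all i; lra.
have hb : r * r / 2 <= bump0 r (grid M m).
  apply: Rle_trans (Rmax_r _ _).
  suff : energy (grid M m) <= r * r / 2 by lra.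
  apply: Rle_trans rk; apply: rsum_le_ord => i; have := all i.
  by move=> /Rabs_le_between ?; nra.
by rewrite /bump; nra.
Qed.

(* [mass] approximates the integral of the bump function and is bounded below, so [z] is unique. *)
Definition deg_is D h (z : R) := exists r0, 0 < r0 /\ forall r, 0 < r < r0 ->
  forall e, 0 < e -> exists N0, forall N, (N0 <= N)%N ->
    Rabs (riem M N r D h - z * mass N r) <= e.

Lemma deg_is_unique D h z z' : deg_is D h z -> deg_is D h z' -> z = z'.
Proof.
move=> [r0 [r00 h1]] [r1 [r10 h2]]; apply: NNPP => zz.
have hr : 0 < Rmin r0 r1 by apply: Rmin_glb_lt.
pose r := Rmin r0 r1 / 2.
have hr0 : 0 < r < r0 by have := Rmin_l r0 r1; rewrite /r; lra.
have hr1 : 0 < r < r1 by have := Rmin_r r0 r1; rewrite /r; lra.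
have [c [c0 [N0 hN0]]] := mass_lower (proj1 hr0).
have a0 : 0 < Rabs (z - z') by apply: Rabs_pos_lt; lra.
(* Two errors of this size add up to two thirds of [|z - z'| * c], which is less than [|z - z'|]
   times the mass. *)
have e0 : 0 < Rabs (z - z') * c / 3 by nra.
have [N1 hN1] := h1 r hr0 _ e0; have [N2 hN2] := h2 r hr1 _ e0.
pose N := maxn N0 (maxn N1 N2).
have l0 : (N0 <= N)%N by apply: leq_maxl.
have l1 : (N1 <= N)%N by rewrite /N !leq_max leqnn !orbT.
have l2 : (N2 <= N)%N by rewrite /N !leq_max leqnn !orbT.
have := hN1 N l1; have := hN2 N l2; have hm := hN0 N l0.
have hz : Rabs ((z - z') * mass N r) = Rabs (z - z') * mass N r.
  by rewrite Rabs_mult (Rabs_pos_eq (mass _ _)); lra.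
move=> i2 i1; have := Rabs_triang (riem M N r D h - z' * mass N r) (- (riem M N r D h - z * mass N r)).
rewrite Rabs_Ropp.
have -> : riem M N r D h - z' * mass N r + - (riem M N r D h - z * mass N r)
   = (z - z') * mass N r by ring.
rewrite hz; nra.
Qed.

Lemma riem_ext N r D D' h h' :
  (forall x, ind D x * (bump r (mapv h x) * mdet (jac h x))
           = ind D' x * (bump r (mapv h' x) * mdet (jac h' x))) ->
  riem M N r D h = riem M N r D' h'.
Proof. by move=> e; congr (_ * _); apply: eq_bigr => m _. Qed.

(** For [r < c] the bump vanishes at [h x] on [D] minus [D'], so the two Riemann sums are equal and
    not merely close. *)
Lemma deg_is_excise D D' h c z : 0 < c -> (forall x, D' x -> D x) ->
  (forall x, D x -> ~ D' x -> c <= vnorm (mapv h x)) -> deg_is D h z <-> deg_is D' h z.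
Proof.
move=> c0 sub hc.
have e N r : 0 < r < c -> riem M N r D h = riem M N r D' h.
  move=> hr; apply: riem_ext => x.
  have [Dx|Dx] := classic (D x); last first.
    by rewrite !ind0 // => /sub.
  have [Dx'|Dx'] := classic (D' x); first by rewrite !ind1.
  have hx := hc x Dx Dx'; rewrite /bump bump0_out; [ring | lra | lra].
split=> -[r0 [r00 hd]]; (exists (Rmin r0 c); split; first exact: Rmin_glb_lt);
  move=> r hr e0 e0p;
  have h1 : 0 < r < r0 by [have := Rmin_l r0 c; lra];
  have h2 : 0 < r < c by [have := Rmin_r r0 c; lra];
  have [N0 hN0] := hd r h1 e0 e0p; exists N0 => N hN.
- by rewrite -(e N r h2); apply: hN0.
- by rewrite (e N r h2); apply: hN0.
Qed.

Lemma deg_is_empty h : deg_is (fun _ => False) h 0.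
Proof.
exists 1; split; first lra; move=> r hr e e0; exists 0%nat => N _.
rewrite /riem big1 => [|m _]; last by rewrite ind0 // Rmult_0_l.
by rewrite Rmult_0_r Rmult_0_l Rminus_0_r Rabs_R0; lra.
Qed.

Lemma deg_is_union D1 D2 h z1 z2 : (forall x, D1 x -> ~ D2 x) ->
  deg_is D1 h z1 -> deg_is D2 h z2 -> deg_is (fun x => D1 x \/ D2 x) h (z1 + z2).
Proof.
move=> dis [r1 [r10 h1]] [r2 [r20 h2]]; exists (Rmin r1 r2); split; first exact: Rmin_glb_lt.
move=> r hr e e0.
have hr1 : 0 < r < r1 by have := Rmin_l r1 r2; lra.
have hr2 : 0 < r < r2 by have := Rmin_r r1 r2; lra.
have e2 : 0 < e / 2 by lra.
have [N1 hN1] := h1 r hr1 _ e2; have [N2 hN2] := h2 r hr2 _ e2.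
exists (maxn N1 N2) => N; rewrite geq_max => /andP [/hN1 l1 /hN2 l2].
have -> : riem M N r (fun x => D1 x \/ D2 x) h = riem M N r D1 h + riem M N r D2 h.
  rewrite /riem -Rmult_plus_distr_l -big_split; congr (_ * _); apply: eq_bigr => m _ /=.
  rewrite -Rmult_plus_distr_r; congr (_ * _).
  have [d1|d1] := classic (D1 (grid M m)); have [d2|d2] := classic (D2 (grid M m)).
  - by case: (dis _ d1).
  - by rewrite (ind1 d1) (ind0 d2) ind1; [ring | left].
  - by rewrite (ind0 d1) (ind1 d2) ind1; [ring | right].
  - by rewrite (ind0 d1) (ind0 d2) ind0; [ring | case].
have := Rabs_triang (riem M N r D1 h - z1 * mass N r) (riem M N r D2 h - z2 * mass N r).
have -> : riem M N r D1 h - z1 * mass N r + (riem M N r D2 h - z2 * mass N r)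
  = riem M N r D1 h + riem M N r D2 h - (z1 + z2) * mass N r by ring.
lra.
Qed.

(** Compactness of [[0,1]] times the box. A point of [D] has a ball inside [D], a point off the
    closure has a ball off [D], and at a boundary point the homotopy is nonzero, hence bounded below
    nearby. *)
Lemma collar h0 h1 D : is_open D -> (forall x, D x -> vnorm x < M) ->
  (forall t x, 0 <= t <= 1 -> boundary D x -> mapv (hom h0 h1 t) x <> vzero) ->
  exists c, 0 < c /\ forall t x y, 0 <= t <= 1 -> D x -> ~ D y -> vnorm (vsub x y) < c ->
     c <= vnorm (mapv (hom h0 h1 t) x).
Proof.
move=> oD DM nz.
have [K0 [K00 hK0]] := C2map_lip h0 M; have [K1 [K10 hK1]] := C2map_lip h1 M.
have := compact_prod (@compact_interval 0 1) (@compact_box k M).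
move=> /(_ (fun c p => D p.2 -> forall y, ~ D y -> vnorm (vsub p.2 y) < c ->
   c <= vnorm (mapv (hom h0 h1 p.1) p.2))).
case=> [c c' [t x] c0 cc hc Dx y Dy hxy| [t x] /= [ht hx] | c [c0 hc]].
- by have := hc Dx y Dy; lra.
- have [Dx|Dx] := classic (D x).
    have [r [r0 hr]] := oD x Dx; exists (r / 2); split; first lra.
    move=> [t' x'] [/= ht' hx'] hd Dx' y Dy hy; case: Dy; apply: hr.
    have := vnorm_sub_tri y x' x; rewrite (vnorm_sub_sym y x').
    by have := Rmax_r (Rabs (t' - t)) (vnorm (vsub x' x)); lra.
  have [cx|/not_closure [r [r0 hr]]] := classic (closure D x); last first.
    exists r; split => // -[t' x'] [/= ht' hx'] hd Dx'; case: (hr x' (max_ltr hd)).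
    exact: subset_closure.
  have a0 := vnorm_pos (nz t x ht (conj cx Dx)); set a := vnorm _ in a0.
  (* Moving [x] and [t] by less than [a / C] changes the homotopy by at most
     [3 * (K0 + K1) * (a / C)], which leaves [2 * (a / C)] of the norm [a]. *)
  pose C := 3 * (K0 + K1) + 2.
  have q0 : 0 < a / C by apply: Rdiv_lt_0_compat; rewrite /C; lra.
  exists (a / C); split => // -[t' x'] [/= ht' hx'] hd _ _ _ _.
  have [u1 u2] := hK0 x' x hx' hx; have [w1 w2] := hK1 x' x hx' hx.
  have [v1 _] := hK0 x x hx hx; have [v2 _] := hK1 x x hx hx.
  have d1 := max_ltl hd; have d2 := max_ltr hd.
  have close : vnorm (vsub (mapv (hom h0 h1 t') x') (mapv (hom h0 h1 t) x))
      <= (3 * (K0 + K1)) * (a / C).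
    apply: vnorm_lub => [|i]; first by apply: Rmult_le_pos; lra.
    rewrite /vsub /mapv !homE.
    have -> : (1 - t') * h0 i x' + t' * h1 i x' - ((1 - t) * h0 i x + t * h1 i x)
      = (1 - t') * (h0 i x' - h0 i x) + t' * (h1 i x' - h1 i x)
        + (t' - t) * (h1 i x - h0 i x) by ring.
    have b1 : Rabs (h0 i x' - h0 i x) <= K0 * (a / C).
      apply: Rle_trans (vnorm_coord (vsub (mapv h0 x') (mapv h0 x)) i) _.
      by apply: Rle_trans u2 _; apply: Rmult_le_compat_l; lra.
    have b2 : Rabs (h1 i x' - h1 i x) <= K1 * (a / C).
      apply: Rle_trans (vnorm_coord (vsub (mapv h1 x') (mapv h1 x)) i) _.
      by apply: Rle_trans w2 _; apply: Rmult_le_compat_l; lra.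
    have b3 : Rabs (h1 i x - h0 i x) <= K0 + K1.
      have c0 := Rle_trans _ _ _ (vnorm_coord (mapv h0 x) i) v1.
      have c1 := Rle_trans _ _ _ (vnorm_coord (mapv h1 x) i) v2.
      rewrite /mapv in c0 c1; have := Rabs_triang (h1 i x) (- h0 i x).
      by rewrite Rabs_Ropp -/(Rminus _ _); lra.
    have s1 := Rabs_triang ((1 - t') * (h0 i x' - h0 i x) + t' * (h1 i x' - h1 i x))
                 ((t' - t) * (h1 i x - h0 i x)).
    have s2 := Rabs_triang ((1 - t') * (h0 i x' - h0 i x)) (t' * (h1 i x' - h1 i x)).
    move: s1 s2; rewrite !Rabs_mult (Rabs_pos_eq t') ?(Rabs_pos_eq (1 - t')); try lra.
    have p1 := Rabs_pos (t' - t); have p2 := Rabs_pos (h1 i x - h0 i x).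
    have p3 := Rabs_pos (h1 i x' - h1 i x); have p4 := Rabs_pos (h0 i x' - h0 i x).
    have := Rmult_le_compat _ _ _ _ p1 p2 (Rlt_le _ _ d1) b3.
    nra.
  have := vnorm_le_sub (mapv (hom h0 h1 t) x) (mapv (hom h0 h1 t') x').
  rewrite vnorm_sub_sym -/a.
  have e : (3 * (K0 + K1) + 2) * (a / C) = a by rewrite /C; field; lra.
  move: (a / C) e close q0 => q; lra.
- exists c; split => // t x y ht Dx Dy hxy; apply: (hc (t, x) _ Dx y Dy hxy) => /=.
  by split => //; apply/Rlt_le/DM.
Qed.

Lemma deg_is_homotopy h0 h1 D z : is_open D -> (forall x, D x -> vnorm x < M) ->
  (forall t x, 0 <= t <= 1 -> boundary D x -> mapv (hom h0 h1 t) x <> vzero) ->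
  deg_is D h0 z -> deg_is D h1 z.
Proof.
move=> oD DM nz [r0 [r00 hd]]; have [c [c0 hc]] := collar oD DM nz.
exists (Rmin r0 c); split; first exact: Rmin_glb_lt.
move=> r hr e e0.
have h1' : 0 < r < r0 by have := Rmin_l r0 c; lra.
have h2 : r < c by have := Rmin_r r0 c; lra.
have e2 : 0 < e / 2 by lra.
have [N1 hN1] := hd r h1' _ e2.
have [|N2 hN2] := @riem_homotopy k M M0 h0 h1 D r c ltac:(lra) c0 DM _ _ e2.
  by move=> t x y ht Dx Dy hxy; have := hc t x y ht Dx Dy hxy; lra.
exists (maxn N1 N2) => N; rewrite geq_max => /andP [/hN1 l1 /hN2 l2].
have := Rabs_triang (riem M N r D h1 - riem M N r D h0) (riem M N r D h0 - z * mass N r).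
have -> : riem M N r D h1 - riem M N r D h0 + (riem M N r D h0 - z * mass N r)
  = riem M N r D h1 - z * mass N r by ring.
lra.
Qed.

Lemma deg_is_nozero h D : is_open D -> (forall x, D x -> vnorm x < M) ->
  (forall x, closure D x -> mapv h x <> vzero) -> deg_is D h 0.
Proof.
move=> oD DM nz.
have [x|x|x cx|x e cx e0|c [c0 hc]] :=
  @pos_lower k M (closure D) (fun x => vnorm (mapv h x)).
- by apply: closure_bound => y /DM; lra.
- exact: not_closure.
- exact: vnorm_pos (nz x cx).
- have [r [r0 hr]] := mapv_cont h x e0; exists r; split => // y _ hy.
  exact: Rle_lt_trans (norm_cont _ _ _) (hr y hy).
apply/(@deg_is_excise D (fun _ => False) h c) => //; last exact: deg_is_empty.
by move=> x Dx _; apply: hc; apply: subset_closure.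
Qed.

End Degree.

(** * Local degree at a regular zero *)

Section LinearPath.
Import GRing.Theory.
Local Open Scope ring_scope.

(* From P A = L U: contract L to the identity, then U to the signs of its diagonal.  This joins
   A to a signed permutation matrix, which preserves the bump function. *)
Lemma lup_path n (A : 'M[R]_n) : \det A <> 0 ->
  exists (A1 : 'M[R]_n) (s : 'S_n) (d : 'I_n -> R),
  [/\ forall i, d i = 1 \/ d i = -1,
      forall t : R, \det ((1 - t) *: A + t *: A1) <> 0 &
      forall t : R, (0 <= t <= 1)%R ->
        \det ((1 - t) *: A1 + t *: (\matrix_(i, j) (if s i == j then d j else 0))) <> 0].
Proof.
case: n A => [|n] A hA.
  exists A, 1%g, (fun _ => 1); split=> [i|t|t _]; first by left.
  - by rewrite det_mx00; apply/eqP; rewrite oner_eq0.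
  - by rewrite det_mx00; apply/eqP; rewrite oner_eq0.
have := cormen_lup_correct A; have := cormen_lup_perm A; have := cormen_lup_lower A.
have := cormen_lup_upper A.
case: (cormen_lup A) => [[P L] U] /= hU hL /is_perm_mxP [s ->] PA.
have {}PA : A = perm_mx s^-1%g *m (L *m U).
  have -> : L *m U = perm_mx s *m A by exact: esym PA.
  by rewrite mulmxA -perm_mxM mulVg perm_mx1 mul1mx.
have dperm : \det (perm_mx s^-1%g : 'M[R]_n.+1) != 0 by rewrite det_perm signr_eq0.
have dtr (D : 'M[R]_n.+1) : (forall i j : 'I_n.+1, (j < i)%N -> D i j = 0) ->
    \det D = \prod_i D i i.
  move=> h; rewrite -det_tr det_trig; first by apply: eq_bigr => i _; rewrite mxE.
  by apply/is_trig_mxP => i j ij; rewrite mxE h.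
have dL (t : R) : \det ((1 - t) *: L + t *: 1%:M) = 1.
  rewrite det_trig; last first.
    apply/is_trig_mxP => i j ij; rewrite !mxE hL ?(ltnW ij) //.
    by rewrite -val_eqE /= (ltn_eqF ij) !mulr0 addr0.
  by rewrite big1 // => i _; rewrite !mxE hL // eqxx !mulr1 subrK.
have dLL : \det L = 1 by have := dL 0; rewrite subr0 scale1r scale0r addr0.
have Unz i : U i i != 0.
  have : \det U != 0.
    by apply/eqP => U0; apply: hA; rewrite PA !det_mulmx U0 !mulr0.
  by rewrite (dtr U hU) => /prodf_neq0 h; apply: h.
pose d i : R := if Rlt_dec 0 (U i i) then 1 else -1.
exists (perm_mx s^-1%g *m U), s^-1%g, d; split.
- by move=> i; rewrite /d; case: Rlt_dec => h; [left | right].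
- move=> t; have -> : (1 - t) *: A + t *: (perm_mx s^-1%g *m U)
     = perm_mx s^-1%g *m (((1 - t) *: L + t *: 1%:M) *m U).
    by rewrite PA mulmxDl mulmxDr -!scalemxAl mul1mx -!scalemxAr.
  rewrite !det_mulmx dL mul1r; apply/eqP; rewrite mulf_eq0 negb_or dperm /=.
  by rewrite (dtr U hU); apply/prodf_neq0.
- move=> t ht; have -> : \matrix_(i, j) (if s^-1%g i == j then d j else 0)
     = perm_mx s^-1%g *m diag_mx (\row_j d j).
    apply/matrixP => i j; rewrite -row_permE !mxE.
    by case: eqP => [->|_]; rewrite ?mulr1n ?mulr0n.
  rewrite scalemxAr scalemxAr -mulmxDr det_mulmx; apply/eqP; rewrite mulf_eq0 negb_or dperm /=.
  rewrite dtr; last first.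
    by move=> i j ij; rewrite !mxE hU // -val_eqE /= (gtn_eqF ij) mulr0n !mulr0 addr0.
  apply/prodf_neq0 => i _; rewrite !mxE eqxx mulr1n.
  have := Unz i; rewrite /d; move: (U i i) => u; case: Rlt_dec => hu u0 /=; apply/eqP.
    have h : (0 < (1 - t) * u + t * 1)%R by nra.
    exact: Rgt_not_eq h.
  have hu' : (u < 0)%R.
    have : u <> 0%R by apply/eqP.
    lra.
  have h : ((1 - t) * u + t * (-1) < 0)%R by nra.
  exact: Rlt_not_eq h.
Qed.
End LinearPath.

Lemma sgnZ_pos r : 0 < r -> sgnZ r = 1%Z.
Proof. by rewrite /sgnZ; case: Rlt_dec. Qed.

Lemma sgnZ_neg r : r < 0 -> sgnZ r = (-1)%Z.
Proof. by rewrite /sgnZ; case: Rlt_dec => // *; lra. Qed.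

Section Linear.
Variable k : nat.
Implicit Types A B : Mat k.

Definition seg A B t : Mat k := fun i j => (1 - t) * A i j + t * B i j.

Lemma mapp_inv_bound A : mdet A <> 0 ->
  exists C, 0 < C /\ forall v, vnorm v <= C * vnorm (mapp A v).
Proof.
move=> hA; pose Ai : Mat k := fun i j => invmx (mx A) i j.
have hinv v : mapp Ai (mapp A v) = v.
  have uA : mx A \in unitmx by rewrite unitmxE GRing.unitfE -mdetE; apply/eqP.
  apply: vec_eq => i.
  have := f_equal (fun w : 'cV[R]_k => w i 0%ring) (mulKmx uA (\col_j v j)%ring).
  rewrite !mxE => e; apply: etrans e.
  apply: eq_bigr => j _; congr (_ * _).
  by rewrite !mxE; apply: eq_bigr => l _; rewrite !mxE.
pose a := \rsum_i \rsum_j Rabs (Ai i j).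
have a0 i j : Rabs (Ai i j) <= a.
  apply: (Rle_trans _ (\rsum_j Rabs (Ai i j))).
    by apply: (rsum_ge_term (F := fun j => Rabs (Ai i j))) => l; apply: Rabs_pos.
  apply: (rsum_ge_term (F := fun i => \rsum_j Rabs (Ai i j))) => l.
  by apply: rsum_ge0 => *; apply: Rabs_pos.
have ap : 0 <= a by apply: rsum_ge0 => i _; apply: rsum_ge0 => j _; apply: Rabs_pos.
have k0 := pos_INR k; have ka := Rmult_le_pos _ _ k0 ap.
exists (INR k * a + 1); split; first lra.
move=> v; have := mapp_bound (mapp A v) a0; rewrite hinv.
by have := vnorm_ge0 (mapp A v); lra.
Qed.

(** Otherwise the intermediate value theorem would produce a zero of the determinant on the
    segment. *)
Lemma seg_sign A B : (forall t, 0 <= t <= 1 -> mdet (seg A B t) <> 0) ->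
  0 < mdet A * mdet B.
Proof.
move=> h; pose f t := mdet (seg A B t).
have fc : continuity f.
  move=> t; apply: derivable_continuous_pt; eexists.
  apply: (@dlim_det k (seg A B) (fun i j => B i j - A i j)) => i j; exact: dlim_affine.
have f0 : f 0 = mdet A.
  congr mdet; apply: mat_eq => i j.
  by rewrite /seg; ring.
have f1 : f 1 = mdet B.
  congr mdet; apply: mat_eq => i j.
  by rewrite /seg; ring.
apply: Rnot_le_lt => hle.
have [t [ht ft]] : {t | Rmin 0 1 <= t <= Rmax 0 1 /\ f t = 0}.
  apply: IVT_gen; first exact: fc.
  rewrite f0 f1 /Rmin /Rmax; case: Rle_dec => hab; split; nra.
by apply: (h t) => //; move: ht; rewrite Rmin_left ?Rmax_right; lra.
Qed.

Definition lin A (x0 : Vec k) : C2map k := fun i =>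
  C2sum (index_enum 'I_k) (fun j => C2scale (A i j) (C2add (C2coord j) (C2const k (- x0 j)))).

Lemma lin_val A x0 x : mapv (lin A x0) x = mapp A (vsub x x0).
Proof. by apply: vec_eq => i; rewrite /mapv /lin C2sumE. Qed.

Lemma lin_jac A x0 x : jac (lin A x0) x = A.
Proof.
apply: mat_eq => i j.
rewrite /jac /lin C2sum_d1 (bigD1 j) //= eqxx big1 => [|l /negbTE lj]; first by ring.
by rewrite eq_sym lj; ring.
Qed.

Lemma hom_lin A B x0 t x : mapv (hom (lin A x0) (lin B x0) t) x = mapp (seg A B t) (vsub x x0).
Proof.
apply: vec_eq => i; rewrite /mapv homE.
have e C : lin C x0 i x = mapp C (vsub x x0) i by rewrite -lin_val.
rewrite !e /mapp !rsum_scal -big_split; apply: eq_bigr => j _ /=; rewrite /seg; ring.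
Qed.

Lemma mapp_nonzero A v : mdet A <> 0 -> v <> vzero -> mapp A v <> vzero.
Proof.
move=> hA v0 e; have [C [C0 hC]] := mapp_inv_bound hA.
by have := hC v; rewrite e vnorm_zero => h; apply: v0; apply: vnorm_eq0; lra.
Qed.

Lemma ball_open (x0 : Vec k) rho : is_open (ball x0 rho).
Proof.
move=> x hx; exists (rho - vnorm (vsub x x0)); split; first by rewrite /ball in hx; lra.
by move=> y hy; rewrite /ball; have := vnorm_sub_tri y x x0; lra.
Qed.

Lemma ball_closure (x0 : Vec k) rho x : closure (ball x0 rho) x -> vnorm (vsub x x0) <= rho.
Proof.
move=> h; apply: Rnot_lt_le => hx.
have [y [hy]] := h (vnorm (vsub x x0) - rho) ltac:(lra).
rewrite /ball in hy; have := vnorm_sub_tri x y x0; rewrite (vnorm_sub_sym x y); lra.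
Qed.

Lemma ball_boundary (x0 : Vec k) rho x : boundary (ball x0 rho) x -> vnorm (vsub x x0) = rho.
Proof. by move=> [/ball_closure h1 /Rnot_lt_le h2]; lra. Qed.

Lemma vsubx0 (x : Vec k) : vsub x vzero = x.
Proof. by vec_ring. Qed.

End Linear.

Section LocalDegree.
Variables (k : nat) (M : R).
Hypothesis M0 : 0 < M.

Lemma ball_in_box (x0 : Vec k) rho : vnorm x0 + rho <= M ->
  forall x, ball x0 rho x -> vnorm x < M.
Proof. by rewrite /ball => h x hx; have := vnorm_le_sub x x0; lra. Qed.

Definition idm : Mat k := fun i j => if i == j then 1 else 0.

Lemma mapp_idm v : mapp idm v = v.
Proof.
apply: vec_eq => i; rewrite /mapp (bigD1 i) //= /idm eqxx big1 => [|j /negbTE]; first by ring.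
by rewrite eq_sym => ->; ring.
Qed.

(** On the open box the identity has degree 1 by the choice of [mass]. The homotopy to [x - x0] has
    its zero at [t * x0], inside the box, and excision passes to the ball. *)
Lemma deg_ball_idm (x0 : Vec k) rho : 0 < rho -> vnorm x0 + rho <= M ->
  deg_is M (ball x0 rho) (lin idm x0) 1.
Proof.
move=> r0 hr.
have h0 : deg_is M (@openbox k M) (@idmap k) 1.
  exists 1; split; first lra; move=> r _ e e0; exists 0%nat => N _.
  by rewrite /mass Rmult_1_l Rminus_diag Rabs_R0; lra.
have ob : @openbox k M = ball vzero M.
  by apply: functional_extensionality => x; rewrite /ball vsubx0.
have h1 : deg_is M (@openbox k M) (lin idm x0) 1.
  apply: (deg_is_homotopy M0 _ _ _ h0) => //.
    by rewrite ob; apply: ball_open.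
  move=> t x ht; rewrite ob => /ball_boundary; rewrite vsubx0 => hx e.
  have ex : x = vscale t x0.
    apply: vec_eq => i; have := f_equal (fun w => w i) e; rewrite /mapv homE.
    have -> : lin idm x0 i x = x i - x0 i.
      by have := f_equal (fun w => w i) (lin_val idm x0 x); rewrite mapp_idm.
    have -> : @idmap k i x = x i by [].
    by rewrite /vscale /vzero; lra.
  have := vnorm_scale t x0; rewrite -ex (Rabs_pos_eq t) ?hx; last lra.
  by have := vnorm_ge0 x0; nra.
refine (proj1 (@deg_is_excise k M _ _ _ rho _ r0 _ _) h1).
- exact: ball_in_box.
- by move=> x _ /Rnot_lt_le; rewrite lin_val mapp_idm.
Qed.

(** A signed permutation preserves [energy], so its Riemann sum is exactly its determinant times
    that of the identity matrix. *)
Lemma deg_ball_signed_perm (s : 'S_k) (d : 'I_k -> R) (x0 : Vec k) rho :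
  (forall i, d i = 1 \/ d i = -1) -> 0 < rho -> vnorm x0 + rho <= M ->
  let Q : Mat k := fun i j => if s i == j then d j else 0 in
  deg_is M (ball x0 rho) (lin Q x0) (mdet Q).
Proof.
move=> hd r0 hr Q; have [r1 [r10 h]] := deg_ball_idm r0 hr.
have e N r : riem M N r (ball x0 rho) (lin Q x0) = mdet Q * riem M N r (ball x0 rho) (lin idm x0).
  rewrite /riem.
  have -> : forall b c x, b * (c * x) = c * (b * x) by move=> b c x; ring.
  congr (_ * _); rewrite rsum_scal; apply: eq_bigr => m _.
  rewrite !lin_jac !lin_val mapp_idm; set v := vsub _ _.
  have -> : mdet idm = 1 by rewrite -(@jac_idmap k x0); congr mdet;
    apply: mat_eq => i j;
    rewrite /idm /jac /= eq_sym.
  suff -> : bump r (mapp Q v) = bump r v by ring.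
  rewrite /bump; suff -> : bump0 r (mapp Q v) = bump0 r v by [].
  congr (pos (_ - _)).
  rewrite [RHS](reindex_inj (@perm_inj _ s)) /=; apply: eq_bigr => i _.
  have -> : mapp Q v i = d (s i) * v (s i).
    rewrite /mapp (bigD1 (s i)) //= /Q eqxx big1 => [|j /negbTE]; first by ring.
    by rewrite eq_sym => ->; ring.
  by case: (hd (s i)) => ->; ring.
exists r1; split => // r hr1 e0 e00.
have q0 : 0 < e0 / (Rabs (mdet Q) + 1).
  by apply: Rdiv_lt_0_compat => //; have := Rabs_pos (mdet Q); lra.
have [N0 hN0] := h r hr1 _ q0; exists N0 => N /hN0; rewrite e Rmult_1_l => hN.
have -> : mdet Q * riem M N r (ball x0 rho) (lin idm x0) - mdet Q * mass k M N r
  = mdet Q * (riem M N r (ball x0 rho) (lin idm x0) - mass k M N r) by ring.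
rewrite Rabs_mult; have p := Rabs_pos (mdet Q).
have e1 : (Rabs (mdet Q) + 1) * (e0 / (Rabs (mdet Q) + 1)) = e0 by field; lra.
nra.
Qed.

Lemma deg_ball_seg (A B : Mat k) (x0 : Vec k) rho z : 0 < rho -> vnorm x0 + rho <= M ->
  (forall t, 0 <= t <= 1 -> mdet (seg A B t) <> 0) ->
  deg_is M (ball x0 rho) (lin B x0) z -> deg_is M (ball x0 rho) (lin A x0) z.
Proof.
move=> r0 hr hs; apply: deg_is_homotopy => //.
- exact: ball_open.
- exact: ball_in_box.
move=> t x ht /ball_boundary hx; rewrite hom_lin; apply: mapp_nonzero.
  have -> : seg B A t = seg A B (1 - t).
    apply: mat_eq => i j.
    by rewrite /seg; ring.
  by apply: hs; lra.
by move=> e; move: hx; rewrite e vnorm_zero; lra.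
Qed.

(** [A] is joined through invertible matrices to a signed permutation, whose determinant is 1 or -1
    and has the sign of [mdet A]. *)
Lemma deg_ball_linear (A : Mat k) (x0 : Vec k) rho : 0 < rho -> vnorm x0 + rho <= M ->
  mdet A <> 0 -> deg_is M (ball x0 rho) (lin A x0) (IZR (sgnZ (mdet A))).
Proof.
move=> r0 hr hA.
have [] := @lup_path k (mx A); first by rewrite -mdetE.
move=> A1 [s [d [hd' h1 h2]]]; have hd i : d i = 1 \/ d i = -1 := hd' i.
pose B : Mat k := fun i j => A1 i j.
pose Q : Mat k := fun i j => if s i == j then d j else 0.
have s1 t : 0 <= t <= 1 -> mdet (seg A B t) <> 0.
  move=> _; rewrite mdetE; have -> : mx (seg A B t) = ((1 - t) *: mx A + t *: A1)%ring.
    by apply/matrixP => i j; rewrite !mxE.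
  exact: h1.
have s2 t : 0 <= t <= 1 -> mdet (seg B Q t) <> 0.
  move=> ht; rewrite mdetE; have -> : mx (seg B Q t)
    = ((1 - t) *: A1 + t *: (\matrix_(i, j) (if s i == j then d j else 0%R)))%ring.
    by apply/matrixP => i j; rewrite !mxE.
  exact: h2.
have -> : IZR (sgnZ (mdet A)) = mdet Q.
  have p1 := seg_sign s1; have p2 := seg_sign s2.
  have q2 : mdet Q * mdet Q = 1.
    have -> : mdet Q = (if odd_perm s then -1 else 1) * \big[Rmult/1]_(i < k) d (s i).
      (* Only the permutation [s] itself contributes to the expansion. *)
      rewrite /mdet (bigD1 s) //= [X in _ + X]big1 => [|u us].
        rewrite Rplus_0_r; congr (_ * _); apply: eq_bigr => i _; by rewrite /Q eqxx.
      have [i hi] : exists i, s i != u i.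
        apply/existsP; rewrite -negb_forall; apply: contra us => /forallP h.
        by apply/eqP/permP => i; apply/eqP; rewrite eq_sym.
      by rewrite (bigD1 i) //= /Q (negbTE hi) Rmult_0_l Rmult_0_r.
    have : (\big[Rmult/1]_(i < k) d (s i)) * (\big[Rmult/1]_(i < k) d (s i)) = 1.
      have dd j : d j * d j = 1 by case: (hd j) => ->; ring.
      by rewrite -big_split; apply: big1 => i _; apply: dd.
    by case: (odd_perm s) => /= h; nra.
  have q1 : mdet Q = 1 \/ mdet Q = -1.
    have : (mdet Q - 1) * (mdet Q + 1) = 0 by lra.
    by case/Rmult_integral => h; [left | right]; lra.
  have {p1 p2} p3 : 0 < mdet A * mdet Q.
    apply: Rnot_le_lt => h; have := Rmult_lt_0_compat _ _ p1 p2.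
    have := Rle_0_sqr (mdet B); rewrite /Rsqr => b0.
    have -> : mdet A * mdet B * (mdet B * mdet Q) = (mdet B * mdet B) * (mdet A * mdet Q) by ring.
    by have := Rmult_le_compat_l _ _ _ b0 h; lra.
  case: q1 => q1; rewrite q1 in p3 *; first by rewrite sgnZ_pos //; lra.
  by rewrite sgnZ_neg //; lra.
by apply: (deg_ball_seg r0 hr s1); apply: (deg_ball_seg r0 hr s2); apply: deg_ball_signed_perm.
Qed.

(** With [n] the distance to [x0], the Taylor remainder is at most [K * n^2] and the linear part at
    least [n / C]. Below the chosen radius the linear part wins strictly, so the linear homotopy to
    the differential has no zero on the sphere and [x0] is isolated. *)
Lemma deg_ball_regular_zero (G : C2map k) (x0 : Vec k) :
  mapv G x0 = vzero -> mdet (jac G x0) <> 0 ->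
  exists rho0, 0 < rho0 /\ forall rho, 0 < rho <= rho0 -> vnorm x0 + rho <= M ->
    deg_is M (ball x0 rho) G (IZR (sgnZ (mdet (jac G x0)))) /\
    forall x, ball x0 rho x -> mapv G x = vzero -> x = x0.
Proof.
move=> G0 hA; set A := jac G x0 in hA *.
have [C [C0 hC]] := mapp_inv_bound hA; have [K [K0 hK]] := C2map_taylor G (vnorm x0 + 1).
have KC : 0 <= K * C by apply: Rmult_le_pos; lra.
have q0 : 0 < / (2 * (K * C + 1)) by apply: Rinv_0_lt_compat; lra.
exists (Rmin 1 (/ (2 * (K * C + 1)))); split; first by apply: Rmin_glb_lt; lra.
have near x : vnorm (vsub x x0) <= Rmin 1 (/ (2 * (K * C + 1))) -> x <> x0 ->
    vnorm (vsub (mapv G x) (mapp A (vsub x x0))) < vnorm (mapp A (vsub x x0)).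
  move=> hx xx; have n0 : 0 < vnorm (vsub x x0).
    by apply: vnorm_pos => /vsub_eq0.
  have hx1 := le_minl hx; have hx2 := le_minr hx.
  have ex : vadd x0 (vsub x x0) = x by vec_ring.
  have := hK x0 (vsub x x0); rewrite ex G0 vsubx0 => /(_ _ _) h.
  have b := h ltac:(lra) ltac:(have := vnorm_le_sub x x0; lra).
  apply: Rle_lt_trans b _; set n := vnorm _ in n0 hx1 hx2 *.
  have hc := hC (vsub x x0); rewrite -/n in hc; set w := vnorm _ in hc *.
  have e : (2 * (K * C + 1)) * / (2 * (K * C + 1)) = 1 by field; lra.
  have h1 : (K * C + 1) * n <= / 2.
    have h1' := Rmult_le_compat_l (2 * (K * C + 1)) _ _ ltac:(lra) hx2; lra.
  have w0 : 0 < w by apply: Rnot_le_lt => w0; nra.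
  have h2 : K * n * n <= K * n * (C * w).
    by apply: Rmult_le_compat_l => //; apply: Rmult_le_pos; lra.
  nra.
move=> rho hr hrM; split; last first.
  move=> x hx Gx; apply: NNPP => xx.
  rewrite /ball in hx; have := near x ltac:(lra) xx.
  by rewrite Gx (vnorm_sub_sym vzero) vsubx0; lra.
apply: deg_is_homotopy (deg_ball_linear _ hrM hA); last by lra.
- by [].
- exact: ball_open.
- exact: ball_in_box.
move=> t x ht /ball_boundary hx e.
have xx : x <> x0 by move=> xx; move: hx; rewrite xx vsubxx vnorm_zero; lra.
have hn := near x ltac:(lra) xx.
have ea : mapp A (vsub x x0) = vscale (- t) (vsub (mapv G x) (mapp A (vsub x x0))).
  apply: vec_eq => i; have := f_equal (fun w => w i) e; rewrite /mapv homE.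
  have -> : lin A x0 i x = mapp A (vsub x x0) i by rewrite -lin_val.
  by rewrite /vscale /vsub /vzero; lra.
have := vnorm_scale (- t) (vsub (mapv G x) (mapp A (vsub x x0))).
rewrite -ea Rabs_Ropp Rabs_pos_eq; last lra.
have := vnorm_ge0 (vsub (mapv G x) (mapp A (vsub x x0))); nra.
Qed.
End LocalDegree.

(** * Smooth approximation *)

(** At 0 and 1 one side is constant and the other follows [P]; the one-sided derivatives agree
    because [P'] vanishes there. *)
Lemma dlim_clamp01 (P P' : R -> R) s : (forall c, derivable_pt_lim P c (P' c)) ->
  P' 0 = 0 -> P' 1 = 0 -> derivable_pt_lim (fun s => P (clamp 0 1 s)) s (P' (clamp 0 1 s)).
Proof.
move=> hP h0 h1 eps e0; have [del hdel] := hP (clamp 0 1 s) eps e0.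
(* An increment below [m] does not carry [s] across an end of [[0,1]], unless [s] is that end. *)
have [m [m0 hm]] : exists m, 0 < m /\ ((s < 0 -> m <= - s) /\ (1 < s -> m <= s - 1)
    /\ (0 < s < 1 -> m <= s /\ m <= 1 - s) /\ m <= 1).
  have [a|a] := Rlt_le_dec s 0; first by exists (Rmin 1 (- s)); have := Rmin_l 1 (- s);
    have := Rmin_r 1 (- s); split; [apply: Rmin_glb_lt | ]; lra.
  have [b|b] := Rlt_le_dec 1 s; first by exists (Rmin 1 (s - 1)); have := Rmin_l 1 (s - 1);
    have := Rmin_r 1 (s - 1); split; [apply: Rmin_glb_lt | ]; lra.
  have [c|c] := Rle_lt_dec s 0; first by exists 1; lra.
  have [d|d] := Rle_lt_dec 1 s; first by exists 1; lra.
  exists (Rmin s (1 - s)); have := Rmin_l s (1 - s); have := Rmin_r s (1 - s).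
  by split; [apply: Rmin_glb_lt | ]; lra.
have q0 : 0 < Rmin del m by apply: Rmin_glb_lt => //; apply: cond_pos.
exists (mkposreal _ q0) => h hn /= hh.
have hd := lt_minl hh.
have hm' := lt_minr hh.
have /Rabs_lt_between hm2 := hm'.
have c1 := @clampP 0 1 s Rle_0_1; have c2 := @clampP 0 1 (s + h) Rle_0_1.
have [e|e] : clamp 0 1 (s + h) = clamp 0 1 s + h \/
    (clamp 0 1 (s + h) = clamp 0 1 s /\ P' (clamp 0 1 s) = 0).
  have [a|a] := Rlt_le_dec s 0.
    by right; have -> : clamp 0 1 s = 0 by [lra]; split => //; lra.
  have [b|b] := Rlt_le_dec 1 s.
    by right; have -> : clamp 0 1 s = 1 by [lra]; split => //; lra.
  have [c|c] := Rle_lt_dec s 0.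
    have e : clamp 0 1 s = 0 by lra.
    rewrite e; have [g|g] := Rle_lt_dec 0 h; [left; lra | right; split => //; lra].
  have [d|d] := Rle_lt_dec 1 s.
    have e : clamp 0 1 s = 1 by lra.
    rewrite e; have [g|g] := Rle_lt_dec h 0; [left; lra | right; split => //; lra].
  left; lra.
- by rewrite e; apply: hdel.
- case: e => -> ->; rewrite Rminus_diag Rminus_0_r /Rdiv Rmult_0_l Rabs_R0; lra.
Qed.

Lemma lip_on_bounded_of_loclip (phi : R -> R) :
  loclip (fun x : Vec 1 => phi (x ord0)) -> lip_on_bounded phi.
Proof.
move=> h M; have [K [K0 hK]] := h M; exists K; split => // s t hs ht.
have n (u : R) : vnorm (fun _ : 'I_1 => u) = Rabs u.
  apply: Rle_antisym; last exact: (vnorm_coord (fun _ : 'I_1 => u) ord0).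
  by apply: vnorm_lub => [|_]; [apply: Rabs_pos | apply: Rle_refl].
have := hK tt (fun=> s) (fun=> t); rewrite !n => /(_ hs ht) [h1 h2]; split => //.
Qed.

Lemma clamp01_lip : lip_on_bounded (clamp 0 1).
Proof.
move=> M; exists 1; split; first lra.
move=> s t _ _; have := @clampP 0 1 s Rle_0_1; have := @clampP 0 1 t Rle_0_1.
have a1 := Rle_abs (s - t); have a2 := Rabs_maj2 (s - t) => h1 h2.
by split; apply: Rabs_le; lra.
Qed.

(* The quintic smoothstep: its derivative 30 c^2 (1 - c)^2 has double zeros at 0 and 1, so its
   extension by constants is C2. *)
Definition step0 c := c * c * c * (10 + -15 * c + 6 * (c * c)).
Definition step1 c := 30 * (c * c) * ((1 + -1 * c) * (1 + -1 * c)).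
Definition step2 c := 60 * c * ((1 + -1 * c) * (1 + -2 * c)).
Definition sigma0 s := step0 (clamp 0 1 s).
Definition sigma1 s := step1 (clamp 0 1 s).
Definition sigma2 s := step2 (clamp 0 1 s).

Lemma dlim_sigma0 s : derivable_pt_lim sigma0 s (sigma1 s).
Proof.
apply: (@dlim_clamp01 step0 step1) => [c||]; rewrite /step1; try ring.
by apply/is_derive_Reals; rewrite /step0; auto_derive => //; ring.
Qed.

Lemma dlim_sigma1 s : derivable_pt_lim sigma1 s (sigma2 s).
Proof.
apply: (@dlim_clamp01 step1 step2) => [c||]; rewrite /step2; try ring.
by apply/is_derive_Reals; rewrite /step1; auto_derive => //; ring.
Qed.

Lemma sigma0_le0 s : s <= 0 -> sigma0 s = 0.
Proof. by move=> h; rewrite /sigma0; have -> : clamp 0 1 s = 0 by [have := @clampP 0 1 s Rle_0_1; lra]; rewrite /step0; ring. Qed.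

Lemma sigma0_ge1 s : 1 <= s -> sigma0 s = 1.
Proof. by move=> h; rewrite /sigma0; have -> : clamp 0 1 s = 1 by [have := @clampP 0 1 s Rle_0_1; lra]; rewrite /step0; ring. Qed.

Lemma sigma0_mono s t : s <= t -> sigma0 s <= sigma0 t.
Proof.
move=> st; have [||c [_ e]] := @MVT_gen sigma0 s t sigma1.
- by move=> x _; apply/is_derive_Reals; apply: dlim_sigma0.
- by move=> x _; apply: derivable_continuous_pt; exists (sigma1 x); apply: dlim_sigma0.
suff : 0 <= sigma1 c by nra.
rewrite /sigma1 /step1; set u := clamp 0 1 c.
by have := Rle_0_sqr u; have := Rle_0_sqr (1 + -1 * u); rewrite /Rsqr; nra.
Qed.

Lemma poly_clamp_lip (a b : R) (P : R -> R) :
  (forall (f : Vec 1 -> R), loclip f -> loclip (fun x => P (f x))) ->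
  lip_on_bounded (fun s => P (clamp 0 1 (a * s + b))).
Proof.
move=> h; apply: lip_on_bounded_of_loclip; apply: h.
apply: (ulip_comp clamp01_lip (f := fun _ x => a * x ord0 + b)).
apply: ulip_add; last exact: loclip_const.
by apply: ulip_scale; apply: ulip_coord.
Qed.

Section Spline.
Variable k : nat.

Definition spline_step (a b : R) (i : 'I_k) : C2fun k.
Proof.
apply: (@C2coord_fun k (fun s => sigma0 (a * s + b)) (fun s => sigma1 (a * s + b) * a)
  (fun s => sigma2 (a * s + b) * a * a) i).
- move=> s; apply: (derivable_pt_lim_comp (fun s => a * s + b)); last exact: dlim_sigma0.
  by apply/is_derive_Reals; auto_derive => //; ring.
- move=> s; apply: dlim_ext (derivable_pt_lim_scal _ a _ _ (derivable_pt_lim_comp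
    (fun s => a * s + b) sigma1 s a _ _ (dlim_sigma1 _))).
  + by move=> u; rewrite /mult_real_fct /comp; ring.
  + ring.
  + by apply/is_derive_Reals; auto_derive => //; ring.
- apply: poly_clamp_lip => f hf; rewrite /step0.
  by do ?[apply: ulip_mul => //|apply: ulip_add => //]; exact: loclip_const.
- apply: (@poly_clamp_lip a b (fun c => step1 c * a)) => f hf; rewrite /step1.
  by do ?[apply: ulip_mul => //|apply: ulip_add => //]; exact: loclip_const.
- apply: (@poly_clamp_lip a b (fun c => step2 c * a * a)) => f hf; rewrite /step2.
  by do ?[apply: ulip_mul => //|apply: ulip_add => //]; exact: loclip_const.
Defined.

End Spline.

Section Smoothing.
Variables (k : nat) (M : R).
Hypothesis M0 : 0 < M.

(** A difference of two consecutive smoothsteps: it lives on the two cells to the right of node [m],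
    and the family telescopes. *)
Definition weight N (m : 'I_N.+1) (i : 'I_k) : C2fun k :=
  C2add (spline_step (/ mesh M N) (M / mesh M N - INR m) i)
    (C2scale (-1) (spline_step (/ mesh M N) (M / mesh M N - INR m - 1) i)).

Definition bweight N (m : {ffun 'I_k -> 'I_N.+1}) : C2fun k :=
  C2prod (index_enum 'I_k) (fun i => weight (m i) i).

Lemma weightE N (m : 'I_N.+1) i x : weight m i x =
  sigma0 ((x i + M) / mesh M N - INR m) - sigma0 ((x i + M) / mesh M N - INR m - 1).
Proof.
have d0 := mesh_pos M0 N.
have -> : weight m i x = sigma0 (/ mesh M N * x i + (M / mesh M N - INR m))
  + -1 * sigma0 (/ mesh M N * x i + (M / mesh M N - INR m - 1)) by [].
have -> : / mesh M N * x i + (M / mesh M N - INR m) = (x i + M) / mesh M N - INR m.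
  by field; lra.
have -> : / mesh M N * x i + (M / mesh M N - INR m - 1) = (x i + M) / mesh M N - INR m - 1.
  by field; lra.
ring.
Qed.

Lemma weight_ge0 N (m : 'I_N.+1) i x : 0 <= weight m i x.
Proof.
rewrite weightE; set u := _ - INR m.
by have := @sigma0_mono (u - 1) u; lra.
Qed.

(** Telescoping leaves the first smoothstep minus the one after the last; the margin of one mesh
    puts [x] past the rise of the former and before that of the latter. *)
Lemma weight_sum N i (x : Vec k) : vnorm x <= M - mesh M N ->
  \big[Rplus/0]_(m : 'I_N.+1) weight m i x = 1.
Proof.
move=> hx; have d0 := mesh_pos M0 N; set u := (x i + M) / mesh M N.
have tele n : \big[Rplus/0]_(m < n) (sigma0 (u - INR m) - sigma0 (u - INR m - 1))
    = sigma0 u - sigma0 (u - INR n).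
  elim: n => [|n IH]; first by rewrite big_ord0 /= Rminus_0_r; ring.
  rewrite big_ord_recr IH S_INR /=.
  have -> : u - (INR n + 1) = u - INR n - 1 by ring.
  rewrite /=; change (sigma0 u - sigma0 (u - INR n) + (sigma0 (u - INR n) - sigma0 (u - INR n - 1))
    = sigma0 u - sigma0 (u - INR n - 1)); ring.
have -> : \big[Rplus/0]_(m : 'I_N.+1) weight m i x
    = \big[Rplus/0]_(m < N.+1) (sigma0 (u - INR m) - sigma0 (u - INR m - 1)).
  by apply: eq_bigr => m _; rewrite weightE.
have /Rabs_le_between hxi := Rle_trans _ _ _ (vnorm_coord x i) hx.
have um : u * mesh M N = x i + M by rewrite /u; field; lra.
have NM : INR N.+1 * mesh M N = 2 * M by rewrite /mesh; field; apply: not_0_INR.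
rewrite tele sigma0_ge1 ?sigma0_le0; first ring.
- by apply: Rnot_lt_le => h; have := Rmult_lt_compat_r _ _ _ d0 h; rewrite Rmult_0_l; lra.
- by apply: Rnot_lt_le => h; have := Rmult_lt_compat_r _ _ _ d0 h; lra.
Qed.

Lemma weight_support N (m : 'I_N.+1) i x : weight m i x <> 0 ->
  Rabs (node M N m - x i) < 2 * mesh M N.
Proof.
have d0 := mesh_pos M0 N.
rewrite weightE; set u := (x i + M) / mesh M N => h.
have um : u * mesh M N = x i + M by rewrite /u; field; lra.
have h1 : 0 < u - INR m.
  by apply: Rnot_le_lt => h1; apply: h; rewrite !sigma0_le0; lra.
have h2 : u - INR m - 1 < 1.
  by apply: Rnot_le_lt => h2; apply: h; rewrite !sigma0_ge1; lra.
rewrite /node; apply: Rabs_def1; nra.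
Qed.

Lemma bweightE N (m : {ffun 'I_k -> 'I_N.+1}) x :
  bweight m x = \big[Rmult/1]_i weight (m i) i x.
Proof. exact: C2prodE. Qed.

Lemma bweight_ge0 N (m : {ffun 'I_k -> 'I_N.+1}) x : 0 <= bweight m x.
Proof.
rewrite bweightE; apply: (big_ind (Rle 0)) => [|a b|i _]; [lra | exact: Rmult_le_pos |].
exact: weight_ge0.
Qed.

Lemma bweight_sum N x : vnorm x <= M - mesh M N -> \rsum_m @bweight N m x = 1.
Proof.
move=> hx; transitivity (\big[Rplus/0]_(m : {ffun 'I_k -> 'I_N.+1}) \big[Rmult/1]_i weight (m i) i x).
  by apply: eq_bigr => m _; exact: bweightE.
rewrite -(bigA_distr_bigA (fun (i : 'I_k) (m : 'I_N.+1) => weight m i x)).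
by apply: big1 => i _; exact: weight_sum.
Qed.

Lemma bweight_support N (m : {ffun 'I_k -> 'I_N.+1}) x : bweight m x <> 0 ->
  vnorm (vsub (grid M m) x) < 2 * mesh M N.
Proof.
move=> h; have d0 := mesh_pos M0 N; apply: vnorm_lt => [|i]; first lra.
apply: (@weight_support _ (m i)) => hi; apply: h.
by rewrite bweightE (bigD1 i) // hi; apply: Rmult_0_l.
Qed.

Lemma unif_cont_closure (f : Vec k -> Vec k) (U : Vec k -> Prop) e :
  (forall x, closure U x -> vnorm x <= M) -> cont_on_closure f U -> 0 < e ->
  exists c, 0 < c /\ forall x y, closure U x -> closure U y -> vnorm (vsub y x) < c ->
    vnorm (vsub (f y) (f x)) < e.
Proof.
move=> UM fc e0.
have [|p hp|c [c0 hc]] := @compact_box k M (fun c x => closure U x -> forall y, closure U y ->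
   vnorm (vsub y x) < c -> vnorm (vsub (f y) (f x)) < e).
- by move=> c c' x c0 cc h Ux y Uy hy; apply: h => //; lra.
- have [cp|cp] := classic (closure U p).
    have e2 : 0 < e / 2 by lra.
    have [d [d0 hd]] := fc p cp _ e2.
    exists (d / 2); split; first lra; move=> x hx hxp Ux y Uy hy.
    have := hd x Ux ltac:(lra).
    have := hd y Uy ltac:(have := vnorm_sub_tri y x p; lra).
    by have := vnorm_sub_tri (f y) (f p) (f x); rewrite (vnorm_sub_sym (f p)); lra.
  have [r [r0 hr]] := not_closure cp; exists r; split => // x hx hxp Ux.
  by case: (hr x hxp).
- by exists c; split => // x y Ux Uy hxy; apply: hc => //; apply: UM.
Qed.

(** The approximation averages, with the weights [bweight], values of [f] at points of the closure
    within four meshes of [x], where [f] varies by less than [e]. *)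
Lemma smooth_approx (f : Vec k -> Vec k) (U : Vec k -> Prop) e :
  (forall x, closure U x -> vnorm x < M - 1) -> cont_on_closure f U -> 0 < e ->
  exists h : C2map k, forall x, closure U x -> vnorm (vsub (mapv h x) (f x)) <= e.
Proof.
move=> UM fc e0.
have UM' x : closure U x -> vnorm x <= M by move=> /UM; lra.
have [c [c0 hc]] := unif_cont_closure UM' fc e0.
have q0 : 0 < Rmin 1 (c / 4) by apply: Rmin_glb_lt; lra.
have [N0 hN] := mesh_small M q0; have {hN} := hN N0 (leqnn _); set N := N0 => hN.
have d0 := mesh_pos M0 N.
have hN1 := le_minl hN; have hN2 := le_minr hN.
pose near m q := closure U q /\ vnorm (vsub (@grid k M N m) q) < 2 * mesh M N.
(* A node may lie outside the closure of [U], so [f] is sampled at a nearby point of the closure. If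
   there is none, the default [vzero] is harmless: the weight then vanishes on the closure. *)
pose q m := epsilon (inhabits (@vzero k)) (near m).
pose h : C2map k := fun i =>
  C2sum (index_enum _) (fun m => C2scale (f (q m) i) (@bweight N m)).
exists h => x Ux; apply: vnorm_lub => [|i]; first lra.
have hx : vnorm x <= M - mesh M N by have := UM x Ux; lra.
rewrite /vsub /mapv /h C2sumE.
have -> : f x i = \rsum_m (f x i * @bweight N m x).
  by rewrite -rsum_scal bweight_sum // Rmult_1_r.
rewrite rsum_sub; apply: Rle_trans (rsum_abs _ _) _.
have -> : e = \rsum_m (e * @bweight N m x) by rewrite -rsum_scal bweight_sum // Rmult_1_r.
apply: rsum_le => m _.
have -> : C2scale (f (q m) i) (bweight m) x = f (q m) i * bweight m x by [].
rewrite -Rmult_minus_distr_r Rabs_mult (Rabs_pos_eq (bweight m x)); last exact: bweight_ge0.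
have [z|nz] := Req_dec (bweight m x) 0; first by rewrite z; lra.
apply: Rmult_le_compat_r; first exact: bweight_ge0.
have hm := bweight_support nz.
have [cq hq] : near m (q m) by apply: epsilon_spec; exists x.
apply: Rle_trans (vnorm_coord (vsub (f (q m)) (f x)) i) _.
apply/Rlt_le/hc => //.
have := vnorm_sub_tri (q m) (grid M m) x; rewrite (vnorm_sub_sym (q m) (grid M m)); lra.
Qed.

End Smoothing.

(** * Regular values *)

(** A left null vector [w] of the Jacobian at [x0] kills the first-order term of [w . (G x - G x0)],
    so a small cell around [x0] is mapped into a thin slab. Dividing by an entry of largest modulus
    gives [w i = 1] and entries at most 1 in modulus, whence the constant [INR k * B]. *)
Lemma critical_slab (k : nat) (G : C2map k) M : exists K B, 0 <= K /\ 0 <= B /\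
  forall x0, vnorm x0 <= M -> mdet (jac G x0) = 0 -> exists (w : Vec k) (i : 'I_k), w i = 1 /\
    forall x, vnorm x <= M ->
      vnorm (vsub (mapv G x) (mapv G x0)) <= K * vnorm (vsub x x0) /\
      Rabs (\rsum_j (w j * (mapv G x j - mapv G x0 j)))
        <= B * vnorm (vsub x x0) * vnorm (vsub x x0).
Proof.
have [K [K0 hK]] := C2map_lip G M; have [B [B0 hB]] := C2map_taylor G M.
have k0 := pos_INR k.
exists K, (INR k * B); split => //; split; first exact: Rmult_le_pos.
move=> x0 hx0 hdet.
have /det0P [v /eqP v0 hv] : (\det (mx (jac G x0)) == 0)%ring by rewrite -mdetE hdet.
pose u : Vec k := fun j => v 0%ring j.
have u0 : 0 < vnorm u.
  apply: vnorm_pos => e; apply: v0; apply/rowP => j; rewrite mxE.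
  exact: (f_equal (fun w => w j) e).
have [i hi] : exists i, vnorm u <= Rabs (u i).
  apply: NNPP => h; have : vnorm u < vnorm u; last lra.
  by apply: vnorm_lt => // i; apply: Rnot_le_lt => hi; apply: h; exists i.
have ui : u i <> 0 by move=> e; rewrite e Rabs_R0 in hi; lra.
exists (vscale (/ u i) u), i; split; first by rewrite /vscale; field.
move=> x hx; split; first by have [] := hK x x0 hx hx0.
have w1 j : Rabs (vscale (/ u i) u j) <= 1.
  rewrite /vscale Rabs_mult Rabs_inv; have ap := Rabs_pos_lt _ ui.
  have := vnorm_coord u j => huj.
  apply: (Rmult_le_reg_l (Rabs (u i))) => //.
  rewrite -Rmult_assoc Rinv_r ?Rmult_1_l ?Rmult_1_r; lra.
have ker : \rsum_a (vscale (/ u i) u a * mapp (jac G x0) (vsub x x0) a) = 0.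
  have h j : \rsum_a (u a * jac G x0 a j) = 0.
    have := f_equal (fun w : 'rV[R]_k => w 0%ring j) hv; rewrite !mxE => e.
    by apply: etrans e; apply: eq_bigr => a _; rewrite mxE.
  transitivity (\rsum_a \rsum_j (/ u i * vsub x x0 j * (u a * jac G x0 a j))).
    apply: eq_bigr => a _; rewrite /mapp rsum_scal; apply: eq_bigr => j _.
    by rewrite /vscale; ring.
  rewrite exchange_big /=; apply: big1 => j _.
  by rewrite -rsum_scal h Rmult_0_r.
have ex : vadd x0 (vsub x x0) = x by vec_ring.
have hT := hB x0 (vsub x x0) hx0; rewrite ex in hT; have {}hT := hT hx.
set E := vsub (vsub _ _) _ in hT.
have -> : \rsum_j (vscale (/ u i) u j * (mapv G x j - mapv G x0 j))
    = \rsum_j (vscale (/ u i) u j * E j).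
  rewrite -[LHS]Rminus_0_r -{2}ker rsum_sub; apply: eq_bigr => j _.
  by rewrite /E /vsub; ring.
apply: Rle_trans (rsum_abs _ _) _; rewrite !Rmult_assoc; apply: rsum_le_ord => j.
rewrite Rabs_mult -Rmult_assoc.
have := vnorm_coord E j; have := w1 j; have := Rabs_pos (E j).
have := Rabs_pos (vscale (/ u i) u j); nra.
Qed.

Lemma eq_of_modn_close (n a b : nat) :
  (a <= b + n)%N -> (b <= a + n)%N -> a = b %[mod n.+1] -> a = b.
Proof.
wlog ab : a b / (a <= b)%N.
  move=> h h1 h2 e; have [ab|ba] := leqP a b; first exact: h.
  by apply/esym; apply: h => //; apply: ltnW.
move=> _ hb /eqP; rewrite eq_sym eqn_mod_dvd // => /dvdnP [q hq].
have : q = 0%N by nia.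
lia.
Qed.

(** A member of [S] is determined by residues mod [b2.+1] off [i] and mod [b1.+1] at [i]:
    coordinates off [i] spread by at most [b2], so equal residues make them equal, and then the
    bound [b1] applies at [i]. *)
Lemma card_slab (k Q b1 b2 : nat) (S : {set {ffun 'I_k.+1 -> 'I_Q}}) (i : 'I_k.+1) :
  (forall f g : {ffun 'I_k.+1 -> 'I_Q}, f \in S -> g \in S -> forall j, (f j <= g j + b2)%N) ->
  (forall f g : {ffun 'I_k.+1 -> 'I_Q}, f \in S -> g \in S -> (forall j, j != i -> f j = g j) ->
     (f i <= g i + b1)%N) ->
  (#|S| <= expn b2.+1 k * b1.+1)%N.
Proof.
move=> h2 h1.
pose code (f : {ffun 'I_k.+1 -> 'I_Q}) : {ffun 'I_k -> 'I_b2.+1} * 'I_b1.+1 :=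
  ([ffun j => inord (f (lift i j) %% b2.+1)], inord (f i %% b1.+1)).
have ci : {in S &, injective code}.
  move=> f g fS gS [/ffunP e1 /(f_equal val)].
  rewrite /= !inordK ?ltn_pmod // => e2.
  have off j : j != i -> f j = g j.
    move=> ji; case: (unliftP i j) ji => [l ->|->]; last by rewrite eqxx.
    move=> _; have := e1 l; rewrite !ffunE => /(f_equal val).
    rewrite /= !inordK ?ltn_pmod // => e; apply: val_inj => /=.
    by apply: eq_of_modn_close e; apply: h2.
  apply/ffunP => j; have [->|/off //] := eqVneq j i.
  apply: val_inj => /=; apply: eq_of_modn_close e2; apply: h1 => // l li.
  by rewrite off.
rewrite -(card_in_imset ci); apply: leq_trans (max_card _) _.
by rewrite card_prod card_ffun !card_ord.
Qed.

Lemma card_bigcup_le (I T : finType) (B : I -> {set T}) b :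
  (forall i, (#|B i| <= b)%N) -> (#|\bigcup_i B i| <= #|I| * b)%N.
Proof.
move=> h; apply: (@leq_trans (\sum_(i : I) b)%N); last by rewrite sum_nat_const.
apply: (big_ind2 (fun (A : {set T}) n => (#|A| <= n)%N)) => [|A n A' n' hA hA'|i _].
- by rewrite cards0.
- by apply: leq_trans (leq_card_setU _ _) _; apply: leq_add.
- exact: h.
Qed.

Lemma nat_above (x : R) : exists n : nat, x <= INR n.
Proof. by have [n hn] := INR_unbounded x; exists n; lra. Qed.

(* Critical values are avoided by counting lattice points: the critical points in a cell of
   side s have values in a slab of width O(s^2), which meets O(s^(1-k)) points of the lattice
   of step s^2, out of about s^(-2k) such points near 0. *)
Lemma sard (k : nat) (G : C2map k) M e : 1 < M -> 0 < e ->
  exists c : Vec k, vnorm c < e /\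
    forall x, vnorm x <= M - 1 -> mapv G x = c -> mdet (jac G x) <> 0.
Proof.
move=> M1 e0; have M0 : 0 < M by lra.
case: k G => [|k] G.
  exists vzero; split; first by rewrite vnorm_zero.
  by move=> x _ _; rewrite mdetE det_mx00; apply: R1_neq_R0.
have [K [B [K0 [B0 hKB]]]] := critical_slab G M.
(* In units of the lattice step [a], [b1] bounds the slab width, two values being each within
   [16 * B * a] of a third, and [B2 * N.+1] bounds the diameter [8 * K * s] of the image of a
   cell. *)
have [b1 hb1] := nat_above (32 * B); have [B2 hB2] := nat_above (4 * K / M).
have [D hD] : exists D, 4 * (M * M) / e < INR D.+1.
  have [D hD] := INR_unbounded (4 * (M * M) / e); exists D; rewrite S_INR; lra.
have [P0 hP0] := nat_above (2 * M).
(* The bad lattice points number at most a constant times [P^(2k+1)], the lattice has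
   [(D.+1 P^2)^(k+1)] points, and [P] is chosen to beat the constant. [P0] gives [s <= 1], and [D]
   keeps the lattice within [e] of 0. *)
pose C := (expn B2.+1 k * b1.+1)%N.
pose P := (P0 + expn D.+1 k * C).+1.
pose N := (D.+1 * P).-1; pose Q := (D.+1 * (P * P)).-1.
have eN : N.+1 = (D.+1 * P)%N by rewrite /N prednK.
have eQ : Q.+1 = (D.+1 * (P * P))%N by rewrite /Q prednK.
pose s := mesh M N; have s0 : 0 < s := mesh_pos M0 N.
have P1 : 0 < INR P by apply: lt_0_INR; apply/ltP.
have D1 : 0 < INR D.+1 by apply: lt_0_INR; apply/ltP.
have es : s * (INR D.+1 * INR P) = 2 * M.
  by rewrite /s /mesh eN mult_INR; field; split; lra.
have s1 : s <= 1.
  have : 2 * M <= INR P.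
    by apply: Rle_trans hP0 _; apply: le_INR; apply/leP; rewrite /P; lia.
  have d1 : 1 <= INR D.+1 by rewrite S_INR; have := pos_INR D; lra.
  move=> mp; apply: (Rmult_le_reg_r (INR P)) => //.
  have := Rmult_le_compat_l (s * INR P) _ _ ltac:(apply: Rmult_le_pos; lra) d1; lra.
pose a := s * s; have a0 : 0 < a by apply: Rmult_lt_0_compat.
pose lat (f : {ffun 'I_k.+1 -> 'I_Q.+1}) : Vec k.+1 := fun i => a * INR (f i).
have lat_small f : vnorm (lat f) < e.
  have : vnorm (lat f) <= a * INR Q.
    apply: vnorm_lub => [|i]; first by apply: Rmult_le_pos; [lra | apply: pos_INR].
    rewrite Rabs_pos_eq; last by apply: Rmult_le_pos; [lra | apply: pos_INR].
    by apply: Rmult_le_compat_l; [lra | apply: le_INR; apply/leP; rewrite -ltnS].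
  have : a * INR Q.+1 * INR D.+1 = 4 * (M * M).
    rewrite eQ !mult_INR /a.
    have -> : s * s * (INR D.+1 * (INR P * INR P)) * INR D.+1
      = (s * (INR D.+1 * INR P)) * (s * (INR D.+1 * INR P)) by ring.
    by rewrite es; ring.
  have : INR Q.+1 = INR Q + 1 by rewrite S_INR.
  have hD' : 4 * (M * M) < e * INR D.+1.
    have -> : 4 * (M * M) = e * (4 * (M * M) / e) by field; lra.
    exact: Rmult_lt_compat_l.
  move=> h1 h2 h3; apply: Rle_lt_trans h3 _; apply: Rnot_le_lt => h4.
  have : e * INR D.+1 <= a * INR Q * INR D.+1 by apply: Rmult_le_compat_r; lra.
  rewrite h1 in h2; have := Rmult_lt_0_compat _ _ a0 D1; lra.
pose bad m f := exists x, vnorm x <= M - 1 /\ vnorm (vsub (@grid k.+1 M N m) x) < 2 * s /\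
   mapv G x = lat f /\ mdet (jac G x) = 0.
pose Bad m : {set {ffun 'I_k.+1 -> 'I_Q.+1}} := [set f | boolp.asbool (bad m f)].
have BadP m f : f \in Bad m -> bad m f by rewrite inE => /boolp.asboolP.
have cB m : (#|Bad m| <= expn (B2 * N.+1).+1 k * b1.+1)%N.
  have [->|/set0Pn [f0 /BadP [x0 [hx0 [hg0 [hG0 hd0]]]]]] := eqVneq (Bad m) set0.
    by rewrite cards0.
  have [|w [i [wi hw]]] := hKB x0 _ hd0; first lra.
  have near x : vnorm (vsub (grid M m) x) < 2 * s -> vnorm (vsub x x0) <= 4 * s.
    move=> h; have := vnorm_sub_tri x (grid M m) x0.
    by rewrite (vnorm_sub_sym x (grid M m)); lra.
  have key f : f \in Bad m -> vnorm (vsub (lat f) (lat f0)) <= K * (4 * s) /\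
      Rabs (\rsum_j (w j * (lat f j - lat f0 j))) <= 16 * B * a.
    move=> /BadP [x [hx [hg [hG _]]]]; have [|h1 h2] := hw x; first lra.
    rewrite -hG -hG0; have n0 := vnorm_ge0 (vsub x x0); have n4 := near x hg.
    split; first by apply: Rle_trans h1 _; apply: Rmult_le_compat_l.
    apply: Rle_trans h2 _; rewrite /a.
    have h3 : vnorm (vsub x x0) * vnorm (vsub x x0) <= (4 * s) * (4 * s).
      exact: Rmult_le_compat.
    have := Rmult_le_compat_l _ _ _ B0 h3; lra.
  apply: (card_slab (i := i)) => f g /key [f1 f2] /key [g1 g2] => [j|agree].
    apply/leP/INR_le; rewrite plus_INR mult_INR.
    have h : a * INR (f j) - a * INR (g j) <= 8 * K * s.
      have := vnorm_coord (vsub (lat f) (lat g)) j.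
      have := vnorm_sub_tri (lat f) (lat f0) (lat g); rewrite (vnorm_sub_sym (lat f0)).
      have := Rle_abs (vsub (lat f) (lat g) j); rewrite {1}/vsub {1 2}/lat; lra.
    have hB : 8 * K <= s * (INR B2 * INR N.+1).
      have -> : s * (INR B2 * INR N.+1) = 2 * M * INR B2.
        by rewrite /s /mesh; field; apply: not_0_INR.
      have -> : 8 * K = 2 * M * (4 * K / M) by field; lra.
      by apply: Rmult_le_compat_l; lra.
    apply: (Rmult_le_reg_l a) => //.
    have := Rmult_le_compat_r _ _ _ (Rlt_le _ _ s0) hB.
    by rewrite Rmult_plus_distr_l /a in h *; lra.
  apply/leP/INR_le; rewrite plus_INR.
  have e1 : \rsum_j (w j * (lat f j - lat g j)) = lat f i - lat g i.
    rewrite (bigD1 i) //= wi big1 => [|j ji]; first by ring.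
    by rewrite /lat (agree j ji); ring.
  have e2 : \rsum_j (w j * (lat f j - lat g j))
     = \rsum_j (w j * (lat f j - lat f0 j)) - \rsum_j (w j * (lat g j - lat f0 j)).
    by rewrite rsum_sub; apply: eq_bigr => j _; ring.
  have : lat f i - lat g i <= 32 * B * a.
    move: f2 g2 => /Rabs_le_between f2 /Rabs_le_between g2.
    by rewrite -e1 e2; lra.
  rewrite /lat => h; apply: (Rmult_le_reg_l a) => //.
  by have := Rmult_le_compat_l _ _ _ (Rlt_le _ _ a0) hb1; lra.
have [f hf] : exists f, f \notin \bigcup_m Bad m.
  apply: NNPP => h.
  have full : (#|{ffun 'I_k.+1 -> 'I_Q.+1}| <= #|\bigcup_m Bad m|)%N.
    rewrite -cardsT; apply: subset_leq_card; apply/subsetP => f _.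
    by apply/negPn/negP => hf; apply: h; exists f.
  have := leq_trans full (card_bigcup_le cB); rewrite !card_ffun !card_ord eQ.
  apply/negP; rewrite -ltnNge.
  apply: (@leq_ltn_trans (expn N.+1 k.+1 * (expn (B2.+1 * N.+1) k * b1.+1))%N).
    have mono x y n : (x <= y)%N -> (expn x n <= expn y n)%N.
      by move=> xy; elim: n => // n IH; rewrite !expnS; apply: leq_mul.
    by rewrite leq_mul2l leq_mul2r mono ?orbT //; lia.
  rewrite eN !expnMn !expnS.
  set dk := expn D.+1 k; set pk := expn P k; set bk := expn B2.+1 k.
  have dk0 : (0 < dk)%N by rewrite expn_gt0.
  have pk0 : (0 < pk)%N by rewrite expn_gt0.
  have -> : (D.+1 * dk * (P * pk) * (bk * (dk * pk) * b1.+1)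
    = (D.+1 * dk * P * pk * pk) * (dk * (bk * b1.+1)))%N by nia.
  have -> : (D.+1 * dk * (P * pk * (P * pk)) = (D.+1 * dk * P * pk * pk) * P)%N by nia.
  rewrite ltn_pmul2l; first by rewrite /P /C -/dk -/bk; lia.
  by rewrite !muln_gt0 dk0 pk0.
exists (lat f); split; first exact: lat_small.
move=> x hx hG hd; move/negP: hf; apply.
have hxm : vnorm x <= M - s by lra.
(* The weights sum to 1 at [x], so one of them is nonzero and its node is near [x]. *)
have [m hm] : exists m, @bweight k.+1 M N m x <> 0.
  apply: NNPP => h; have := bweight_sum M0 (N := N) hxm.
  rewrite big1; first by lra.
  by move=> m _; apply: NNPP => hm; apply: h; exists m.
apply/bigcupP; exists m => //; rewrite inE; apply/boolp.asboolP; exists x; split => //.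
by split; first exact: (bweight_support M0).
Qed.

(** * The degree of a continuous map *)

Lemma list_uniform (X : Type) (P : X -> R -> Prop) (l : list X) :
  (forall x r r', 0 < r' -> r' <= r -> P x r -> P x r') ->
  (forall x, List.In x l -> exists r, 0 < r /\ P x r) ->
  exists r, 0 < r /\ forall x, List.In x l -> P x r.
Proof.
move=> mono; elim: l => [|a l IH] h; first by exists 1; split; [lra | move=> x []].
have [r1 [r10 h1]] := h a (or_introl erefl).
have [r2 [r20 h2]] := IH (fun x hx => h x (or_intror hx)).
have r0 : 0 < Rmin r1 r2 by apply: Rmin_glb_lt.
exists (Rmin r1 r2); split => // x [<-|hx]; first exact: mono (Rmin_l _ _) h1.
by apply: mono (Rmin_r _ _) (h2 x hx).
Qed.

(** One radius serves all zeros: the balls are disjoint, lie in [U] and each carries the sign of its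
    zero. Additivity gives the union; excision passes to [U], since [G] is bounded away from 0 on
    the rest of the closure. *)
Lemma deg_is_sum_zeros (k : nat) (M : R) (U : Vec k -> Prop) (G : C2map k) (l : list (Vec k)) :
  0 < M -> is_open U -> (forall x, closure U x -> vnorm x < M) ->
  (forall x, boundary U x -> mapv G x <> vzero) ->
  (forall x, U x -> mapv G x = vzero -> mdet (jac G x) <> 0) ->
  List.NoDup l -> (forall x, List.In x l <-> (U x /\ mapv G x = vzero)) ->
  deg_is M U G
    (IZR (List.fold_right (fun x acc => (sgnZ (mdet (jac G x)) + acc)%Z) 0%Z l)).
Proof.
move=> M0 oU UM nzb reg nd hl.
pose sg x := sgnZ (mdet (jac G x)).
have [rho [rho0 hrho]] : exists rho, 0 < rho /\ forall x, List.In x l ->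
   (deg_is M (ball x rho) G (IZR (sg x)) /\ (forall y, ball x rho y -> U y)) /\
   forall y, List.In y l -> y <> x -> 2 * rho <= vnorm (vsub y x).
  have [x r r' r'0 rr [h1 h2]|x hx|r [r0 hr]] := @list_uniform _ (fun x r =>
      (forall r', 0 < r' <= r ->
        deg_is M (ball x r') G (IZR (sg x)) /\ (forall y, ball x r' y -> U y)) /\
      forall y, List.In y l -> y <> x -> 2 * r <= vnorm (vsub y x)) l.
  - split; first by move=> r'' hr''; apply: h1; lra.
    by move=> y hy yx; have := h2 y hy yx; lra.
  - have [Ux Gx] := proj1 (hl x) hx.
    have xM : vnorm x < M by apply: UM; apply: subset_closure.
    have [r1 [r10 h1]] := deg_ball_regular_zero M0 Gx (reg x Ux Gx).
    have [r2 [r20 h2]] := oU x Ux.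
    have [y r r' _ rr h yx|y hy|r3 [r30 h3]] :=
      @list_uniform _ (fun y r => y <> x -> 2 * r <= vnorm (vsub y x)) l.
    + by have := h yx; lra.
    + have [->|yx] := classic (y = x); first by exists 1; split; [lra | case].
      have n0 : 0 < vnorm (vsub y x) by apply: vnorm_pos => /vsub_eq0.
      by exists (vnorm (vsub y x) / 2); split => [|_]; lra.
    pose r := Rmin (Rmin r1 r2) (Rmin r3 (M - vnorm x)).
    have r0 : 0 < r by rewrite /r; do !apply: Rmin_glb_lt; lra.
    have [a b] : r <= Rmin r1 r2 /\ r <= Rmin r3 (M - vnorm x).
      by split; [apply: Rmin_l | apply: Rmin_r].
    have a1 := le_minl a; have a2 := le_minr a.
    have b1 := le_minl b; have b2 := le_minr b.
    exists r; split => //; split.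
      move=> r' hr'; split; last by move=> y hy; apply: h2; rewrite /ball in hy; lra.
      by have [] := h1 r' ltac:(lra) ltac:(lra).
    by move=> y hy yx; have := h3 y hy yx; lra.
  exists r; split => // x hx; have [h1 h2] := hr x hx; split; last by [].
  by apply: h1; lra.
have sub : deg_is M (fun y => exists x, List.In x l /\ ball x rho y) G
    (IZR (List.fold_right (fun x acc => (sg x + acc)%Z) 0%Z l)).
  have : forall l', (forall x, List.In x l' -> List.In x l) -> List.NoDup l' ->
      deg_is M (fun y => exists x, List.In x l' /\ ball x rho y) G
        (IZR (List.fold_right (fun x acc => (sg x + acc)%Z) 0%Z l')).
    elim=> [|a l' IH] inc nd'.
      have -> : (fun y => exists x, List.In x [::] /\ ball x rho y) = (fun _ : Vec k => False).
        apply: functional_extensionality => y.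
        by apply: boolp.propext; split => // -[x [[]]].
      exact: deg_is_empty.
    have [na nd''] : ~ List.In a l' /\ List.NoDup l' by inversion nd'.
    have hIH := IH (fun x hx => inc x (or_intror hx)) nd''.
    have [[da _] sep] := hrho a (inc a (or_introl erefl)).
    rewrite /= plus_IZR.
    have -> : (fun y => exists x, (a = x \/ List.In x l') /\ ball x rho y)
       = (fun y => ball a rho y \/ exists x, List.In x l' /\ ball x rho y).
      apply: functional_extensionality => y; apply: boolp.propext; split.
        by move=> [x [[<-|hx] hy]]; [left | right; exists x].
      by move=> [hy|[x [hx hy]]]; [exists a; split => //; left | exists x; split => //; right].
    apply: deg_is_union => // y hy [x [hx hyx]].
    have xa : x <> a by move=> xa; apply: na; rewrite -xa.
    have := sep x (inc x (or_intror hx)) xa; rewrite /ball in hy hyx.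
    by have := vnorm_sub_tri x y a; rewrite (vnorm_sub_sym x y); lra.
  by apply.
have [x [/UM h _]|x nS|x [cx hx]|x e _ e0|c [c0 hc]] := @pos_lower k M
  (fun x => closure U x /\ forall z, List.In z l -> rho <= vnorm (vsub x z))
  (fun x => vnorm (mapv G x)).
- by lra.
- have [cx|cx] := classic (closure U x); last first.
    by have [r [r0 hr]] := not_closure cx; exists r; split => // y hy [cy _]; apply: hr hy cy.
  have [z hz] : exists z, ~ (List.In z l -> rho <= vnorm (vsub x z)).
    by apply: not_all_ex_not => h; apply: nS.
  have {hz} [zl hz] := imply_to_and _ _ hz.
  exists (rho - vnorm (vsub x z)); split; first lra.
  by move=> y hy [_ /(_ z zl)]; have := vnorm_sub_tri y x z; lra.
- apply: vnorm_pos => Gx.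
  have [Ux|nUx] := classic (U x); last by case: (nzb x (conj cx nUx)).
  have := hx x (proj2 (hl x) (conj Ux Gx)); rewrite vsubxx vnorm_zero; lra.
- have [r [r0 hr]] := mapv_cont G x e0; exists r; split => // y _ hy.
  exact: Rle_lt_trans (norm_cont _ _ _) (hr y hy).
apply/(@deg_is_excise k M _ _ _ c _ c0); last exact: sub.
- by move=> y [x [hx hy]]; have [[_ h] _] := hrho x hx; apply: h.
- move=> x Ux nx; apply: hc; split; first exact: subset_closure.
  by move=> z zl; apply: Rnot_lt_le => h; apply: nx; exists z.
Qed.

(** A Rouche argument by contradiction. If [H] had no zero in [U], a smooth approximation [H1] would
    have degree 0; a regular smooth approximation [G] of [F] has degree [d] by [has_degree]; and the
    linear homotopy between them has no zero on the boundary. *)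
Theorem degree_zero (k : nat) (F H : Vec k -> Vec k) (U : Vec k -> Prop) (d : Z) :
  is_open U -> is_bounded U -> has_degree F U d -> d <> 0%Z -> cont_on_closure H U ->
  (forall x, boundary U x -> vnorm (vsub (H x) (F x)) < vnorm (F x)) ->
  exists x, U x /\ H x = vzero.
Proof.
move=> oU [M1 UM1] [Fc [Fb [delta [delta0 hdeg]]]] d0 Hc HF; apply: NNPP => noz.
pose M := Rmax 0 M1 + 2.
have M2 : 2 <= M by have := Rmax_l 0 M1; rewrite /M; lra.
have UM x : closure U x -> vnorm x < M - 1.
  have := Rmax_r 0 M1; rewrite /M => h cx; have := closure_bound UM1 cx; lra.
have Hnz x : closure U x -> 0 < vnorm (H x).
  move=> cx; apply: vnorm_pos => Hx; have [Ux|nUx] := classic (U x).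
    by apply: noz; exists x.
  have := HF x (conj cx nUx); rewrite Hx vnorm_sub_sym vsubx0; lra.
have [x [/UM h _]|x|x /HF h|x e [cx _] e0|c1 [c10 hc1]] := @pos_lower k M (boundary U)
  (fun x => vnorm (F x) - vnorm (vsub (H x) (F x))).
- by lra.
- exact: not_boundary.
- by lra.
- have e3 : 0 < e / 3 by lra.
  have [r1 [r10 h1]] := Fc x cx _ e3; have [r2 [r20 h2]] := Hc x cx _ e3.
  exists (Rmin r1 r2); split; first exact: Rmin_glb_lt.
  move=> y [cy _] hy; have := h1 y cy (lt_minl hy).
  have := h2 y cy (lt_minr hy).
  have := norm_cont F x y; have := norm_cont (fun z => vsub (H z) (F z)) x y.
  have := vnorm_sub_le (vsub (H y) (H x)) (vsub (F y) (F x)).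
  have -> : vsub (vsub (H y) (H x)) (vsub (F y) (F x))
    = vsub (vsub (H y) (F y)) (vsub (H x) (F x)).
    by vec_ring.
  move=> i1 /Rabs_le_between i2 /Rabs_le_between i3 i4 i5; apply: Rabs_def1; lra.
have [x /UM h|x|x|x e cx e0|c2 [c20 hc2]] :=
  @pos_lower k M (closure U) (fun x => vnorm (H x)).
- by lra.
- exact: not_closure.
- exact: Hnz.
- have [r [r0 hr]] := Hc x cx e e0; exists r; split => // y cy hy.
  exact: Rle_lt_trans (norm_cont _ _ _) (hr y cy hy).
(* [c1] keeps the homotopy off 0 on the boundary, [c2] keeps [H1] off 0 on the closure, and [delta]
   makes [G], within [2 * e] of [F], admissible for [has_degree]. *)
pose e := Rmin (Rmin (c1 / 8) (c2 / 8)) (delta / 4).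
have e0 : 0 < e by rewrite /e; do !apply: Rmin_glb_lt; lra.
have [ea ed] : e <= Rmin (c1 / 8) (c2 / 8) /\ e <= delta / 4.
  by split; [apply: Rmin_l | apply: Rmin_r].
have ec1 := le_minl ea; have ec2 := le_minr ea.
have M0 : 0 < M by lra.
have [F1 hF1] := smooth_approx M0 UM Fc e0; have [H1 hH1] := smooth_approx M0 UM Hc e0.
have [c [ce hc]] := @sard k F1 M e ltac:(lra) e0.
pose G : C2map k := fun i => C2add (F1 i) (C2const k (- c i)).
have Gv x : mapv G x = vsub (mapv F1 x) c by [].
have Gj x : jac G x = jac F1 x.
  apply: mat_eq => i j.
  by rewrite /jac /=; ring.
have GF x : closure U x -> vnorm (vsub (mapv G x) (F x)) <= 2 * e.
  move=> cx; have := hF1 x cx; rewrite Gv.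
  have -> : vsub (vsub (mapv F1 x) c) (F x) = vsub (vsub (mapv F1 x) (F x)) c.
    by vec_ring.
  by have := vnorm_sub_le (vsub (mapv F1 x) (F x)) c; lra.
have reg x : U x -> mapv G x = vzero -> mdet (jac G x) <> 0.
  move=> Ux Gx; rewrite Gj; apply: hc; last by apply: vsub_eq0; rewrite -Gv.
  by have := UM x (subset_closure Ux); lra.
have nzt t x : 0 <= t <= 1 -> boundary U x -> mapv (hom G H1 t) x <> vzero.
  move=> ht bx hz; have cx := proj1 bx.
  have g1 := GF x cx; have g2 := hH1 x cx; have g3 := hc1 x bx.
  have : vnorm (F x) <= t * vnorm (vsub (H x) (F x)) + (1 - t) * vnorm (vsub (mapv G x) (F x))
      + t * vnorm (vsub (mapv H1 x) (H x)).
    have n1 := vnorm_scale t (vsub (H x) (F x)); rewrite Rabs_pos_eq in n1; last lra.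
    have n2 := vnorm_scale (1 - t) (vsub (mapv G x) (F x)); rewrite Rabs_pos_eq in n2; last lra.
    have n3 := vnorm_scale t (vsub (mapv H1 x) (H x)); rewrite Rabs_pos_eq in n3; last lra.
    rewrite -n1 -n2 -n3 {n1 n2 n3}.
    have {1}-> : F x = vscale (-1) (vadd (vadd (vscale t (vsub (H x) (F x)))
        (vscale (1 - t) (vsub (mapv G x) (F x)))) (vscale t (vsub (mapv H1 x) (H x)))).
      apply: vec_eq => i; have := f_equal (fun w => w i) hz.
      rewrite /mapv homE /vscale /vadd /vsub /vzero; lra.
    rewrite vnorm_scale Rabs_Ropp Rabs_R1 Rmult_1_l.
    apply: Rle_trans (vnorm_add _ _) _; apply: Rplus_le_compat_r; exact: vnorm_add.
  have := vnorm_ge0 (vsub (H x) (F x)); have := vnorm_ge0 (vsub (mapv G x) (F x)).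
  have := vnorm_ge0 (vsub (mapv H1 x) (H x)); nra.
have [l [nd [hl dl]]] := hdeg (mapv G) (jac G) (C2map_frechet G) (C2map_C1 G)
   (fun x cx => ltac:(rewrite vnorm_sub_sym; have := GF x cx; lra)) reg.
have degG : deg_is M U G (IZR d).
  rewrite dl; apply: deg_is_sum_zeros => //.
  - by move=> x /UM; lra.
  - move=> x bx; have := nzt 0 x ltac:(lra) bx.
    suff -> : mapv (hom G H1 0) x = mapv G x by [].
    by apply: vec_eq => i; rewrite /mapv homE; ring.
have UM' x : U x -> vnorm x < M by move=> /subset_closure /UM; lra.
have degH := deg_is_homotopy M0 oU UM' nzt degG.
have degH0 : deg_is M U H1 0.
  apply: deg_is_nozero => // x cx hx; have := hH1 x cx; have := hc2 x cx.
  by rewrite hx vnorm_sub_sym vsubx0; lra.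
by apply: d0; apply: eq_IZR; apply: deg_is_unique degH degH0.
Qed.

(** * Gronwall and Picard-Lindelof *)

Lemma le_of_deriv_le (f g f' g' : R -> R) a b : a <= b ->
  (forall t, a <= t <= b -> derivable_pt_lim f t (f' t)) ->
  (forall t, a <= t <= b -> derivable_pt_lim g t (g' t)) ->
  (forall t, a <= t <= b -> f' t <= g' t) -> f b - f a <= g b - g a.
Proof.
move=> ab hf hg h.
have [|t ht|c [hc e]] := @MVT_gen (fun t => g t - f t) a b (fun t => g' t - f' t).
- move=> t; rewrite Rmin_left ?Rmax_right // => ht; apply/is_derive_Reals.
  by apply: derivable_pt_lim_minus; [apply: hg | apply: hf]; lra.
- move: ht; rewrite Rmin_left ?Rmax_right // => ht; apply: derivable_continuous_pt.
  by exists (g' t - f' t); apply: derivable_pt_lim_minus; [apply: hg | apply: hf]; lra.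
move: hc; rewrite Rmin_left ?Rmax_right // => /h hc.
suff : 0 <= (g' c - f' c) * (b - a) by lra.
by apply: Rmult_le_pos; lra.
Qed.

Lemma dlim_opp_arg (f : R -> R) t l :
  derivable_pt_lim f (- t) l -> derivable_pt_lim (fun s => f (- s)) t (- l).
Proof.
move=> h; have h1 : derivable_pt_lim (fun s => - s) t (- 1).
  by apply: (derivable_pt_lim_opp id); apply: derivable_pt_lim_id.
apply: dlim_ext (derivable_pt_lim_comp _ f t _ _ h1 h) => //; ring.
Qed.

Lemma dlim_shift_arg (f : R -> R) t c l :
  derivable_pt_lim f (t + c) l -> derivable_pt_lim (fun s => f (s + c)) t l.
Proof.
move=> h e e0; have [d hd] := h e e0; exists d => s s0 hs.
have -> : t + s + c = t + c + s by ring.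
exact: hd.
Qed.

Lemma exp_mono x y : x <= y -> exp x <= exp y.
Proof. by case=> [h|->]; [apply/Rlt_le/exp_increasing | apply: Rle_refl]. Qed.

Section Gronwall.
Variable k : nat.
Implicit Types u : R -> Vec k.

Definition has_deriv u (u' : R -> Vec k) (t : R) :=
  forall i, derivable_pt_lim (fun s => u s i) t (u' t i).

(** The sup norm is not differentiable, so the squared Euclidean norm is used: its derivative is at
    most [K * energy + c], and after multiplication by [exp (- K * (t - a))] at most [c]. *)
Lemma gronwall_energy u u' a b L e : a <= b -> 0 <= L -> 0 <= e ->
  (forall t, a <= t <= b -> has_deriv u u' t) ->
  (forall t, a <= t <= b -> vnorm (u' t) <= L * vnorm (u t) + e) ->
  energy (u b) <= (energy (u a) + INR k * (e * e) * (b - a))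
                  * exp ((2 * INR k * L + INR k) * (b - a)).
Proof.
move=> ab L0 e0 hd hb; have k0 := pos_INR k.
(* From [2 |u| (L |u| + e) <= (2 L + 1) |u|^2 + e^2], once for each coordinate. *)
set K := 2 * INR k * L + INR k; set c := INR k * (e * e).
have c0 : 0 <= c by apply: Rmult_le_pos => //; nra.
have K0 : 0 <= K by rewrite /K; have := Rmult_le_pos _ _ k0 L0; lra.
pose E' t := \rsum_i (2 * (u t i * u' t i)).
have hE t : a <= t <= b -> derivable_pt_lim (fun t => energy (u t)) t (E' t).
  move=> ht; apply: dlim_sum => i.
  by apply: dlim_ext (derivable_pt_lim_mult _ _ _ _ _ (hd t ht i) (hd t ht i)) => //; ring.
have bE t : a <= t <= b -> E' t <= K * energy (u t) + c.
  move=> ht; have h := hb t ht; have n0 := vnorm_ge0 (u t).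
  apply: (Rle_trans _ (INR k * (2 * (vnorm (u t) * (L * vnorm (u t) + e))))).
    apply: rsum_le_ord => i; apply: Rmult_le_compat_l; first lra.
    apply: Rle_trans (Rle_abs _) _; rewrite Rabs_mult; apply: Rmult_le_compat;
      try exact: Rabs_pos; first exact: vnorm_coord.
    exact: Rle_trans (vnorm_coord _ _) h.
  have eg := energy_ge (u t); rewrite /K /c.
  have q : 2 * (vnorm (u t) * e) <= vnorm (u t) * vnorm (u t) + e * e.
    by have := Rle_0_sqr (vnorm (u t) - e); rewrite /Rsqr; lra.
  have kL := Rmult_le_pos _ _ k0 L0.
  have := Rmult_le_compat_l _ _ _ k0 q; have := Rmult_le_compat_l _ _ _ kL eg.
  have := Rmult_le_compat_l _ _ _ k0 eg; lra.
have dexp t : derivable_pt_lim (fun t => exp (- K * (t - a))) t (- K * exp (- K * (t - a))).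
  by apply/is_derive_Reals; auto_derive => //; rewrite Rmult_1_r.
have ex t : a <= t <= b -> 0 < exp (- K * (t - a)) <= 1.
  move=> ht; split; first exact: exp_pos.
  by rewrite -exp_0; apply: exp_mono; nra.
have h : energy (u b) * exp (- K * (b - a)) - energy (u a) * exp (- K * (a - a))
    <= c * b - c * a.
  apply: (@le_of_deriv_le (fun t => energy (u t) * exp (- K * (t - a))) (fun t => c * t)
    (fun t => E' t * exp (- K * (t - a)) + energy (u t) * (- K * exp (- K * (t - a))))
    (fun t => c)) => // t ht.
  - by apply: derivable_pt_lim_mult; [apply: hE | apply: dexp].
  - by apply/is_derive_Reals; auto_derive => //; ring.
  - have := bE t ht; have := ex t ht => h1 h2.
    have : (E' t - K * energy (u t)) * exp (- K * (t - a)) <= c * exp (- K * (t - a)).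
      by apply: Rmult_le_compat_r; lra.
    nra.
have e1 : exp (- K * (b - a)) * exp (K * (b - a)) = 1.
  by rewrite -exp_plus -exp_0; congr exp; ring.
have {}h : energy (u b) * exp (- K * (b - a)) <= energy (u a) + c * (b - a).
  by move: h; rewrite Rminus_diag Rmult_0_r exp_0; lra.
have := Rmult_le_compat_r _ _ _ (Rlt_le _ _ (exp_pos (K * (b - a)))) h.
by rewrite Rmult_assoc e1 Rmult_1_r.
Qed.

Lemma gronwall L T : 0 <= L -> 0 <= T -> exists C, 1 <= C /\
  forall u u' a b e, b - a <= T -> 0 <= e ->
  (forall t, a <= t <= b -> has_deriv u u' t) ->
  (forall t, a <= t <= b -> vnorm (u' t) <= L * vnorm (u t) + e) ->
  forall s t, a <= s <= b -> a <= t <= b -> vnorm (u t) <= C * (vnorm (u s) + e).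
Proof.
move=> L0 T0; have k0 := pos_INR k.
set K := 2 * INR k * L + INR k.
have K0 : 0 <= K by rewrite /K; have := Rmult_le_pos _ _ k0 L0; lra.
pose C0 := INR k * (1 + T) * exp (K * T).
have C00 : 0 <= C0.
  apply: Rmult_le_pos (Rlt_le _ _ (exp_pos _)); apply: Rmult_le_pos; lra.
(* The energy bounds the squared norm by [C0] times a square; since [C0 <= (1 + C0)^2], no root of
   [C0] is taken. *)
exists (1 + C0); split; first lra.
have fwd u u' a b e : a <= b -> b - a <= T -> 0 <= e ->
    (forall t, a <= t <= b -> has_deriv u u' t) ->
    (forall t, a <= t <= b -> vnorm (u' t) <= L * vnorm (u t) + e) ->
    vnorm (u b) <= (1 + C0) * (vnorm (u a) + e).
  move=> ab bT e0 hd hb; have h := gronwall_energy ab L0 e0 hd hb.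
  have n0 := vnorm_ge0 (u a); have n1 := vnorm_ge0 (u b).
  set Y := vnorm (u a) + e; have Y0 : 0 <= Y by rewrite /Y; lra.
  have h1 : energy (u a) + INR k * (e * e) * (b - a) <= INR k * (1 + T) * (Y * Y).
    have := energy_le (u a) => h1.
    have h2 : INR k * (e * e) * (b - a) <= INR k * (e * e) * T.
      by apply: Rmult_le_compat_l => //; apply: Rmult_le_pos => //; nra.
    have h3 : vnorm (u a) * vnorm (u a) <= Y * Y by rewrite /Y; nra.
    have h4 : e * e <= Y * Y by rewrite /Y; nra.
    have := Rmult_le_compat_l _ _ _ k0 h3.
    have := Rmult_le_compat_l _ _ _ (Rmult_le_pos _ _ k0 T0) h4; lra.
  have h2 : exp (K * (b - a)) <= exp (K * T).
    by apply: exp_mono; apply: Rmult_le_compat_l.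
  have h3 : energy (u b) <= C0 * (Y * Y).
    apply: Rle_trans h _; rewrite -/K /C0.
    have p := exp_pos (K * (b - a)).
    have e00 : 0 <= energy (u a) + INR k * (e * e) * (b - a).
      have : 0 <= energy (u a) by apply: rsum_ge0 => i _; nra.
      have : 0 <= INR k * (e * e) * (b - a) by apply: Rmult_le_pos; [apply: Rmult_le_pos; nra | lra].
      lra.
    have := Rmult_le_compat _ _ _ _ e00 (Rlt_le _ _ p) h1 h2; lra.
  have h4 := Rle_trans _ _ _ (energy_ge (u b)) h3.
  apply: Rnot_lt_le => hn.
  have Y2 : 0 <= Y * Y by nra.
  have : (1 + C0) * Y * ((1 + C0) * Y) < vnorm (u b) * vnorm (u b).
    by apply: Rmult_le_0_lt_compat => //; apply: Rmult_le_pos; lra.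
  nra.
move=> u u' a b e ab e0 hd hb s t hs ht.
have [st|st] := Rle_lt_dec s t.
  by apply: (fwd u u') => //; [lra | move=> r hr; apply: hd; lra | move=> r hr; apply: hb; lra].
(* Backward estimates follow by reversing time. *)
have := fwd (fun r => u (- r)) (fun r => vscale (-1) (u' (- r))) (- s) (- t) e.
rewrite !Ropp_involutive; apply => //; try lra.
- move=> r hr i; apply: dlim_ext (dlim_opp_arg (hd (- r) ltac:(lra) i)) => //.
  by rewrite /vscale; ring.
- by move=> r hr; rewrite vnorm_scale Rabs_Ropp Rabs_R1 Rmult_1_l; apply: hb; lra.
Qed.

Lemma dlim_vsub u v u' v' t : has_deriv u u' t -> has_deriv v v' t ->
  has_deriv (fun s => vsub (u s) (v s)) (fun s => vsub (u' s) (v' s)) t.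
Proof. by move=> hu hv i; apply: derivable_pt_lim_minus; [apply: hu | apply: hv]. Qed.

Lemma gronwall_sub L T : 0 <= L -> 0 <= T -> exists C, 1 <= C /\
  forall u v u' v' a b e, b - a <= T -> 0 <= e ->
  (forall t, has_deriv u u' t) -> (forall t, has_deriv v v' t) ->
  (forall t, a <= t <= b ->
     vnorm (vsub (u' t) (v' t)) <= L * vnorm (vsub (u t) (v t)) + e) ->
  forall s t, a <= s <= b -> a <= t <= b ->
    vnorm (vsub (u t) (v t)) <= C * (vnorm (vsub (u s) (v s)) + e).
Proof.
move=> L0 T0; have [C [C1 hC]] := gronwall L0 T0; exists C; split => //.
move=> u v u' v' a b e ab e0 hu hv h.
apply: (hC (fun t => vsub (u t) (v t)) (fun t => vsub (u' t) (v' t))) => // t _.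
exact: dlim_vsub.
Qed.

End Gronwall.

Section Picard.
Variable k : nat.
Implicit Types (u : R -> Vec k) (f : R -> Vec k -> Vec k).

Definition vcont u := forall t e, 0 < e ->
  exists d, 0 < d /\ forall s, Rabs (s - t) < d -> vnorm (vsub (u s) (u t)) < e.

Definition jcont f := forall t x e, 0 < e ->
  exists d, 0 < d /\ forall s y, Rabs (s - t) < d -> vnorm (vsub y x) < d ->
    vnorm (vsub (f s y) (f t x)) < e.

(** Global in [x] and local in time: this rules out blow-up and is what truncated fields satisfy. *)
Definition tlip f := forall A, exists L, 0 < L /\ forall t x y, Rabs t <= A ->
  vnorm (vsub (f t x) (f t y)) <= L * vnorm (vsub x y).

Lemma vcont_coord u i t : vcont u -> continuity_pt (fun s => u s i) t.
Proof.
move=> h e e0; have [d [d0 hd]] := h t e e0; exists d; split => // s [_ hs].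
exact: Rle_lt_trans (vnorm_coord (vsub (u s) (u t)) i) (hd s hs).
Qed.

Lemma vcont_of_coord u : (forall i t, continuity_pt (fun s => u s i) t) -> vcont u.
Proof.
move=> h t e e0.
have hi i : exists d, 0 < d /\ forall s, Rabs (s - t) < d -> Rabs (u s i - u t i) < e.
  have [d [d0 hd]] := h i t e e0; exists d; split => // s hs.
  have [->|st] := Req_dec s t; first by rewrite Rminus_diag Rabs_R0.
  by apply: hd; split => //; split => //; apply: not_eq_sym.
have [d [d0 hd]] : exists d, 0 < d /\ forall i s, Rabs (s - t) < d -> Rabs (u s i - u t i) < e.
  have [i r r' _ rr H s hs|i _|d [d0 hd]] := @list_uniform _
     (fun i d => forall s, Rabs (s - t) < d -> Rabs (u s i - u t i) < e) (enum 'I_k).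
  - by apply: H; lra.
  - exact: hi.
  - exists d; split => // i; apply: hd.
    have : i \in enum 'I_k by rewrite mem_enum.
    by elim: (enum 'I_k) => // a l IH; rewrite inE => /orP [/eqP ->|/IH]; [left | right].
by exists d; split => // s hs; apply: vnorm_lt => // i; apply: hd.
Qed.

Lemma vcont_of_deriv u u' : (forall t, has_deriv u u' t) -> vcont u.
Proof.
move=> h; apply: vcont_of_coord => i t; apply: derivable_continuous_pt.
by exists (u' t i); apply: h.
Qed.

Lemma vcont_comp f u : jcont f -> vcont u -> vcont (fun t => f t (u t)).
Proof.
move=> hf hu t e e0; have [d [d0 hd]] := hf t (u t) e e0; have [d' [d'0 hd']] := hu t d d0.
exists (Rmin d d'); split; first exact: Rmin_glb_lt.
move=> s hs; apply: hd; first exact: Rlt_le_trans hs (Rmin_l _ _).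
by apply: hd'; apply: Rlt_le_trans hs (Rmin_r _ _).
Qed.

Lemma vcont_bounded u a b : vcont u -> exists B, 0 < B /\ forall t, a <= t <= b -> vnorm (u t) <= B.
Proof.
move=> hu; apply: (compact_bounded (@compact_interval a b)) => t ht.
have [d [d0 hd]] := hu t 1 ltac:(lra); exists d, (vnorm (u t) + 1); split => // s hs hst.
by have := hd s hst; have := vnorm_le_sub (u s) (u t); lra.
Qed.

Lemma antiderivative_exists (h : R -> Vec k) (x0 : Vec k) : vcont h ->
  exists H, H 0 = x0 /\ forall t, has_deriv H h t.
Proof.
move=> hc; exists (fun t i => x0 i + RInt (fun s => h s i) 0 t); split.
  by apply: vec_eq => i; rewrite RInt_point /zero /=; ring.
have ct i t : continuous (fun s => h s i) t.
  by apply/continuity_pt_filterlim; apply: vcont_coord.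
move=> t i; apply/is_derive_Reals.
have -> : h t i = plus zero (h t i) by rewrite plus_zero_l.
apply: (@is_derive_plus _ _ (fun=> x0 i) (fun t => RInt (fun s => h s i) 0 t)).
  exact: is_derive_const.
apply: (is_derive_RInt (fun s => h s i)) (ct i t).
apply: filter_forall => s; apply: RInt_correct; apply: ex_RInt_continuous => r _; exact: ct.
Qed.

Variables (f : R -> Vec k -> Vec k) (x0 : Vec k).
Hypotheses (fj : jcont f) (fl : tlip f).

(** The antiderivative is picked by choice, so the iteration can be defined before its continuity is
    known. *)
Definition picard_step (u : R -> Vec k) : R -> Vec k :=
  epsilon (inhabits u) (fun H => H 0 = x0 /\ forall t, has_deriv H (fun s => f s (u s)) t).

Fixpoint picard (n : nat) : R -> Vec k :=
  if n is n'.+1 then picard_step (picard n') else (fun _ => x0).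

Lemma picard_stepP u : vcont u ->
  picard_step u 0 = x0 /\ forall t, has_deriv (picard_step u) (fun s => f s (u s)) t.
Proof.
move=> hu; apply: (epsilon_spec (inhabits u)
  (fun H => H 0 = x0 /\ forall t, has_deriv H (fun s => f s (u s)) t)).
by apply: antiderivative_exists; apply: vcont_comp.
Qed.

Lemma picard_cont n : vcont (picard n).
Proof.
elim: n => [|n IH] /=; last by have [_ h] := picard_stepP IH; apply: vcont_of_deriv h.
by move=> t e e0; exists 1; split; [lra | move=> s _; rewrite vsubxx vnorm_zero].
Qed.

Lemma picard_deriv n t : has_deriv (picard n.+1) (fun s => f s (picard n s)) t.
Proof. by have [_ h] := picard_stepP (picard_cont n); apply: h. Qed.

Lemma picard0 n : picard n 0 = x0.
Proof. by case: n => //= n; have [h _] := picard_stepP (picard_cont n). Qed.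

(* With the weight exp (2 L |t|) the Picard map contracts by the factor 1/2 on every interval. *)
Lemma exp_weight_bound (g g' : R -> R) A L B : 0 < L -> g 0 = 0 ->
  (forall t, Rabs t <= A -> derivable_pt_lim g t (g' t)) ->
  (forall t, Rabs t <= A -> Rabs (g' t) <= L * (B * exp (2 * L * Rabs t))) ->
  0 <= B -> forall t, Rabs t <= A -> Rabs (g t) <= B / 2 * exp (2 * L * Rabs t).
Proof.
move=> L0.
have fwd : forall g g', g 0 = 0 ->
  (forall t, Rabs t <= A -> derivable_pt_lim g t (g' t)) ->
  (forall t, Rabs t <= A -> Rabs (g' t) <= L * (B * exp (2 * L * Rabs t))) ->
  0 <= B -> forall t, 0 <= t <= A -> g t <= B / 2 * exp (2 * L * t).
  move=> {}g {}g' g0 hd hb B0 t ht.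
  have : g t - g 0 <= B / 2 * exp (2 * L * t) - B / 2 * exp (2 * L * 0).
    apply: (@le_of_deriv_le g (fun t => B / 2 * exp (2 * L * t)) g'
      (fun t => L * (B * exp (2 * L * t)))) => [|s hs|s hs|s hs]; first lra.
    - by apply: hd; rewrite Rabs_pos_eq; lra.
    - by apply/is_derive_Reals; auto_derive => //; field.
    - have := hb s; rewrite (Rabs_pos_eq s); last lra.
      by have := Rle_abs (g' s) => h1 /(_ _) h2; apply: Rle_trans h1 (h2 _); lra.
  by rewrite g0 Rmult_0_r exp_0; lra.
have both : forall g g', g 0 = 0 ->
  (forall t, Rabs t <= A -> derivable_pt_lim g t (g' t)) ->
  (forall t, Rabs t <= A -> Rabs (g' t) <= L * (B * exp (2 * L * Rabs t))) ->
  0 <= B -> forall t, 0 <= t <= A -> Rabs (g t) <= B / 2 * exp (2 * L * t).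
  move=> {}g {}g' g0 hd hb B0 t ht; apply: Rabs_le.
  have h1 := fwd g g' g0 hd hb B0 t ht.
  have h2 : - g t <= B / 2 * exp (2 * L * t); last lra.
  apply: (fwd (fun t => - g t) (fun t => - g' t)) => //; first by rewrite g0 Ropp_0.
  - by move=> s hs; apply: derivable_pt_lim_opp; apply: hd.
  - by move=> s hs; rewrite Rabs_Ropp; apply: hb.
move=> g0 hd hb B0 t ht.
have [t0|t0] := Rle_lt_dec 0 t.
  rewrite (Rabs_pos_eq t) // in ht *; exact: both g0 hd hb B0 t (conj t0 ht).
rewrite (Rabs_left t) // in ht *.
have := both (fun s => g (- s)) (fun s => - g' (- s)).
rewrite Ropp_0 => /(_ g0) h; have {h} := h _ _ B0 (- t).
rewrite Ropp_involutive; apply; last by lra.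
- by move=> s hs; apply: dlim_opp_arg; apply: hd; rewrite Rabs_Ropp.
- by move=> s hs; rewrite Rabs_Ropp -(Rabs_Ropp s); apply: hb; rewrite Rabs_Ropp.
Qed.

Lemma picard_diff A : exists B, 0 < B /\ forall n t, Rabs t <= A ->
  vnorm (vsub (picard n.+1 t) (picard n t)) <= B * (1 / 2) ^ n.
Proof.
have [L [L0 hL]] := fl A.
have [B [B0 hB]] := vcont_bounded (- A) A (picard_cont 1).
have w n t : Rabs t <= A -> vnorm (vsub (picard n.+1 t) (picard n t))
    <= (B + vnorm x0) * (1 / 2) ^ n * exp (2 * L * Rabs t).
  have x00 := vnorm_ge0 x0.
  elim: n t => [|n IH] t ht.
    have := hB t (proj1 (Rabs_le_between _ _) ht).
    have := vnorm_sub_le (picard 1 t) (picard 0 t); rewrite [picard 0 t]/= => h1 h2.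
    have : 1 <= exp (2 * L * Rabs t).
      by rewrite -exp_0; apply: exp_mono; have := Rabs_pos t; nra.
    rewrite [_ ^ 0]/=; nra.
  have p0 : 0 < (1 / 2) ^ n by apply: pow_lt; lra.
  have e0 := exp_pos (2 * L * Rabs t).
  apply: vnorm_lub => [|i].
    by apply: Rmult_le_pos; [apply: Rmult_le_pos; [lra | apply: pow_le; lra] | lra].
  have -> : (B + vnorm x0) * (1 / 2) ^ n.+1 * exp (2 * L * Rabs t)
     = ((B + vnorm x0) * (1 / 2) ^ n) / 2 * exp (2 * L * Rabs t) by rewrite /=; field.
  apply: (@exp_weight_bound (fun t => picard n.+2 t i - picard n.+1 t i)
    (fun t => f t (picard n.+1 t) i - f t (picard n t) i) A) => //.
  - by rewrite !picard0; ring.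
  - by move=> s _; apply: derivable_pt_lim_minus; apply: picard_deriv.
  - move=> s hs; apply: Rle_trans (vnorm_coord (vsub (f s _) (f s _)) i) _.
    apply: Rle_trans (hL s _ _ hs) _; apply: Rmult_le_compat_l; [lra | exact: IH].
  - by apply: Rmult_le_pos; lra.
have x00 := vnorm_ge0 x0; have e0 := exp_pos (2 * L * A).
exists ((B + vnorm x0) * exp (2 * L * A)); split; first by apply: Rmult_lt_0_compat; lra.
move=> n t ht; apply: Rle_trans (w n t ht) _.
have p0 : 0 < (1 / 2) ^ n by apply: pow_lt; lra.
have : exp (2 * L * Rabs t) <= exp (2 * L * A) by apply: exp_mono; nra.
have := Rmult_lt_0_compat _ _ (Rplus_lt_le_0_compat _ _ B0 x00) p0; nra.
Qed.

Lemma picard_cauchy A : exists B, 0 < B /\ forall n m t, Rabs t <= A ->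
  vnorm (vsub (picard (m + n)%N t) (picard n t)) <= B * (1 / 2) ^ n.
Proof.
have [B [B0 hB]] := picard_diff A; exists (2 * B); split; first lra.
move=> n m t ht.
have : vnorm (vsub (picard (m + n)%N t) (picard n t)) <= 2 * B * ((1 / 2) ^ n - (1 / 2) ^ (m + n)%N).
  elim: m => [|m IH]; first by rewrite vsubxx vnorm_zero Rminus_diag Rmult_0_r; lra.
  have := vnorm_sub_tri (picard (m.+1 + n)%N t) (picard (m + n)%N t) (picard n t).
  by have := hB (m + n)%N t ht; rewrite addSn [_ ^ (m + n).+1]/=; lra.
have : 0 < (1 / 2) ^ (m + n)%N by apply: pow_lt; lra.
nra.
Qed.

Lemma geom_small B e : 0 < e -> exists N0, forall n, (N0 <= n)%N -> B * (1 / 2) ^ n < e.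
Proof.
move=> e0; have e1 : 0 < e / (Rabs B + 1) by apply: Rdiv_lt_0_compat => //; have := Rabs_pos B; lra.
have [N0 hN] := pow_lt_1_zero (1 / 2) ltac:(rewrite Rabs_pos_eq; lra) _ e1.
exists N0 => n /leP /hN; rewrite Rabs_pos_eq; last by apply: pow_le; lra.
move=> h; have p0 : 0 <= (1 / 2) ^ n by apply: pow_le; lra.
have e2 : (Rabs B + 1) * (e / (Rabs B + 1)) = e by field; have := Rabs_pos B; lra.
have := Rle_abs B; have := Rabs_pos B => b0 b1.
have := Rmult_le_compat_r _ _ _ p0 b1; nra.
Qed.

(** The limit is taken pointwise, so a single [X] serves every interval [[-A, A]], each with its own
    constant. *)
Lemma picard_limit : exists X : R -> Vec k, forall A, exists B, 0 < B /\
  forall n t, Rabs t <= A -> vnorm (vsub (X t) (picard n t)) <= B * (1 / 2) ^ n.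
Proof.
have lim t i : exists l, Un_cv (fun n => picard n t i) l.
  have [B [B0 hB]] := picard_cauchy (Rabs t).
  suff cc : Cauchy_crit (fun n => picard n t i).
    by have [l hl] := Rcomplete.R_complete _ cc; exists l.
  move=> e e0; have [N0 hN] := geom_small B (e := e / 2) ltac:(lra).
  exists N0 => n m /leP hn /leP hm.
  have b p : (N0 <= p)%N -> Rabs (picard p t i - picard N0 t i) < e / 2.
    move=> hp; have := hB N0 (p - N0)%N t (Rle_refl _); rewrite subnK // => h.
    apply: Rle_lt_trans (Rle_lt_trans _ _ _ h (hN N0 (leqnn _))).
    exact: (vnorm_coord (vsub (picard p t) (picard N0 t))).
  have /Rabs_lt_between := b n hn; have /Rabs_lt_between := b m hm => h1 h2.
  by rewrite /Rdist; apply: Rabs_def1; lra.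
pose X t i := proj1_sig (constructive_indefinite_description _ (lim t i)).
have hX t i : Un_cv (fun n => picard n t i) (X t i).
  exact: proj2_sig (constructive_indefinite_description _ (lim t i)).
exists X => A; have [B [B0 hB]] := picard_cauchy A; exists B; split => // n t ht.
have p0 : 0 <= (1 / 2) ^ n by apply: pow_le; lra.
apply: vnorm_lub => [|i]; first by apply: Rmult_le_pos; lra.
apply: Rnot_lt_le => h; set q := B * _ in h.
have [N0 hN] := hX t i (Rabs (vsub (X t) (picard n t) i) - q) ltac:(lra).
have /hN : (N0 + n >= N0)%coq_nat by lia.
rewrite /Rdist => h1; have h2 := hB n N0 t ht.
have h3 := Rle_trans _ _ _ (vnorm_coord (vsub (picard (N0 + n)%N t) (picard n t)) i) h2.
rewrite /vsub in h h1 h3; rewrite -/q in h3.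
have := Rabs_triang (picard (N0 + n)%N t i - picard n t i) (- (picard (N0 + n)%N t i - X t i)).
rewrite Rabs_Ropp.
have -> : picard (N0 + n)%N t i - picard n t i + - (picard (N0 + n)%N t i - X t i)
  = X t i - picard n t i by ring.
lra.
Qed.

Lemma picard_lindelof : exists X : R -> Vec k, is_solution f X /\ X 0 = x0.
Proof.
have [X hX] := picard_limit.
have cX : vcont X.
  move=> t e e0; have [B [B0 hB]] := hX (Rabs t + 1).
  have [N0 hN] := geom_small B (e := e / 3) ltac:(lra).
  have [d [d0 hd]] := picard_cont N0 t (e := e / 3) ltac:(lra).
  exists (Rmin 1 d); split; first by apply: Rmin_glb_lt; lra.
  move=> s hs; have s1 := lt_minl hs.
  have s2 := hd s (lt_minr hs); have sN := hN N0 (leqnn _).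
  have hs' : Rabs s <= Rabs t + 1.
    by have := Rabs_triang t (s - t); have -> : t + (s - t) = s by [ring]; lra.
  have := hB N0 s hs'; have := hB N0 t ltac:(lra).
  have := vnorm_sub_tri (X s) (picard N0 s) (X t).
  have := vnorm_sub_tri (picard N0 s) (picard N0 t) (X t).
  by rewrite (vnorm_sub_sym (picard N0 t) (X t)); lra.
exists X; split; last first.
  apply: vsub_eq0; apply: vnorm_eq0; apply: Rnot_lt_le => h.
  have [B [B0 hB]] := hX 0; have [N0 hN] := geom_small B h.
  by have := hB N0 0 ltac:(rewrite Rabs_R0; lra); have := hN N0 (leqnn _); rewrite picard0; lra.
move=> t i.
have r0 : 0 < Rabs t + 1 by have := Rabs_pos t; lra.
pose r := mkposreal _ r0.
have [B [B0 hB]] := hX (Rabs t + 1); have [L [L0 hL]] := fl (Rabs t + 1).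
have bl y : Boule 0 r y -> Rabs y <= Rabs t + 1 by rewrite /Boule /= Rminus_0_r; lra.
(* The derivatives converge uniformly on the ball of radius [|t| + 1], so the limit can be
   differentiated termwise. *)
apply: (@derivable_pt_lim_CVU (fun n s => picard n.+1 s i) (fun n s => f s (picard n s) i)
  (fun s => X s i) (fun s => f s (X s) i) t 0 r).
- by rewrite /Boule /= Rminus_0_r; lra.
- by move=> y n _; apply: picard_deriv.
- move=> y /bl hy e e0; have [N0 hN] := geom_small B e0; exists N0 => n hn.
  rewrite /Rdist Rabs_minus_sym.
  apply: Rle_lt_trans (vnorm_coord (vsub (X y) (picard n.+1 y)) i) _.
  by apply: Rle_lt_trans (hB n.+1 y hy) _; apply: hN; apply/leP; lia.
- move=> e e0; have [N0 hN] := geom_small (L * B) e0; exists N0 => n y hn /bl hy.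
  apply: Rle_lt_trans (vnorm_coord (vsub (f y (X y)) (f y (picard n y))) i) _.
  apply: Rle_lt_trans (hL y _ _ hy) _.
  apply: Rle_lt_trans (Rmult_le_compat_l L _ _ (Rlt_le _ _ L0) (hB n y hy)) _.
  by rewrite -Rmult_assoc; apply: hN; apply/leP.
- by move=> y _; apply: (@vcont_coord (fun s => f s (X s))); apply: vcont_comp.
Qed.

End Picard.

(** * Perturbation of the flow *)

Section CompactFamily.
Variables (k : nat) (Y : Type) (dd : Y -> Y -> R) (a b M : R).
Hypothesis dd_sym : forall y z, dd y z = dd z y.
Hypothesis dd_tri : forall x y z, dd x z <= dd x y + dd y z.
Variable g : R -> Vec k -> Y.
Hypothesis gc : forall t x e, 0 < e -> exists d, 0 < d /\ forall s y,
  Rabs (s - t) < d -> vnorm (vsub y x) < d -> dd (g s y) (g t x) < e.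

(** The distance [dd] is abstract so that fields and their Jacobian matrices are treated alike. *)
Lemma family_unif_cont e : 0 < e -> exists c, 0 < c /\ forall t x y, a <= t <= b ->
  vnorm x <= M -> vnorm y <= M -> vnorm (vsub y x) < c -> dd (g t y) (g t x) < e.
Proof.
move=> e0; have := compact_prod (@compact_interval a b) (@compact_box k M).
move=> /(_ (fun c p => forall y, vnorm (vsub y p.2) < c -> dd (g p.1 y) (g p.1 p.2) < e)).
case=> [c c' [t x] c0 cc h y hy|[t x] /= [ht hx]|c [c0 hc]].
- by apply: h; lra.
- have [d [d0 hd]] := gc t x (e := e / 2) ltac:(lra).
  exists (d / 2); split; first lra; move=> [s z] /= [hs hz] h y hy.
  have h1 := max_ltl h; have h2 := max_ltr h.
  have := dd_tri (g s y) (g t x) (g s z); rewrite (dd_sym (g t x)).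
  have := hd s z ltac:(lra) ltac:(lra).
  have := hd s y ltac:(lra) ltac:(have := vnorm_sub_tri y z x; lra).
  lra.
- by exists c; split => // t x y ht hx hy; apply: (hc (t, x)).
Qed.

Lemma family_bounded (N : Y -> R) : (forall y z, N y <= N z + dd y z) ->
  exists B, 0 < B /\ forall t x, a <= t <= b -> vnorm x <= M -> N (g t x) <= B.
Proof.
move=> hN.
have [[t x] /= [ht hx]|K [K0 hK]] := compact_bounded (N := fun p => N (g p.1 p.2))
  (compact_prod (@compact_interval a b) (@compact_box k M)).
  have [d [d0 hd]] := gc t x (e := 1) ltac:(lra); exists d, (N (g t x) + 1); split => //.
  move=> [s z] /= _ h; have := hd s z (max_ltl h) (max_ltr h).
  by have := hN (g s z) (g t x); lra.
by exists K; split => // t x ht hx; apply: (hK (t, x)).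
Qed.

End CompactFamily.

Section SmoothField.
Variable k : nat.
Implicit Types (A : Mat k) (v x y : Vec k).

Definition mnorm A : R := vnorm (fun i => vnorm (A i)).
Definition mdist A B : R := mnorm (fun i j => A i j - B i j).

Lemma mnorm_coord A i j : Rabs (A i j) <= mnorm A.
Proof.
apply: Rle_trans (vnorm_coord (A i) j) _.
have := vnorm_coord (fun i => vnorm (A i)) i.
by rewrite Rabs_pos_eq //; apply: vnorm_ge0.
Qed.

Lemma mnorm_lub A c : 0 <= c -> (forall i j, Rabs (A i j) <= c) -> mnorm A <= c.
Proof.
move=> c0 h; apply: vnorm_lub => // i; rewrite Rabs_pos_eq; last exact: vnorm_ge0.
exact: vnorm_lub.
Qed.

Lemma mnorm_ge0 A : 0 <= mnorm A.
Proof. exact: vnorm_ge0. Qed.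

Lemma mdist_sym A B : mdist A B = mdist B A.
Proof.
rewrite /mdist /mnorm; congr vnorm; apply: vec_eq => i.
exact: (vnorm_sub_sym (A i) (B i)).
Qed.

Lemma mnorm_le_dist A B : mnorm A <= mnorm B + mdist A B.
Proof.
apply: mnorm_lub => [|i j]; first by have := mnorm_ge0 B; have := mnorm_ge0 (fun i j => A i j - B i j); rewrite -/(mdist A B); lra.
have := mnorm_coord B i j; have := mnorm_coord (fun i j => A i j - B i j) i j.
rewrite -/(mdist A B); have := Rabs_triang (B i j) (A i j - B i j).
by have -> : B i j + (A i j - B i j) = A i j by [ring]; lra.
Qed.

Lemma mdist_tri A B C : mdist A C <= mdist A B + mdist B C.
Proof.
have := mnorm_le_dist (fun i j => A i j - C i j) (fun i j => B i j - C i j).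
have -> : mdist (fun i j => A i j - C i j) (fun i j => B i j - C i j) = mdist A B.
  by congr mnorm; do 2 (apply: functional_extensionality => ?); ring.
by rewrite /mdist; lra.
Qed.

Lemma mapp_mnorm A v : vnorm (mapp A v) <= INR k * mnorm A * vnorm v.
Proof. by apply: mapp_bound; apply: mnorm_coord. Qed.

Variables (f : R -> Vec k -> Vec k) (D : R -> Vec k -> Mat k).
Hypothesis fC1 : C1_tx_with f D.

Lemma C1_jcont : jcont f.
Proof.
have [Dt [hd _]] := fC1; move=> t x e e0.
have [d [d0 h]] := hd t x 1 ltac:(lra).
have k0 := pos_INR k; have n0 := vnorm_ge0 (Dt t x); have m0 := mnorm_ge0 (D t x).
pose C := vnorm (Dt t x) + INR k * mnorm (D t x) + 1.
have C1p : 1 <= C by rewrite /C; have := Rmult_le_pos _ _ k0 m0; lra.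
have q0 : 0 < e / (2 * C) by apply: Rdiv_lt_0_compat; lra.
exists (Rmin d (e / (2 * C))); split; first exact: Rmin_glb_lt.
move=> s y hs hy.
have s1 := lt_minl hs; have s2 := lt_minr hs.
have y1 := lt_minl hy; have y2 := lt_minr hy.
have := h (s - t) (vsub y x) s1 y1.
have -> : t + (s - t) = s by ring.
have -> : vadd x (vsub y x) = y by vec_ring.
set q := Rmax _ _; set w := vadd (vscale _ _) _ => h1.
have qe : q < e / (2 * C) by apply: Rmax_lub_lt.
have q1 : Rabs (s - t) <= q by apply: Rmax_l.
have q2 : vnorm (vsub y x) <= q by apply: Rmax_r.
have hw : vnorm w <= q * (vnorm (Dt t x) + INR k * mnorm (D t x)).
  apply: Rle_trans (vnorm_add _ _) _; rewrite vnorm_scale.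
  have := mapp_mnorm (D t x) (vsub y x).
  have := Rmult_le_compat_r _ _ _ n0 q1.
  have := Rmult_le_compat_l _ _ _ (Rmult_le_pos _ _ k0 m0) q2; lra.
have := vnorm_le_sub (vsub (f s y) (f t x)) w.
have e1 : C * (e / (2 * C)) = e / 2 by field; lra.
have qp : 0 <= q by apply: Rle_trans (Rabs_pos _) q1.
have : q * C <= e / 2 by rewrite -e1 Rmult_comm; apply: Rmult_le_compat_l; lra.
by rewrite /C; lra.
Qed.

Lemma C1_grad t i : has_grad (fun x => f t x i) (fun j x => D t x i j).
Proof.
have [Dt [hd _]] := fC1; move=> x v e e0.
have n0 := vnorm_ge0 v.
have q0 : 0 < e / (2 * (vnorm v + 1)) by apply: Rdiv_lt_0_compat; lra.
have [d [d0 h]] := hd t x _ q0.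
have d1 : 0 < d / (vnorm v + 1) by apply: Rdiv_lt_0_compat; lra.
exists (mkposreal _ d1) => s s0 /= hs; have sp := Rabs_pos_lt _ s0.
have sv : vnorm (vscale s v) < d.
  rewrite vnorm_scale; have e1 : d / (vnorm v + 1) * (vnorm v + 1) = d by field; lra.
  have := Rmult_lt_compat_r (vnorm v + 1) _ _ ltac:(lra) hs; lra.
have := h 0 (vscale s v) ltac:(rewrite Rabs_R0; lra) sv.
rewrite Rplus_0_r Rabs_R0 Rmax_right; last exact: vnorm_ge0.
set w := vsub _ _ => h1; have {}h1 := Rle_trans _ _ _ (vnorm_coord w i) h1.
rewrite Rplus_0_l line0.
have ew : w i = f t (line x v s) i - f t x i - s * \rsum_j (v j * D t x i j).
  rewrite /w /vsub /vadd /vscale /mapp rsum_scal.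
  have -> : \rsum_j (D t x i j * (s * v j)) = \rsum_j (s * (v j * D t x i j)).
    by apply: eq_bigr => j _; ring.
  by rewrite /line /vadd /vscale; ring.
have -> : (f t (line x v s) i - f t x i) / s - \rsum_j (v j * D t x i j) = w i / s.
  by rewrite ew; field.
rewrite /Rdiv Rabs_mult Rabs_inv; apply: (Rmult_lt_reg_r (Rabs s)) => //.
rewrite Rmult_assoc Rinv_l ?Rmult_1_r; last lra.
apply: Rle_lt_trans h1 _; rewrite vnorm_scale.
have e1 : e / (2 * (vnorm v + 1)) * (2 * (vnorm v + 1)) = e by field; lra.
nra.
Qed.

Lemma C1_Dcont t x e : 0 < e -> exists d, 0 < d /\ forall s y,
  Rabs (s - t) < d -> vnorm (vsub y x) < d -> mdist (D s y) (D t x) < e.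
Proof.
have [Dt [_ hc]] := fC1; move=> e0.
have [d [d0 h]] := hc t x (e / 2) ltac:(lra); exists d; split => // s y hs hy.
have [_ h2] := h s y hs hy; apply: (Rle_lt_trans _ (e / 2)); last lra.
by apply: mnorm_lub => [|i j]; [lra | apply: Rlt_le].
Qed.

Lemma C1_bound a b M : exists B, 0 < B /\ forall t x, a <= t <= b -> vnorm x <= M ->
  vnorm (f t x) <= B.
Proof.
apply: (family_bounded a b M (dd := fun x y => vnorm (vsub x y))); first exact: C1_jcont.
by move=> y z; apply: vnorm_le_sub.
Qed.

Lemma C1_unif_cont a b M e : 0 < e -> exists c, 0 < c /\ forall t x y, a <= t <= b ->
  vnorm x <= M -> vnorm y <= M -> vnorm (vsub y x) < c -> vnorm (vsub (f t y) (f t x)) < e.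
Proof.
apply: (family_unif_cont (dd := fun x y => vnorm (vsub x y))).
- exact: vnorm_sub_sym.
- exact: vnorm_sub_tri.
- exact: C1_jcont.
Qed.

Lemma C1_D_bound a b M : exists B, 0 < B /\ forall t x, a <= t <= b -> vnorm x <= M ->
  mnorm (D t x) <= B.
Proof.
by apply: (family_bounded a b M (dd := mdist)); [exact: C1_Dcont | exact: mnorm_le_dist].
Qed.

Lemma C1_D_unif_cont a b M e : 0 < e -> exists c, 0 < c /\ forall t x y, a <= t <= b ->
  vnorm x <= M -> vnorm y <= M -> vnorm (vsub y x) < c -> mdist (D t y) (D t x) < e.
Proof.
by apply: (family_unif_cont (dd := mdist));
  [exact: mdist_sym | exact: mdist_tri | exact: C1_Dcont].
Qed.

Lemma C1_mapp_bound a b M : exists C, 0 < C /\ forall t x v, a <= t <= b -> vnorm x <= M ->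
  vnorm (mapp (D t x) v) <= C * vnorm v.
Proof.
have [B [B0 hB]] := C1_D_bound a b M; have k0 := pos_INR k.
have kB := Rmult_le_pos _ _ k0 (Rlt_le _ _ B0).
exists (INR k * B + 1); split; first lra.
move=> t x v ht hx; have := mapp_mnorm (D t x) v; have n0 := vnorm_ge0 v.
by have := Rmult_le_compat_r _ _ _ n0 (Rmult_le_compat_l _ _ _ k0 (hB t x ht hx)); lra.
Qed.

Lemma C1_mapp_unif_cont a b M e : 0 < e -> exists c, 0 < c /\ forall t x y v, a <= t <= b ->
  vnorm x <= M -> vnorm y <= M -> vnorm (vsub y x) < c ->
  vnorm (vsub (mapp (D t y) v) (mapp (D t x) v)) <= e * vnorm v.
Proof.
move=> e0; have k0 := pos_INR k; have [q [[q0 _] hq]] := small_mult k0 e0.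
have [c [c0 hc]] := C1_D_unif_cont a b M q0; exists c; split => // t x y v ht hx hy hxy.
have -> : vsub (mapp (D t y) v) (mapp (D t x) v) = mapp (fun i j => D t y i j - D t x i j) v.
  by apply: vec_eq => i; rewrite /vsub /mapp rsum_sub; apply: eq_bigr => j _; ring.
apply: Rle_trans (mapp_mnorm _ _) _; apply: Rmult_le_compat_r; first exact: vnorm_ge0.
by apply/Rlt_le/hq; [apply: mnorm_ge0 | apply: hc].
Qed.

Lemma vadd_sub x y : vadd x (vsub y x) = y.
Proof. by vec_ring. Qed.

Lemma C1_lip a b M : exists L, 0 < L /\ forall t x y, a <= t <= b ->
  vnorm x <= M -> vnorm y <= M -> vnorm (vsub (f t x) (f t y)) <= L * vnorm (vsub x y).
Proof.
have [B [B0 hB]] := C1_D_bound a b M; have k0 := pos_INR k.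
have kB := Rmult_le_pos _ _ k0 (Rlt_le _ _ B0).
exists (INR k * B + 1); split; first lra.
move=> t x y ht hx hy; have n0 := vnorm_ge0 (vsub x y).
apply: vnorm_lub => [|i]; first by apply: Rmult_le_pos; lra.
have [th [hth]] := grad_mvt y (vsub x y) (C1_grad t i).
rewrite vadd_sub -/(vsub (f t x) (f t y) i) => ->; apply: Rle_trans (rsum_abs _ _) _.
apply: (Rle_trans _ (INR k * (B * vnorm (vsub x y)))); last lra.
apply: rsum_le_ord => j; rewrite Rabs_mult Rmult_comm.
apply: Rmult_le_compat; try exact: Rabs_pos; last exact: vnorm_coord.
apply: Rle_trans (mnorm_coord _ _ _) _; apply: hB => //.
by apply: line_bound; rewrite ?vadd_sub.
Qed.

(** Mean value theorem in each coordinate; the Jacobian at the intermediate point is uniformly close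
    to the one at [x]. *)
Lemma C1_linearize a b M e : 0 < e -> exists c, 0 < c /\ forall t x y, a <= t <= b ->
  vnorm x <= M -> vnorm y <= M -> vnorm (vsub y x) < c ->
  vnorm (vsub (vsub (f t y) (f t x)) (mapp (D t x) (vsub y x))) <= e * vnorm (vsub y x).
Proof.
move=> e0; have k0 := pos_INR k.
have q0 : 0 < e / (INR k + 1) by apply: Rdiv_lt_0_compat; lra.
have [c [c0 hc]] := C1_D_unif_cont a b M q0; exists c; split => // t x y ht hx hy hxy.
have n0 := vnorm_ge0 (vsub y x).
apply: vnorm_lub => [|i]; first by apply: Rmult_le_pos; lra.
have [th [hth]] := grad_mvt x (vsub y x) (C1_grad t i); rewrite vadd_sub => h.
rewrite {1 2}/vsub h.
have -> : mapp (D t x) (vsub y x) i = \rsum_j (vsub y x j * D t x i j).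
  by apply: eq_bigr => j _; rewrite Rmult_comm.
rewrite rsum_sub; apply: Rle_trans (rsum_abs _ _) _.
apply: (Rle_trans _ (INR k * (e / (INR k + 1) * vnorm (vsub y x)))); last first.
  rewrite -Rmult_assoc; apply: Rmult_le_compat_r => //.
  have e1 : (INR k + 1) * (e / (INR k + 1)) = e by field; lra.
  lra.
apply: rsum_le_ord => j; rewrite -Rmult_minus_distr_l Rabs_mult Rmult_comm.
apply: Rmult_le_compat; try exact: Rabs_pos; last exact: vnorm_coord.
apply: Rle_trans (mnorm_coord (fun i j => D t (line x (vsub y x) th) i j - D t x i j) i j) _.
apply/Rlt_le/hc => //; first by apply: line_bound; rewrite ?vadd_sub.
have -> : vsub (line x (vsub y x) th) x = vscale th (vsub y x).
  by apply: vec_eq => l; rewrite /line /vadd /vscale /vsub; ring.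
rewrite vnorm_scale Rabs_pos_eq; [nra | lra].
Qed.

(** A 1-Lipschitz retraction onto the box. Composing a C1 field with it makes the field globally
    Lipschitz in [x] and leaves it unchanged on the box. *)
Definition clampv (M : R) x : Vec k := fun i => clamp (- M) M (x i).

Lemma clampv_bound M x : 0 <= M -> vnorm (clampv M x) <= M.
Proof.
move=> M0; apply: vnorm_lub => // i; apply: Rabs_le; rewrite /clampv.
by have := @clampP (- M) M (x i) ltac:(lra); lra.
Qed.

Lemma clampv_id M x : vnorm x <= M -> clampv M x = x.
Proof.
move=> h; apply: vec_eq => i; have /Rabs_le_between := Rle_trans _ _ _ (vnorm_coord x i) h.
by rewrite /clampv; have := @clampP (- M) M (x i); lra.
Qed.

Lemma clampv_lip M x y : 0 <= M -> vnorm (vsub (clampv M x) (clampv M y)) <= vnorm (vsub x y).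
Proof.
move=> M0; apply: vnorm_lub => [|i]; first exact: vnorm_ge0.
apply: Rle_trans (vnorm_coord (vsub x y) i); rewrite /vsub /clampv.
have h (s : R) := @clampP (- M) M s ltac:(lra); have := h (x i); have := h (y i); have a1 := Rle_abs (x i - y i).
have a2 := Rabs_maj2 (x i - y i) => h1 h2; apply: Rabs_le; lra.
Qed.

Lemma trunc_jcont M : 0 <= M -> jcont (fun t x => f t (clampv M x)).
Proof.
move=> M0 t x e e0; have [d [d0 h]] := C1_jcont t (clampv M x) e0.
exists d; split => // s y hs hy; apply: h => //.
exact: Rle_lt_trans (clampv_lip _ _ M0) hy.
Qed.

Lemma trunc_tlip M : 0 <= M -> tlip (fun t x => f t (clampv M x)).
Proof.
move=> M0 A; have [L [L0 h]] := C1_lip (- A) A M; exists L; split => // t x y ht.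
apply: Rle_trans (h t _ _ (proj1 (Rabs_le_between _ _) ht) (clampv_bound _ M0) (clampv_bound _ M0)) _.
by apply: Rmult_le_compat_l; [lra | apply: clampv_lip].
Qed.

End SmoothField.

Section Combine.
Variable k : nat.
Implicit Types f g : R -> Vec k -> Vec k.

Lemma jcont_combine c f g : jcont f -> jcont g -> jcont (fun t x => vadd (vscale c (f t x)) (g t x)).
Proof.
move=> hf hg t x e e0; have a0 := Rabs_pos c.
have q0 : 0 < e / (2 * (Rabs c + 1)) by apply: Rdiv_lt_0_compat; lra.
have [d1 [d10 h1]] := hf t x _ q0; have [d2 [d20 h2]] := hg t x (e / 2) ltac:(lra).
exists (Rmin d1 d2); split; first exact: Rmin_glb_lt.
move=> s y hs hy.
have i1 := h1 s y (lt_minl hs) (lt_minl hy).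
have i2 := h2 s y (lt_minr hs) (lt_minr hy).
have -> : vsub (vadd (vscale c (f s y)) (g s y)) (vadd (vscale c (f t x)) (g t x))
  = vadd (vscale c (vsub (f s y) (f t x))) (vsub (g s y) (g t x)).
  by vec_ring.
apply: Rle_lt_trans (vnorm_add _ _) _; rewrite vnorm_scale.
have e1 : e / (2 * (Rabs c + 1)) * (Rabs c + 1) = e / 2 by field; lra.
have := Rmult_le_compat_l _ _ _ a0 (Rlt_le _ _ i1); lra.
Qed.

Lemma tlip_combine c f g : tlip f -> tlip g -> tlip (fun t x => vadd (vscale c (f t x)) (g t x)).
Proof.
move=> hf hg A; have [L [L0 h1]] := hf A; have [K [K0 h2]] := hg A.
have a0 := Rabs_pos c; have aL := Rmult_le_pos _ _ a0 (Rlt_le _ _ L0).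
exists (Rabs c * L + K); split; first lra.
move=> t x y ht.
have -> : vsub (vadd (vscale c (f t x)) (g t x)) (vadd (vscale c (f t y)) (g t y))
  = vadd (vscale c (vsub (f t x) (f t y))) (vsub (g t x) (g t y)).
  by vec_ring.
apply: Rle_trans (vnorm_add _ _) _; rewrite vnorm_scale.
have := h2 t x y ht; have := Rmult_le_compat_l _ _ _ a0 (h1 t x y ht); lra.
Qed.

End Combine.

Lemma periodic_reduce (X : Type) (T : R) (g : R -> X) : 0 < T -> (forall t, g (t + T) = g t) ->
  forall t, exists t', 0 <= t' <= T /\ g t' = g t.
Proof.
move=> T0 per t.
have main : forall n t, Rabs t <= INR n * T + T -> exists t', 0 <= t' <= T /\ g t' = g t.
  elim=> [|n IH] {}t.
    rewrite Rmult_0_l Rplus_0_l => /Rabs_le_between ht.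
    have [t0|t0] := Rle_lt_dec 0 t; first by exists t; split => //; lra.
    by exists (t + T); split; [lra | exact: per].
  rewrite S_INR => /Rabs_le_between ht; have n0 := pos_INR n.
  have nT : 0 <= INR n * T by apply: Rmult_le_pos; lra.
  have [t0|t0] := Rle_lt_dec 0 t; last first.
    have [|t' [ht' e]] := IH (t + T); first by apply: Rabs_le; lra.
    by exists t'; rewrite e per.
  have [t1|t1] := Rle_lt_dec t T; first by exists t.
  have [|t' [ht' e]] := IH (t - T); first by apply: Rabs_le; lra.
  by exists t'; split => //; rewrite e -(per (t - T)); congr g; ring.
have [n hn] := INR_unbounded (Rabs t / T); apply: (main n).
have e : Rabs t / T * T = Rabs t by field; lra.
have := Rmult_lt_compat_r _ _ _ T0 hn; lra.
Qed.

(** [s] is the supremum of the times up to which [z] stays in [U]. Openness excludes [z s] from [U],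
    and the points just before [s] put it in the closure. *)
Lemma first_exit (k : nat) (U : Vec k -> Prop) (z : R -> Vec k) T t1 : is_open U ->
  0 <= t1 <= T -> U (z 0) -> ~ U (z t1) ->
  (forall t e, 0 <= t <= T -> 0 < e -> exists d, 0 < d /\ forall s, 0 <= s <= T ->
     Rabs (s - t) < d -> vnorm (vsub (z s) (z t)) < e) ->
  exists s, 0 <= s <= T /\ boundary U (z s).
Proof.
move=> oU ht1 U0 U1 zc.
pose E t := 0 <= t <= t1 /\ forall r, 0 <= r <= t -> U (z r).
have E0 : E 0 by split=> [|r hr]; [lra | have -> : r = 0 by lra].
have bE : bound E by exists t1 => x [hx _]; lra.
have [s [ub lub]] := completeness E bE (ex_intro _ 0 E0).
have s0 : 0 <= s by apply: ub.
have s1 : s <= t1 by apply: lub => x [hx _]; lra.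
have sT : 0 <= s <= T by lra.
have below r : 0 <= r < s -> U (z r).
  move=> hr; apply: NNPP => nU; have : s <= r; last lra.
  apply: lub => x [hx hU]; apply: Rnot_lt_le => rx; apply: nU; apply: hU; lra.
have nUs : ~ U (z s).
  move=> Us; have [e [e0 he]] := oU _ Us; have [d [d0 hd]] := zc s e sT e0.
  have [e1|lt] := Req_dec s t1; first by apply: U1; rewrite -e1.
  pose s' := Rmin t1 (s + d / 2).
  have a1 : s' <= t1 := Rmin_l _ _; have a2 : s' <= s + d / 2 := Rmin_r _ _.
  have a3 : s < s' by apply: Rmin_glb_lt; lra.
  have : s' <= s; last lra.
  apply: ub; split; first lra; move=> r hr.
  have [rs|rs] := Rlt_le_dec r s; first by apply: below; lra.
  by apply: he; apply: hd; [lra | apply: Rabs_def1; lra].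
exists s; split => //; split => // e e0; have [d [d0 hd]] := zc s e sT e0.
have [e1|sp] := Req_dec s 0; first by case: nUs; rewrite e1.
pose r := Rmax 0 (s - d / 2).
have a1 : 0 <= r := Rmax_l _ _; have a2 : s - d / 2 <= r := Rmax_r _ _.
have a3 : r < s by apply: Rmax_lub_lt; lra.
exists (z r); split; first by apply: below; lra.
by apply: hd; [lra | apply: Rabs_def1; lra].
Qed.

Section Flow.
Variables (k : nat) (T : R) (psi : R -> Vec k -> Vec k) (Dpsi : R -> Vec k -> Mat k).
Hypotheses (T0 : 0 < T) (psiC1 : C1_tx_with psi Dpsi).

(* The solution through (tau, z tau) of the system truncated outside a box exists globally and
   stays so close to y that the truncation is inactive; by uniqueness it is z. *)
Lemma solution_stability m : exists C, 1 <= C /\ forall y z tau,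
  is_solution psi y -> is_solution psi z -> (forall t, 0 <= t <= T -> vnorm (y t) <= m) ->
  0 <= tau <= T -> C * vnorm (vsub (z tau) (y tau)) < 1 ->
  forall t, 0 <= t <= T -> vnorm (vsub (z t) (y t)) <= C * vnorm (vsub (z tau) (y tau)).
Proof.
pose M := Rmax 0 m + 1; have M0 : 0 <= M by have := Rmax_l 0 m; rewrite /M; lra.
have mM : m + 1 <= M by have := Rmax_r 0 m; rewrite /M; lra.
have [L [L0 hL]] := C1_lip psiC1 0 T M.
have [C [C1 hC]] := @gronwall_sub k L T ltac:(lra) ltac:(lra).
exists C; split => // y z tau sy sz by_ ht hz.
pose F t x := psi t (clampv M x).
(* [picard_lindelof] prescribes the value at time 0, so time is shifted by [tau]. *)
have [X0 [sX0 X00]] := @picard_lindelof k (fun t x => F (t + tau) x) (z tau)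
  ltac:(move=> t x e e0; have [d [d0 h]] := trunc_jcont psiC1 M0 (t + tau) x e0;
        exists d; split => // s y' hs hy'; apply: h => //;
        by have -> : s + tau - (t + tau) = s - t by ring)
  ltac:(move=> A; have [L' [L'0 h]] := trunc_tlip psiC1 M0 (A + Rabs tau);
        exists L'; split => // t x y' ht'; apply: h;
        by have := Rabs_triang t tau; lra).
pose X t := X0 (t - tau).
have sX t : has_deriv X (fun t => F t (X t)) t.
  move=> i; have := sX0 (t - tau) i; have -> : t - tau + tau = t by ring.
  exact: dlim_shift_arg.
have Xtau : X tau = z tau by rewrite /X Rminus_diag.
have close t : 0 <= t <= T -> vnorm (vsub (X t) (y t)) <= C * vnorm (vsub (z tau) (y tau)).
  move=> ht'; have := hC _ _ _ _ 0 T 0 ltac:(lra) ltac:(lra) sX (fun t i => sy t i) _ tau t ht ht'.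
  rewrite Xtau Rplus_0_r; apply => s hs; have ys := by_ s hs.
  rewrite /F Rplus_0_r -{1}(@clampv_id k M (y s)); last lra.
  apply: Rle_trans (hL s _ _ hs (clampv_bound _ M0) (clampv_bound _ M0)) _.
  by apply: Rmult_le_compat_l; [lra | apply: clampv_lip].
have XM t : 0 <= t <= T -> vnorm (X t) <= M.
  by move=> ht'; have := close t ht'; have := by_ t ht'; have := vnorm_le_sub (X t) (y t); lra.
have [B [B0 hB]] := vcont_bounded 0 T (vcont_of_deriv (fun t => (sz t : has_deriv z _ t))).
have [L' [L'0 hL']] := C1_lip psiC1 0 T (Rmax M B).
have [C' [C'1 hC']] := @gronwall_sub k L' T ltac:(lra) ltac:(lra).
move=> t ht'.
(* On [[0, T]] both curves solve the original system inside one box, and they agree at [tau]. *)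
suff -> : z t = X t by exact: close.
apply/esym/vsub_eq0/vnorm_eq0.
have := hC' _ _ _ _ 0 T 0 ltac:(lra) ltac:(lra) sX (fun t i => sz t i) _ tau t ht ht'.
rewrite Xtau vsubxx vnorm_zero Rplus_0_r Rmult_0_r; apply => s hs.
rewrite Rplus_0_r /F clampv_id; last exact: XM.
apply: hL' => //; first exact: Rle_trans (XM s hs) (Rmax_l _ _).
exact: Rle_trans (hB s hs) (Rmax_r _ _).
Qed.

Lemma solution_bounded y : is_solution psi y ->
  exists m, 0 < m /\ forall t, 0 <= t <= T -> vnorm (y t) <= m.
Proof.
by move=> sy; apply: vcont_bounded; apply: (vcont_of_deriv (u' := fun t => psi t (y t))) => t i; apply: sy.
Qed.

Lemma solution_unique y z tau t : is_solution psi y -> is_solution psi z ->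
  0 <= tau <= T -> z tau = y tau -> 0 <= t <= T -> z t = y t.
Proof.
move=> sy sz ht e ht'; have [m [_ hm]] := solution_bounded sy.
have [C [C1 hC]] := solution_stability m; have := hC y z tau sy sz hm ht.
rewrite e vsubxx vnorm_zero Rmult_0_r => /(_ ltac:(lra) t ht') h.
by apply/vsub_eq0/vnorm_eq0.
Qed.

Variable Omega : R -> R -> Vec k -> Vec k.
Hypothesis Om : forall t0 xi, is_solution psi (fun t => Omega t t0 xi) /\ Omega t0 t0 xi = xi.

(** Near each [p] the stability of the solution through [p] gives a bound; compactness makes it
    uniform. *)
Lemma flow_bounded M1 : exists M2, 0 < M2 /\ forall t xi, 0 <= t <= T -> vnorm xi <= M1 ->
  vnorm (Omega t 0 xi) <= M2.
Proof.
have [|p hp|c [c0 hc]] := @compact_box k M1 (fun c xi => forall t, 0 <= t <= T ->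
   vnorm (Omega t 0 xi) <= / c).
- move=> c c' x c0 cc h t ht; apply: Rle_trans (h t ht) _; exact: Rinv_le_contravar.
- have [m [m0 hm]] := solution_bounded (proj1 (Om 0 p)).
  have [C [C1 hC]] := solution_stability m.
  have i1 : 0 < / C by apply: Rinv_0_lt_compat; lra.
  have i2 : 0 < / (m + 1) by apply: Rinv_0_lt_compat; lra.
  exists (Rmin (/ C) (/ (m + 1))); split; first exact: Rmin_glb_lt.
  move=> xi hxi hd t ht; have d1 := lt_minl hd.
  have e1 : C * / C = 1 by field; lra.
  have := hC _ _ 0 (proj1 (Om 0 p)) (proj1 (Om 0 xi)) hm ltac:(lra).
  rewrite !(proj2 (Om 0 _)) => h.
  have h1 : C * vnorm (vsub xi p) < 1 by rewrite -e1; apply: Rmult_lt_compat_l; lra.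
  have := h h1 t ht; have := hm t ht; have := vnorm_le_sub (Omega t 0 xi) (Omega t 0 p) => *.
  apply: (Rle_trans _ (m + 1)); first lra.
  rewrite -{1}[m + 1]Rinv_inv; apply: Rinv_le_contravar; last exact: Rmin_r.
  exact: Rmin_glb_lt.
- by exists (/ c); split => [|t xi ht hx]; [apply: Rinv_0_lt_compat | apply: hc].
Qed.

Lemma flow_lip M1 : exists C, 1 <= C /\ forall t xi xi', 0 <= t <= T -> vnorm xi <= M1 ->
  vnorm xi' <= M1 -> vnorm (vsub (Omega t 0 xi) (Omega t 0 xi')) <= C * vnorm (vsub xi xi').
Proof.
have [M2 [M20 hM]] := flow_bounded M1; have [L [L0 hL]] := C1_lip psiC1 0 T M2.
have [C [C1 hC]] := @gronwall_sub k L T ltac:(lra) ltac:(lra).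
exists C; split => // t xi xi' ht hx hx'.
have := hC _ _ _ _ 0 T 0 ltac:(lra) ltac:(lra) (proj1 (Om 0 xi)) (proj1 (Om 0 xi')) _ 0 t
  ltac:(lra) ht.
rewrite !(proj2 (Om 0 _)) Rplus_0_r; apply => s hs.
by rewrite Rplus_0_r; apply: hL => //; apply: hM.
Qed.

(** The solution through [(s, x s)] is compared with the fixed one through [(t, x t)]: at time [s]
    both are near [x t], and stability carries this to time 0. *)
Lemma pullback_cont (x : R -> Vec k) : vcont x ->
  forall t e, 0 <= t <= T -> 0 < e -> exists d, 0 < d /\ forall s, 0 <= s <= T ->
    Rabs (s - t) < d -> vnorm (vsub (Omega 0 s (x s)) (Omega 0 t (x t))) < e.
Proof.
move=> xc t e ht e0; have sy := proj1 (Om t (x t)).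
have [m [m0 hm]] := solution_bounded sy; have [C [C1 hC]] := solution_stability m.
have yc : vcont (fun s => Omega s t (x t)).
  exact: (vcont_of_deriv (u' := fun s => psi s (Omega s t (x t)))).
pose q := Rmin 1 e / (2 * C).
have h0 : 0 < Rmin 1 e by apply: Rmin_glb_lt; lra.
have q0 : 0 < q / 2 by apply: Rdiv_lt_0_compat; [apply: Rdiv_lt_0_compat; lra | lra].
have [d1 [d10 h1]] := xc t _ q0; have [d2 [d20 h2]] := yc t _ q0.
exists (Rmin d1 d2); split; first exact: Rmin_glb_lt.
move=> s hs hst; have i1 := h1 s (lt_minl hst).
have i2 := h2 s (lt_minr hst); rewrite (proj2 (Om t _)) in i2.
have hq : vnorm (vsub (x s) (Omega s t (x t))) < q.
  have := vnorm_sub_tri (x s) (x t) (Omega s t (x t)).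
  by rewrite (vnorm_sub_sym (x t) (Omega s t (x t))); lra.
have e1 : C * q = Rmin 1 e / 2 by rewrite /q; field; lra.
have hCq : C * vnorm (vsub (x s) (Omega s t (x t))) < Rmin 1 e / 2.
  by rewrite -e1; apply: Rmult_lt_compat_l; lra.
have := hC _ _ s sy (proj1 (Om s (x s))) hm hs; rewrite (proj2 (Om s _)).
have r1 := Rmin_l 1 e; have r2 := Rmin_r 1 e.
by move=> /(_ ltac:(lra) 0 ltac:(lra)); lra.
Qed.

Variables (phi : R -> Vec k -> Vec k) (Dphi : R -> Vec k -> Mat k).
Hypothesis phiC1 : C1_tx_with phi Dphi.
Variable eta : R -> R -> Vec k -> Vec k.
Hypothesis heta : forall s xi,
  is_solution (fun t y => vadd (phi t (Omega t 0 xi)) (mapp (Dpsi t (Omega t 0 xi)) y))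
              (fun t => eta t s xi) /\ eta s s xi = vzero.

Definition perturbed eps M (t : R) (x : Vec k) : Vec k :=
  vadd (vscale eps (phi t (clampv M x))) (psi t (clampv M x)).

Lemma eta_bounded M1 : exists B, 0 < B /\ forall t s xi, 0 <= t <= T -> 0 <= s <= T ->
  vnorm xi <= M1 -> vnorm (eta t s xi) <= B.
Proof.
have [M2 [M20 hM]] := flow_bounded M1; have [B [B0 hB]] := C1_bound phiC1 0 T M2.
have [A [A0 hA]] := C1_mapp_bound psiC1 0 T M2.
have [C [C1 hC]] := @gronwall k A T ltac:(lra) ltac:(lra).
exists (C * B); split; first by apply: Rmult_lt_0_compat; lra.
move=> t s xi ht hs hx.
have := hC (fun t => eta t s xi) (fun t => vadd (phi t (Omega t 0 xi))
  (mapp (Dpsi t (Omega t 0 xi)) (eta t s xi))) 0 T B ltac:(lra) ltac:(lra) _ _ s t hs ht.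
rewrite (proj2 (heta s xi)) vnorm_zero Rplus_0_l; apply.
- by move=> r _ i; apply: (proj1 (heta s xi)).
- move=> r hr; have hO := hM r xi hr hx; apply: Rle_trans (vnorm_add _ _) _.
  by have := hB r _ hr hO; have := hA r _ (eta r s xi) hr hO; lra.
Qed.

(** At time [s] the first solution is 0 and the second at most [S * |s - s'|], [S] bounding its
    derivative; the coefficients of the two linear systems are close, and Gronwall concludes. *)
Lemma eta_cont M1 e : 0 < e -> exists c, 0 < c /\ forall t s s' xi xi', 0 <= t <= T ->
  0 <= s <= T -> 0 <= s' <= T -> vnorm xi <= M1 -> vnorm xi' <= M1 ->
  Rabs (s - s') < c -> vnorm (vsub xi xi') < c ->
  vnorm (vsub (eta t s xi) (eta t s' xi')) <= e.
Proof.
move=> e0; have [M2 [M20 hM]] := flow_bounded M1; have [B [B0 hB]] := C1_bound phiC1 0 T M2.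
have [A [A0 hA]] := C1_mapp_bound psiC1 0 T M2; have [E [E0 hE]] := eta_bounded M1.
have [Cf [Cf1 hCf]] := flow_lip M1; have AE : 0 < A * E by apply: Rmult_lt_0_compat.
have [C [C1 hC]] := @gronwall_sub k A T ltac:(lra) ltac:(lra).
(* Initial error [q] and forcing error [q + q * E] add up to [q * (2 + E)]. *)
pose q := e / (C * (3 + E)).
have q0 : 0 < q by apply: Rdiv_lt_0_compat => //; apply: Rmult_lt_0_compat; lra.
have [c1 [c10 h1]] := C1_unif_cont phiC1 0 T M2 q0.
have [c2 [c20 h2]] := C1_mapp_unif_cont psiC1 0 T M2 q0.
pose S := B + A * E.
have S0 : 0 < S by rewrite /S; lra.
pose c := Rmin (Rmin c1 c2 / Cf) (q / S).
have c0 : 0 < c.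
  by apply: Rmin_glb_lt; apply: Rdiv_lt_0_compat; try lra; apply: Rmin_glb_lt.
exists c; split => // t s s' xi xi' ht hs hs' hx hx' hss hxx.
have hx1 := lt_minl hxx; have hs1 := lt_minr hss.
have flowc r : 0 <= r <= T -> vnorm (vsub (Omega r 0 xi) (Omega r 0 xi')) < Rmin c1 c2.
  move=> hr; apply: Rle_lt_trans (hCf r xi xi' hr hx hx') _.
  have -> : Rmin c1 c2 = Cf * (Rmin c1 c2 / Cf) by field; lra.
  by apply: Rmult_lt_compat_l; lra.
have deriv_bound r : 0 <= r <= T -> vnorm (vadd (phi r (Omega r 0 xi'))
    (mapp (Dpsi r (Omega r 0 xi')) (eta r s' xi'))) <= S.
  move=> hr; have hO := hM r xi' hr hx'; apply: Rle_trans (vnorm_add _ _) _.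
  have := hB r _ hr hO; have := hA r _ (eta r s' xi') hr hO.
  have := Rmult_le_compat_l A _ _ ltac:(lra) (hE r s' xi' hr hs' hx'); rewrite /S; lra.
have start : vnorm (eta s s' xi') <= q.
  apply: vnorm_lub => [|i]; first lra.
  have [||r [hr e1]] := @MVT_gen (fun r => eta r s' xi' i) s' s
    (fun r => vadd (phi r (Omega r 0 xi')) (mapp (Dpsi r (Omega r 0 xi')) (eta r s' xi')) i).
  - by move=> r _; apply/is_derive_Reals; apply: (proj1 (heta s' xi')).
  - move=> r _; apply: derivable_continuous_pt; eexists; exact: (proj1 (heta s' xi')).
  have hrT : 0 <= r <= T.
    by move: hr; rewrite /Rmin /Rmax; case: Rle_dec => _; lra.
  have := e1; rewrite (proj2 (heta s' xi')) {1}/vzero Rminus_0_r => ->.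
  rewrite Rabs_mult; apply: (Rle_trans _ (S * (q / S))); last by right; field; lra.
  apply: Rmult_le_compat; try exact: Rabs_pos; last exact: Rlt_le.
  by apply: Rle_trans (vnorm_coord _ i) _; apply: deriv_bound.
have qE : 0 < q * E by apply: Rmult_lt_0_compat.
have := hC _ _ _ _ 0 T (q + q * E) ltac:(lra) ltac:(lra) (proj1 (heta s xi)) (proj1 (heta s' xi')) _ s t hs ht.
rewrite (proj2 (heta s xi)) => h.
have e1 : C * (q + (q + q * E)) <= e.
  have -> : e = C * (3 + E) * q by rewrite /q; field; split; lra.
  have := Rmult_le_pos C q ltac:(lra) ltac:(lra); lra.
apply: Rle_trans (h _) _.
- move=> r hr; have f1 := flowc r hr.
  have g1 := h1 r _ _ hr (hM r _ hr hx') (hM r _ hr hx) (lt_minl f1).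
  have g2 := h2 r _ _ (eta r s' xi') hr (hM r _ hr hx') (hM r _ hr hx) (lt_minr f1).
  set u := vsub (eta r s xi) (eta r s' xi').
  have g3 := hA r _ u hr (hM r _ hr hx).
  set D1 := Dpsi r (Omega r 0 xi) in g2 g3 *; set D2 := Dpsi r (Omega r 0 xi') in g2 *.
  have -> : vsub (vadd (phi r (Omega r 0 xi)) (mapp D1 (eta r s xi)))
     (vadd (phi r (Omega r 0 xi')) (mapp D2 (eta r s' xi')))
     = vadd (vadd (vsub (phi r (Omega r 0 xi)) (phi r (Omega r 0 xi')))
         (vsub (mapp D1 (eta r s' xi')) (mapp D2 (eta r s' xi')))) (mapp D1 u).
    by rewrite mapp_sub; vec_ring.
  apply: Rle_trans (vnorm_add _ _) _.
  have := vnorm_add (vsub (phi r (Omega r 0 xi)) (phi r (Omega r 0 xi')))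
    (vsub (mapp D1 (eta r s' xi')) (mapp D2 (eta r s' xi'))).
  by have := Rmult_le_compat_l q _ _ ltac:(lra) (hE r s' xi' hr hs' hx'); lra.
- have -> : vsub vzero (eta s s' xi') = vscale (-1) (eta s s' xi').
    by vec_ring.
  rewrite vnorm_scale Rabs_Ropp Rabs_R1 Rmult_1_l; apply: Rle_trans e1.
  by apply: Rmult_le_compat_l; lra.
Qed.

(** Gronwall twice: first [X - Omega] is of order [eps], and with that the remainder after
    [eps * eta] is at most [eps * e]. [M] comes before [e] and [eps], since the truncated system
    depends on it. *)
Lemma perturbation_expansion M1 : exists M, 0 <= M /\ forall e, 0 < e ->
  exists eps0, 0 < eps0 /\ forall eps X s xi, 0 < eps < eps0 ->
    is_solution (perturbed eps M) X -> 0 <= s <= T -> vnorm xi <= M1 -> X s = Omega s 0 xi ->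
    forall t, 0 <= t <= T -> vnorm (X t) <= M /\
      vnorm (vsub (vsub (X t) (Omega t 0 xi)) (vscale eps (eta t s xi))) <= eps * e.
Proof.
have [M2 [M20 hM]] := flow_bounded M1; pose M := M2 + 1.
have M0 : 0 <= M by rewrite /M; lra.
exists M; split => // e e0.
have [B [B0 hB]] := C1_bound phiC1 0 T M; have [A [A0 hA]] := C1_mapp_bound psiC1 0 T M2.
have [L [L0 hL]] := C1_lip psiC1 0 T M.
have [C [C1 hC]] := @gronwall_sub k L T ltac:(lra) ltac:(lra).
have [C' [C'1 hC']] := @gronwall_sub k A T ltac:(lra) ltac:(lra).
have CB : 0 < C * B by apply: Rmult_lt_0_compat; lra.
pose q := e / (C' * (1 + C * B)).
have q0 : 0 < q by apply: Rdiv_lt_0_compat => //; apply: Rmult_lt_0_compat; lra.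
have [c1 [c10 h1]] := C1_unif_cont phiC1 0 T M q0.
have [c2 [c20 h2]] := C1_linearize psiC1 0 T M q0.
(* The 1 keeps [X] in the box of size [M2 + 1], where the truncation is inactive; [c1] serves [phi]
   and [c2] the linearization of [psi]. *)
pose c := Rmin 1 (Rmin c1 c2).
have c0 : 0 < c by rewrite /c; do !apply: Rmin_glb_lt; lra.
exists (c / (C * B)); split; first exact: Rdiv_lt_0_compat.
move=> eps X s xi heps sX hs hx Xs.
have hMM r : 0 <= r <= T -> vnorm (Omega r 0 xi) <= M.
  by move=> hr; have := hM r xi hr hx; rewrite /M; lra.
have ecb : eps * (C * B) < c.
  have -> : c = c / (C * B) * (C * B) by field; lra.
  by apply: Rmult_lt_compat_r; lra.
have step1 r : 0 <= r <= T -> vnorm (vsub (X r) (Omega r 0 xi)) <= eps * (C * B).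
  move=> hr; have := hC _ _ _ _ 0 T (eps * B) ltac:(lra) ltac:(apply: Rmult_le_pos; lra)
    sX (proj1 (Om 0 xi)) _ s r hs hr.
  rewrite Xs vsubxx vnorm_zero Rplus_0_l => h; apply: Rle_trans (h _) _; last lra.
  move=> v hv; rewrite /perturbed.
  have -> : vsub (vadd (vscale eps (phi v (clampv M (X v)))) (psi v (clampv M (X v))))
      (psi v (Omega v 0 xi)) = vadd (vsub (psi v (clampv M (X v))) (psi v (Omega v 0 xi)))
       (vscale eps (phi v (clampv M (X v)))).
    by vec_ring.
  apply: Rle_trans (vnorm_add _ _) _; apply: Rplus_le_compat.
    rewrite -{1}(clampv_id (hMM v hv)).
    apply: Rle_trans (hL v _ _ hv (clampv_bound _ M0) (clampv_bound _ M0)) _.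
    by apply: Rmult_le_compat_l; [lra | apply: clampv_lip].
  rewrite vnorm_scale Rabs_pos_eq; last lra.
  by apply: Rmult_le_compat_l; [lra | apply: hB => //; apply: clampv_bound].
have [cm1 cm2] : c <= 1 /\ c <= Rmin c1 c2 by split; [apply: Rmin_l | apply: Rmin_r].
have cm3 := le_minl cm2; have cm4 := le_minr cm2.
have XM r : 0 <= r <= T -> vnorm (X r) <= M.
  move=> hr; have := step1 r hr; have := hM r xi hr hx.
  by have := vnorm_le_sub (X r) (Omega r 0 xi); rewrite /M; lra.
move=> t ht; split; first exact: XM.
have dXO r := @dlim_vsub k X (fun t => Omega t 0 xi) (fun t => perturbed eps M t (X t))
  (fun t => psi t (Omega t 0 xi)) r (sX r) (proj1 (Om 0 xi) r).
have dE r : has_deriv (fun t => vscale eps (eta t s xi)) (fun t => vscale eps (vadd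
    (phi t (Omega t 0 xi)) (mapp (Dpsi t (Omega t 0 xi)) (eta t s xi)))) r.
  by move=> i; apply: derivable_pt_lim_scal; apply: (proj1 (heta s xi)).
have := hC' _ (fun t => vscale eps (eta t s xi)) _ _ 0 T (eps * q * (1 + C * B)) ltac:(lra)
  ltac:(apply: Rmult_le_pos; [apply: Rmult_le_pos; lra | lra]) dXO dE _ s t hs ht.
have -> : vsub (vsub (X s) (Omega s 0 xi)) (vscale eps (eta s s xi)) = vzero.
  rewrite Xs vsubxx (proj2 (heta s xi)).
  by vec_ring.
rewrite vnorm_zero Rplus_0_l => h; apply: Rle_trans (h _) _.
- move=> r hr; rewrite /perturbed (clampv_id (XM r hr)).
  set u := vsub (X r) (Omega r 0 xi); set y := eta r s xi.
  (* Three parts: the variation of [phi], the linearization error of [psi], and the linear system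
     acting on the remainder itself. *)
  have -> : vsub (vsub (vadd (vscale eps (phi r (X r))) (psi r (X r))) (psi r (Omega r 0 xi)))
     (vscale eps (vadd (phi r (Omega r 0 xi)) (mapp (Dpsi r (Omega r 0 xi)) y)))
    = vadd (vadd (vscale eps (vsub (phi r (X r)) (phi r (Omega r 0 xi))))
        (vsub (vsub (psi r (X r)) (psi r (Omega r 0 xi))) (mapp (Dpsi r (Omega r 0 xi)) u)))
      (mapp (Dpsi r (Omega r 0 xi)) (vsub u (vscale eps y))).
    by rewrite mapp_sub mapp_scale; vec_ring.
  have s1 := step1 r hr; rewrite -/u in s1.
  have d1 : vnorm u < c1 by lra.
  have d2 : vnorm u < c2 by lra.
  have g1 := h1 r _ _ hr (hMM r hr) (XM r hr) d1.
  have g2 := h2 r _ _ hr (hMM r hr) (XM r hr) d2; rewrite -/u in g2.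
  have t4 := hA r _ (vsub u (vscale eps y)) hr (hM r xi hr hx).
  have g3 := Rmult_le_compat_l _ _ _ (Rlt_le _ _ q0) s1.
  apply: Rle_trans (vnorm_add _ _) _; have := vnorm_add
    (vscale eps (vsub (phi r (X r)) (phi r (Omega r 0 xi))))
    (vsub (vsub (psi r (X r)) (psi r (Omega r 0 xi))) (mapp (Dpsi r (Omega r 0 xi)) u)).
  rewrite vnorm_scale Rabs_pos_eq; last lra.
  have := Rmult_le_compat_l eps _ _ ltac:(lra) (Rlt_le _ _ g1); lra.
- by right; rewrite /q; field; split; lra.
Qed.

End Flow.

(** * The periodic solution and its location *)

Theorem theorem1 (k : nat) (T : R) (phi psi : R -> Vec k -> Vec k)
  (Dpsi : R -> Vec k -> Mat k)
  (Omega : R -> R -> Vec k -> Vec k) (eta : R -> R -> Vec k -> Vec k)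
  (U : Vec k -> Prop) :
  0 < T ->
  C1_tx phi -> C1_tx_with psi Dpsi ->
  T_periodic T phi -> T_periodic T psi ->
  (* Omega(., t0, xi) is the (global) solution of x' = psi(t,x), x(t0) = xi *)
  (forall t0 xi, is_solution psi (fun t => Omega t t0 xi) /\ Omega t0 t0 xi = xi) ->
  (* eta(., s, xi) is the solution of (2) with y(s) = 0 *)
  (forall s xi,
     is_solution (fun t y => vadd (phi t (Omega t 0 xi)) (mapp (Dpsi t (Omega t 0 xi)) y))
                 (fun t => eta t s xi) /\ eta s s xi = vzero) ->
  is_open U -> is_bounded U ->
  (* (A0) *)
  (forall xi, boundary U xi -> Omega T 0 xi = xi) ->
  (* (A1) *)
  (forall s xi, 0 <= s <= T -> boundary U xi -> vsub (eta T s xi) (eta 0 s xi) <> vzero) ->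
  (* (A2) *)
  (exists d, has_degree (fun xi => eta T 0 xi) U d /\ d <> 0%Z) ->
  exists eps0, 0 < eps0 /\
    forall eps, 0 < eps < eps0 ->
      exists x : R -> Vec k,
        is_solution (fun t y => vadd (vscale eps (phi t y)) (psi t y)) x /\
        (forall t, x (t + T) = x t) /\
        (forall t, 0 <= t <= T -> U (Omega 0 t (x t))).
Proof.
move=> T0 [Dphi phiC1] psiC1 phiT psiT Om heta oU bU A0 A1 [d [hdeg d0]].
have [M1 UM1] := bU.
have bM xi : boundary U xi -> vnorm xi <= M1 by move=> [cx _]; apply: closure_bound cx.
have [M [M0 hexp]] := perturbation_expansion T0 psiC1 Om phiC1 heta M1.
(* (A1) made quantitative: compactness and the continuity of [eta] give one lower bound for all [s]
   and all boundary points. *)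
have [a [a0 ha]] : exists a, 0 < a /\ forall s xi, 0 <= s <= T -> boundary U xi ->
    a <= vnorm (vsub (eta T s xi) (eta 0 s xi)).
  have := compact_prod (@compact_interval 0 T) (@compact_box k M1).
  move=> /(_ (fun c p => boundary U p.2 -> c <= vnorm (vsub (eta T p.1 p.2) (eta 0 p.1 p.2)))).
  case=> [c c' [s xi] c0 cc h bx|[s xi] /= [hs hx]|c [c0 hc]].
  - by have := h bx; lra.
  - have [bx|nb] := classic (boundary U xi); last first.
      have [r [r0 hr]] := not_boundary oU nb; exists r; split => // -[s' xi'] _ /= h bx'.
      by case: (hr xi' (max_ltr h)).
    have n0 := vnorm_pos (A1 s xi hs bx); set n := vnorm _ in n0.
    have [c [c0 hc]] := eta_cont T0 psiC1 Om phiC1 heta M1 (e := n / 4) ltac:(lra).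
    exists (Rmin c (n / 4)); split; first by apply: Rmin_glb_lt; lra.
    move=> [s' xi'] /= [hs' hx'] h bx'.
    have h1 := lt_minl (max_ltl h).
    have h2 := lt_minl (max_ltr h).
    have i1 := hc T s' s xi' xi ltac:(lra) hs' hs hx' hx h1 h2.
    have i2 := hc 0 s' s xi' xi ltac:(lra) hs' hs hx' hx h1 h2.
    have := vnorm_le_sub (vsub (eta T s xi) (eta 0 s xi)) (vsub (eta T s' xi') (eta 0 s' xi')).
    have -> : vsub (vsub (eta T s xi) (eta 0 s xi)) (vsub (eta T s' xi') (eta 0 s' xi'))
       = vsub (vsub (eta 0 s' xi') (eta 0 s xi)) (vsub (eta T s' xi') (eta T s xi)).
      by vec_ring.
    have := vnorm_sub_le (vsub (eta 0 s' xi') (eta 0 s xi)) (vsub (eta T s' xi') (eta T s xi)).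
    rewrite -/n; have := Rmin_r c (n / 4); lra.
  - exists c; split => // s xi hs bx; apply: (hc (s, xi)) => //=; split => //; exact: bM.
(* Two expansion errors of [a / 4] together stay below [a]. *)
have [eps0 [eps00 hE]] := hexp (a / 4) ltac:(lra).
exists eps0; split => // eps heps.
have ex xi : exists X, is_solution (perturbed psi phi eps M) X /\ X 0 = xi.
  apply: picard_lindelof.
  - exact: jcont_combine (trunc_jcont phiC1 M0) (trunc_jcont psiC1 M0).
  - exact: tlip_combine (trunc_tlip phiC1 M0) (trunc_tlip psiC1 M0).
pose X xi := proj1_sig (constructive_indefinite_description _ (ex xi)).
have hX xi : is_solution (perturbed psi phi eps M) (X xi) /\ X xi 0 = xi.
  exact: proj2_sig (constructive_indefinite_description _ (ex xi)).
have tl : tlip (perturbed psi phi eps M).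
  exact: tlip_combine (trunc_tlip phiC1 M0) (trunc_tlip psiC1 M0).
have gron A : exists C, 1 <= C /\ forall x y s t, is_solution (perturbed psi phi eps M) x ->
    is_solution (perturbed psi phi eps M) y -> Rabs s <= A -> Rabs t <= A ->
    vnorm (vsub (x t) (y t)) <= C * vnorm (vsub (x s) (y s)).
  have [L [L0 hL]] := tl A.
  have [C [C1 hC]] := @gronwall_sub k L (2 * Rabs A) ltac:(lra) ltac:(have := Rabs_pos A; lra).
  exists C; split => // x y s t sx sy hs ht.
  have A0' : 0 <= A := Rle_trans _ _ _ (Rabs_pos s) hs.
  have := hC _ _ _ _ (- A) A 0 ltac:(rewrite Rabs_pos_eq; lra) ltac:(lra) sx sy
     _ s t (proj1 (Rabs_le_between _ _) hs) (proj1 (Rabs_le_between _ _) ht).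
  by rewrite Rplus_0_r; apply => r hr; rewrite Rplus_0_r; apply: hL; apply: Rabs_le.
(* Its zeros are the starting points of periodic solutions; on the boundary, by (A0), it is within
   [a / 4] of [eta T 0], whose norm is at least [a] there. *)
pose H xi := vscale (/ eps) (vsub (X xi T) xi).
have ie : 0 < / eps by apply: Rinv_0_lt_compat; lra.
have [xi [Uxi Hxi]] : exists xi, U xi /\ H xi = vzero.
  apply: (degree_zero oU bU hdeg d0).
  - move=> x cx e e0; have [C [C1 hC]] := gron T.
    pose q := eps * e / (C + 1).
    have q0 : 0 < q by apply: Rdiv_lt_0_compat; [apply: Rmult_lt_0_compat; lra | lra].
    exists q; split => // y _ hy.
    have := hC _ _ 0 T (proj1 (hX y)) (proj1 (hX x)) ltac:(rewrite Rabs_R0; lra)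
      ltac:(rewrite Rabs_pos_eq; lra).
    rewrite !(proj2 (hX _)) => h.
    have -> : vsub (H y) (H x) = vscale (/ eps) (vsub (vsub (X y T) (X x T)) (vsub y x)).
      by apply: vec_eq => i; rewrite /H /vscale /vsub; ring.
    rewrite vnorm_scale Rabs_pos_eq; last lra.
    have h2 := vnorm_sub_le (vsub (X y T) (X x T)) (vsub y x).
    have h3 : vnorm (vsub (vsub (X y T) (X x T)) (vsub y x)) < eps * e.
      have -> : eps * e = (C + 1) * q by rewrite /q; field; lra.
      have := Rmult_lt_compat_l (C + 1) _ _ ltac:(lra) hy; lra.
    have -> : e = / eps * (eps * e) by field; lra.
    exact: Rmult_lt_compat_l.
  - move=> x bx.
    have [] := hE eps (X x) 0 x heps (proj1 (hX x)) ltac:(lra) (bM x bx) _ T ltac:(lra).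
      by rewrite (proj2 (hX x)) (proj2 (Om 0 x)).
    move=> _; rewrite (A0 x bx) => h.
    have := ha 0 x ltac:(lra) bx; rewrite (proj2 (heta 0 x)) vsubx0 => h2.
    apply: (Rle_lt_trans _ (a / 4)); last lra.
    have -> : vsub (H x) (eta T 0 x)
       = vscale (/ eps) (vsub (vsub (X x T) x) (vscale eps (eta T 0 x))).
      by apply: vec_eq => i; rewrite /H /vscale /vsub; field; lra.
    rewrite vnorm_scale Rabs_pos_eq; last lra.
    have -> : a / 4 = / eps * (eps * (a / 4)) by field; lra.
    by apply: Rmult_le_compat_l => //; lra.
have XT : X xi T = xi.
  apply: vsub_eq0; apply: vec_eq => i; have := f_equal (fun w => w i) Hxi.
  rewrite /H {1}/vscale /vzero => h.
  by case: (Rmult_integral _ _ h) => // h'; lra.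
have [sX X0] := hX xi; set x := X xi in XT sX X0 *.
(* The shifted curve solves the same system, by periodicity of the fields, and agrees with [x] at
   time 0. *)
have per t : x (t + T) = x t.
  have sY : is_solution (perturbed psi phi eps M) (fun t => x (t + T)).
    move=> r i; have := dlim_shift_arg (sX (r + T) i).
    by rewrite /perturbed phiT psiT.
  apply: vsub_eq0; apply: vnorm_eq0; have [C [C1 hC]] := gron (Rabs t).
  have := hC (fun t => x (t + T)) x 0 t sY sX ltac:(rewrite Rabs_R0; apply: Rabs_pos) (Rle_refl _).
  by rewrite Rplus_0_l XT X0 vsubxx vnorm_zero Rmult_0_r.
have UxM y : U y -> vnorm y <= M1 by apply: UM1.
(* The expansion bounds [x] on [[0, T]] and periodicity everywhere, so [x] solves the system without
   truncation. *)
have xM t : vnorm (x t) <= M.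
  have [t' [ht' <-]] := periodic_reduce T0 per t.
  have [] := hE eps x 0 xi heps sX ltac:(lra) (UxM _ Uxi) _ t' ht' => //.
  by rewrite X0 (proj2 (Om 0 xi)).
exists x; split; last split => //.
  by move=> t i; have := sX t i; rewrite /perturbed clampv_id.
move=> t1 ht1; apply: NNPP => nU.
have xc : vcont x by apply: (vcont_of_deriv (u' := fun t => perturbed psi phi eps M t (x t))).
have [|s [hs bs]] := first_exit (z := fun t => Omega 0 t (x t)) oU ht1 _ nU
  (pullback_cont T0 psiC1 Om xc).
  by rewrite X0 (proj2 (Om 0 xi)).
set y := Omega 0 s (x s) in bs.
(* By uniqueness the unperturbed solution through [(0, y)] passes through [(s, x s)], so the
   expansion applies with starting time [s] and the boundary point [y]. *)
have xs : x s = Omega s 0 y.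
  have := solution_unique T0 psiC1 (proj1 (Om 0 y)) (proj1 (Om s (x s))) (tau := 0) (t := s)
    ltac:(lra) _ hs.
  by rewrite (proj2 (Om s _)) (proj2 (Om 0 y)); apply.
have [_ i1] := hE eps x s y heps sX hs (bM y bs) xs T ltac:(lra).
have [_ i2] := hE eps x s y heps sX hs (bM y bs) xs 0 ltac:(lra).
(* Both solutions take equal values at 0 and [T]. Subtracting the expansions leaves [eps] times
   [eta T s y - eta 0 s y], of norm at most [eps * a / 2], against the lower bound [eps * a]. *)
rewrite (A0 y bs) XT in i1; rewrite (proj2 (Om 0 y)) X0 in i2.
have := ha s y hs bs.
have := vnorm_sub_le (vsub (vsub xi y) (vscale eps (eta 0 s y)))
  (vsub (vsub xi y) (vscale eps (eta T s y))).
have -> : vsub (vsub (vsub xi y) (vscale eps (eta 0 s y)))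
    (vsub (vsub xi y) (vscale eps (eta T s y)))
  = vscale eps (vsub (eta T s y) (eta 0 s y)).
  by vec_ring.
rewrite vnorm_scale Rabs_pos_eq; last lra.
move=> i3 i4; have := Rmult_le_compat_l eps _ _ ltac:(lra) i4.
have : 0 < eps * a by apply: Rmult_lt_0_compat; lra.
lra.
Qed.
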